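(* Let $0<p\le 1$ and $\alpha=\frac1p-1$. Then, with equivalent norms, $$\big(H_{p,q}^s\big)^*=BMO_2(\alpha)\quad\text{for } 0<q\le 1,$$ and $$\big(H_{p,q}^s\big)^*=BMO_{2,q}(\alpha)\quad\text{for } 1<q<\infty .$$ Here the identification is as follows: writing $X=BMO_2(\alpha)$ if $0<q\le1$ and $X=BMO_{2,q}(\alpha)$ if $1<q<\infty$, for each $g\in X$ the functional $\varphi_g(f)=\mathbb{E}(fg)$, $f\in L_2$, extends uniquely to a continuous linear functional on $H_{p,q}^s$; every continuous linear functional on $H_{p,q}^s$ is of this form for some $g\in X$; and $\|\varphi_g\|_{(H_{p,q}^s)^*}\approx\|g\|_X$ with constants independent of $g$.
   Context: Setting: $(\Omega,\mathcal{F},\mathbb{P})$ is a complete probability space and $\{\mathcal{F}_n\}_{n\ge 0}$ is a nondecreasing sequence of sub-$\sigma$-algebras of $\mathcal{F}$ with $\mathcal{F}=\sigma(\bigcup_n\mathcal{F}_n)$ and the convention $\mathcal{F}_{-1}=\mathcal{F}_0$. $\mathbb{E}$ is expectation and $\mathbb{E}_n$ is conditional expectation given $\mathcal{F}_n$. $\mathcal{M}$ is the set of martingales $f=(f_n)_{n\ge0}$ relative to $\{\mathcal{F}_n\}$ with $f_0=0$; $d_if=f_i-f_{i-1}$. A function $f\in L_r$ ($1\le r\le\infty$) is identified with the martingale $f_n=\mathbb{E}_n f$ (so elements of $L_r$ are understood to satisfy $\mathbb{E}_0f=0$), and $f$ also denotes the limit $f_\infty$. Lorentz quasi-norm: for $0<p<\infty$,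 $0<q<\infty$, $\|h\|_{p,q}=\big(q\int_0^\infty (t\,\mathbb{P}(|h|>t)^{1/p})^q\frac{dt}{t}\big)^{1/q}$. Hardy–Lorentz space: $s(f)=\big(\sum_{i=1}^\infty\mathbb{E}_{i-1}|d_if|^2\big)^{1/2}$ and $H_{p,q}^s=\{f\in\mathcal{M}:\ \|f\|_{H_{p,q}^s}=\|s(f)\|_{p,q}<\infty\}$. Its dual $(H_{p,q}^s)^*$ is the space of continuous linear functionals with norm $\|\varphi\|=\sup\{|\varphi(f)|:\|f\|_{H^s_{p,q}}\le1\}$. Stopping times take values in $\{0,1,2,\dots\}\cup\{\infty\}$, $\mathcal{T}$ is the set of all of them; $f^\nu=(f_{n\wedge\nu})_{n\ge0}$, and $f-f^\nu$ as a function means the difference of the limit functions (so it vanishes on $\{\nu=\infty\}$). For $1\le r<\infty$, $\alpha\ge0$, $$BMO_r(\alpha)=\{f\in L_r:\ \|f\|_{BMO_r(\alpha)}=\sup_{\nu\in\mathcal{T}}\mathbb{P}(\nu<\infty)^{-\frac1r-\alpha}\|f-f^\nu\|_r<\infty\}.$$ For $1\le r,q<\infty$, $\alpha\ge0$, $$BMO_{r,q}(\alpha)=\Big\{f\in L_r:\ \|f\|_{BMO_{r,q}(\alpha)}=\sup\frac{\sum_{k\in\mathbb{Z}}2^k\,\mathbb{P}(\nu_k<\infty)^{1-\frac1r}\|f-f^{\nu_k}\|_r}{\big(\sum_{k\in\mathbb{Z}}(2^k\mathbb{P}(\nu_k<\infty)^{1+\alpha})^q\big)^{1/q}}<\infty\Big\},$$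 where the supremum is over all sequences of stopping times $\{\nu_k\}_{k\in\mathbb{Z}}$ with $\{2^k\mathbb{P}(\nu_k<\infty)^{1+\alpha}\}_{k\in\mathbb{Z}}\in\ell_q$. Terms with $\mathbb{P}(\nu<\infty)=0$ (i.e. $0/0$) are counted as $0$. $A\approx B$ means $C_1B\le A\le C_2B$ for positive constants $C_1,C_2$. *)

(* Defs.v *)
From HB Require Import structures.
From mathcomp Require Import all_boot all_order all_algebra.
From mathcomp Require Import all_classical all_reals all_analysis.
From mathcomp Require Import measurable_realfun.

Set Implicit Arguments.
Unset Strict Implicit.
Unset Printing Implicit Defensive.

Import Order.TTheory GRing.Theory Num.Theory.
Import numFieldNormedType.Exports.

Local Open Scope classical_set_scope.
Local Open Scope ring_scope.

(* The last clause is an equality of sigma-algebras, not an equality up to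
   null sets. *)
Definition filtration d (T : measurableType d) (F : nat -> set (set T)) : Prop :=
  [/\ forall n, sigma_algebra [set: T] (F n),
      forall n, F n `<=` measurable,
      forall m n, (m <= n)%N -> F m `<=` F n
    & (measurable : set (set T)) = <<s \bigcup_n F n >> ].

(* Measurability with respect to a sub-sigma-algebra G: when G is a
   sigma-algebra on T, the measurable sets of [g_sigma_algebraType G] are
   exactly the elements of G. *)
Definition measurable_wrt (T : pointedType) (G : set (set T)) d' (U : measurableType d')
    (f : T -> U) : Prop :=
  measurable_fun [set: g_sigma_algebraType G] (f : g_sigma_algebraType G -> U).

Definition is_cexp d (T : measurableType d) (R : realType)
    (P : probability T R) (G : set (set T)) (f Y : T -> R) : Prop :=
  [/\ measurable_wrt G Y,
      P.-integrable setT (EFin \o Y)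
    & forall A, G A ->
        (\int[P]_(x in A) (Y x)%:E = \int[P]_(x in A) (f x)%:E)%E].

(* A chosen version of E[f | G]; meaningful for integrable f. *)
Definition cexp d (T : measurableType d) (R : realType)
    (P : probability T R) (G : set (set T)) (f : T -> R) : T -> R :=
  xget (cst 0) [set Y | is_cexp P G f Y].

Definition is_cexp_ge0 d (T : measurableType d) (R : realType)
    (P : probability T R) (G : set (set T)) (h Y : T -> \bar R) : Prop :=
  [/\ measurable_wrt G Y,
      forall x, (0 <= Y x)%E
    & forall A, G A -> (\int[P]_(x in A) Y x = \int[P]_(x in A) h x)%E].

(* A chosen version of E[h | G] for measurable h >= 0, not necessarily
   integrable; needed because the increments of a martingale in a Hardy space
   need not be square-integrable. *)
Definition cexp_ge0 d (T : measurableType d) (R : realType)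
    (P : probability T R) (G : set (set T)) (h : T -> \bar R) : T -> \bar R :=
  xget (cst 0%E) [set Y | is_cexp_ge0 P G h Y].

(* Martingales starting at 0, that is, the set M. *)
Definition martingale0 d (T : measurableType d) (R : realType)
    (P : probability T R) (F : nat -> set (set T)) : set (nat -> T -> R) :=
  [set f | [/\ forall n, measurable_wrt (F n) (f n),
               forall n, P.-integrable setT (EFin \o f n),
               forall m n, (m <= n)%N -> cexp P (F m) (f n) = f m %[ae P]
             & f 0%N = cst 0 %[ae P] ] ].

Definition mart d (T : measurableType d) (R : realType)
    (P : probability T R) (F : nat -> set (set T)) (f : T -> R) :
    nat -> T -> R :=
  fun n => cexp P (F n) f.

(* L_r, with the convention that its elements satisfy E_0 f = 0. *)
Definition Lr0 d (T : measurableType d) (R : realType)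
    (P : probability T R) (F : nat -> set (set T)) (r : R) : set (T -> R) :=
  [set f | f \in Lfun P r%:E /\ cexp P (F 0%N) f = cst 0 %[ae P] ].

Definition lorentz_norm d (T : measurableType d) (R : realType)
    (P : probability T R) (p q : R) (h : T -> \bar R) : \bar R :=
  ((q%:E * \int[lebesgue_measure]_(t in `]0%R, +oo[)
      ((t * fine (P [set x | (t%:E < `|h x|)%E]) `^ p^-1) `^ q / t)%:E)
    `^ q^-1)%E.

(* The conditional square function s(f); the term of index i is
   E_i |d_(i+1) f|^2. *)
Definition cond_square_fun d (T : measurableType d) (R : realType)
    (P : probability T R) (F : nat -> set (set T)) (f : nat -> T -> R)
    (x : T) : \bar R :=
  ((\sum_(0 <= i <oo)
      cexp_ge0 P (F i) (fun y => (`|f i.+1 y - f i y| ^+ 2)%:E) x)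
    `^ (2^-1))%E.

Definition hardy_norm d (T : measurableType d) (R : realType)
    (P : probability T R) (F : nat -> set (set T)) (p q : R)
    (f : nat -> T -> R) : \bar R :=
  lorentz_norm P p q (cond_square_fun P F f).

Definition hardy d (T : measurableType d) (R : realType)
    (P : probability T R) (F : nat -> set (set T)) (p q : R) :
    set (nat -> T -> R) :=
  [set f | martingale0 P F f /\ (hardy_norm P F p q f < +oo)%E].

(* A functional on the subspace H is represented by a total function, of which
   only the values on H matter.  Martingales are not quotiented by almost
   sure equality: linearity and continuity force phi to respect it. *)
Definition continuous_linear_on (R : realType) (V : lmodType R) (H : set V)
    (N : V -> \bar R) (phi : V -> R) : Prop :=
  (forall (a : R) f h, H f -> H h -> phi (a *: f + h) = a * phi f + phi h) /\
  (forall f, H f -> forall e : R, 0 < e -> exists2 delta : R, 0 < delta &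
     forall h, H h -> (N (h - f)%R < delta%:E)%E -> `|phi h - phi f| < e).

Definition dual_norm (R : realType) (V : lmodType R) (H : set V)
    (N : V -> \bar R) (phi : V -> R) : \bar R :=
  ereal_sup [set (`|phi f|)%:E | f in [set f | H f /\ (N f <= 1)%E]].

(* [None] is the value infinity. *)
Definition stopping_time T (F : nat -> set (set T)) : set (T -> option nat) :=
  [set nu | forall n, F n [set x | exists2 m, (m <= n)%N & nu x = Some m]].

Definition prob_finite d (T : measurableType d) (R : realType)
    (P : probability T R) (nu : T -> option nat) : R :=
  fine (P [set x | nu x <> None]).

(* The limit function of the stopped martingale (E_(min n nu) g)_n: it is
   E_nu g where nu is finite, and g_oo = g where nu = oo. *)
Definition stopped_limit d (T : measurableType d) (R : realType)
    (P : probability T R) (F : nat -> set (set T)) (g : T -> R)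
    (nu : T -> option nat) : T -> R :=
  fun x => if nu x is Some n then mart P F g n x else g x.

Definition stopped_diff_norm d (T : measurableType d) (R : realType)
    (P : probability T R) (F : nat -> set (set T)) (r : R) (g : T -> R)
    (nu : T -> option nat) : \bar R :=
  'N[P]_(r%:E)[EFin \o (g \- stopped_limit P F g nu)%R]%E.

(* Since [0 `^ a = 0] for a != 0, stopping times with P(nu < oo) = 0
   contribute 0. *)
Definition bmo_norm d (T : measurableType d) (R : realType)
    (P : probability T R) (F : nat -> set (set T)) (r alpha : R)
    (g : T -> R) : \bar R :=
  ereal_sup [set ((prob_finite P nu `^ (- r^-1 - alpha))%:E
                   * stopped_diff_norm P F r g nu)%E
            | nu in stopping_time F].

Definition bmo d (T : measurableType d) (R : realType)
    (P : probability T R) (F : nat -> set (set T)) (r alpha : R) :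
    set (T -> R) :=
  [set g | Lr0 P F r g /\ (bmo_norm P F r alpha g < +oo)%E].

Definition bmo_q_num d (T : measurableType d) (R : realType)
    (P : probability T R) (F : nat -> set (set T)) (r : R) (g : T -> R)
    (nu : int -> T -> option nat) : \bar R :=
  (\esum_(k in [set: int])
     ((2 ^ k * prob_finite P (nu k) `^ (1 - r^-1))%:E
       * stopped_diff_norm P F r g (nu k)))%E.

Definition bmo_q_den d (T : measurableType d) (R : realType)
    (P : probability T R) (q alpha : R) (nu : int -> T -> option nat) :
    \bar R :=
  ((\esum_(k in [set: int])
     ((2 ^ k * prob_finite P (nu k) `^ (1 + alpha)) `^ q)%:E) `^ q^-1)%E.

(* The denominator is finite on the range of the supremum; when it vanishes
   the quotient is 0 because [0^-1 = 0]. *)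
Definition bmo_q_norm d (T : measurableType d) (R : realType)
    (P : probability T R) (F : nat -> set (set T)) (r q alpha : R)
    (g : T -> R) : \bar R :=
  ereal_sup [set (bmo_q_num P F r g nu
                   * ((fine (bmo_q_den P q alpha nu))^-1)%:E)%E
            | nu in [set nu : int -> T -> option nat |
                (forall k, stopping_time F (nu k)) /\
                (bmo_q_den P q alpha nu < +oo)%E]].

Definition bmo_q d (T : measurableType d) (R : realType)
    (P : probability T R) (F : nat -> set (set T)) (r q alpha : R) :
    set (T -> R) :=
  [set g | Lr0 P F r g /\ (bmo_q_norm P F r q alpha g < +oo)%E].

(* phi agrees on L_2 with f |-> E(f g). *)
Definition extends_pairing d (T : measurableType d) (R : realType)
    (P : probability T R) (F : nat -> set (set T)) (g : T -> R)
    (phi : (nat -> T -> R) -> R) : Prop :=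
  forall f, Lr0 P F 2 f -> ((phi (mart P F f))%:E = 'E_P[f \* g])%E.

(* The dual of (H, N) is X with an equivalent norm NX, the element g of X
   acting by f |-> E(f g) on L_2. *)
Definition dual_is d (T : measurableType d) (R : realType)
    (P : probability T R) (F : nat -> set (set T))
    (H : set (nat -> T -> R)) (N : (nat -> T -> R) -> \bar R)
    (X : set (T -> R)) (NX : (T -> R) -> \bar R) : Prop :=
  [/\ Lr0 P F 2 `<=` [set f | H (mart P F f)],
      forall g, X g -> exists phi : (nat -> T -> R) -> R,
        [/\ continuous_linear_on H N phi,
            extends_pairing P F g phi
          & forall psi : (nat -> T -> R) -> R,
              continuous_linear_on H N psi -> extends_pairing P F g psi ->
              forall f, H f -> psi f = phi f],
      forall phi : (nat -> T -> R) -> R, continuous_linear_on H N phi ->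
        exists2 g, X g & extends_pairing P F g phi
    & exists C1 C2 : R, [/\ 0 < C1, 0 < C2 &
        forall g (phi : (nat -> T -> R) -> R), X g ->
          continuous_linear_on H N phi -> extends_pairing P F g phi ->
          (C1%:E * NX g <= dual_norm H N phi /\
           dual_norm H N phi <= C2%:E * NX g)%E] ].

(* Main.v *)
Require Import Defs.
From HB Require Import structures.
From mathcomp Require Import all_boot all_order all_algebra.
From mathcomp Require Import all_classical all_reals all_analysis.
From mathcomp Require Import measurable_realfun.
From mathcomp Require Import ring lra zify.

(** The Lorentz quasi-norm of [h], to the power [q], is equivalent to the dyadic
    sum of the terms [(2 ^ k * P(|h| > 2 ^ k) `^ p^-1) `^ q] over all integers
    [k] ([lorentz_norm_dyadic]).  So the Hardy quasi-norm of a martingale [f] is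
    a matter of the probabilities [P(s(f) > 2 ^ k)] ([hardy_norm_dyadic]), and
    the theorem rests on two estimates of the pairing [E(f g)] in these terms.

    Direct estimate.  Let [nu_k] be the first time at which the next value of
    the conditional square function, which is predictable, exceeds [2 ^ k].
    Then [nu_k] is finite exactly when [s(f) > 2 ^ k].  The layer of [f] in
    which the square function is between [2 ^ k] and [2 ^ (k + 1)] has [L_2]
    norm at most [2 ^ (k + 1) * P(nu_k < oo) `^ 2^-1].  It lives after [nu_k],
    so it pairs with [g] as it does with [g - g^nu_k].  Hence [E(f g)] is at
    most twice the sum of [2 ^ k * P(nu_k < oo) `^ 2^-1 * ||g - g^nu_k||]
    ([pairing_le]).  This sum is the numerator in the norm of [BMO_(2,q)] for
    the family [nu_k], and the denominator is the dyadic sum of [f].  For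
    [q <= 1] the inclusion of [l^q] in [l^1] reduces the family to its members
    ([pairing_le_bmo], [pairing_le_bmo_q]).

    Converse estimate.  For any family of stopping times [nu_k], the sum of
    [2 ^ k * P(nu_k < oo) `^ 2^-1 * (g - g^nu_k) / ||g - g^nu_k||] is tested
    against [g].  The pairing is the numerator of the norm of [g], because
    [g - g^nu] is orthogonal to [g^nu] ([ip_stopped_tail]).  The Hardy
    quasi-norm of the sum is at most a multiple of the denominator
    ([atomic_estimate]): the probability that its square function exceeds
    [2 ^ m] is estimated by the Chebyshev inequality for the terms with
    [k < m], and by the probability that [nu_k] is finite for the others.  As
    [p < 2], both contributions are convolutions with geometric sequences
    ([atomic_sum_le]).  A single stopping time gives the norm of [BMO_2]
    ([testing], [bmo_norms_le]).

    Duality.  Truncating the increments shows that [L_2] is dense in the Hardy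
    space ([hardy_dense]), so the pairing with [g] extends uniquely
    ([functional_extension], [eq_on_dense]).  A continuous functional is
    bounded on [L_2], which embeds in the Hardy space ([hardy_norm_le_nrm2]);
    it is represented there by some [g] ([riesz_L2]), and the converse estimate
    bounds the norm of [g] ([dual_of_bounds]). *)

Set Implicit Arguments.
Unset Strict Implicit.
Unset Printing Implicit Defensive.

Import Order.TTheory GRing.Theory Num.Theory.
Import numFieldNormedType.Exports.

Local Open Scope classical_set_scope.
Local Open Scope ring_scope.


(** * Dyadic sums of real numbers *)

Lemma geometric_sum_le (R : realType) (x : R) n :
  0 < x -> x < 1 -> \sum_(0 <= i < n) x ^+ i <= (1 - x)^-1.
Proof.
move=> x0 x1; have x1' : 0 < 1 - x by rewrite subr_gt0.
rewrite -[leRHS]mul1r ler_pdivlMr // mulrC big_mkord.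
have -> : (1 - x) * \sum_(i < n) x ^+ i = 1 - x ^+ n.
  by rewrite -[RHS]opprB subrX1 -mulNr opprB.
by rewrite gerBl exprn_ge0 // ltW.
Qed.

(** The exponent is [`|m - k|], as a sum of two truncated differences. *)
Lemma two_sided_geometric_sum_le (R : realType) (x : R) n k :
  0 < x -> x < 1 ->
  \sum_(0 <= m < n) x ^+ ((m - k) + (k - m))%N <= 2 / (1 - x).
Proof.
move=> x0 x1; have x1' : 0 < 1 - x by rewrite subr_gt0.
have xge0 j : 0 <= x ^+ j by rewrite exprn_ge0 // ltW.
have split_at : \sum_(0 <= m < n) x ^+ ((m - k) + (k - m))%N <=
    \sum_(0 <= m < k) x ^+ (k - m)%N + \sum_(0 <= m < n - k) x ^+ m.
  have [nk|kn] := leqP n k.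
    have -> : (n - k = 0)%N by apply/eqP; rewrite subn_eq0.
    rewrite [X in _ + X]big_geq // addr0 (big_cat_nat (n := n) (p := k)) //=.
    rewrite -[leLHS]addr0 lerD //; last by rewrite sumr_ge0.
    rewrite big_nat [leRHS]big_nat ler_sum // => m /andP[_ mn].
    by have -> : (m - k = 0)%N by
      apply/eqP; rewrite subn_eq0 (leq_trans (ltnW mn)).
  rewrite (big_cat_nat (n := k)) //=; last exact: ltnW.
  rewrite lerD //.
    rewrite big_nat [leRHS]big_nat ler_sum // => m /andP[_ mn].
    by have -> : (m - k = 0)%N by apply/eqP; rewrite subn_eq0 ltnW.
  rewrite -{1}[k]add0n big_addn big_nat [leRHS]big_nat ler_sum // => m _.
  rewrite addnK; have -> : (k - (m + k) = 0)%N.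
    by apply/eqP; rewrite subn_eq0 leq_addl.
  by rewrite addn0.
apply: (le_trans split_at).
rewrite mulr2n mulrDl !mul1r lerD ?geometric_sum_le //.
apply: le_trans (geometric_sum_le k x0 x1).
rewrite !big_mkord (reindex_inj rev_ord_inj) /= ler_sum // => i _.
rewrite subKn // exprS -[leRHS]mul1r ler_wpM2r //; exact: ltW.
Qed.

(** For exponents at least 1 this is Young's inequality for convolutions, but
    no convexity enters: half of the geometric decay turns the inner sum into
    a maximum, which is at most an [e]-norm, and the other half makes the
    double sum converge. *)
Lemma geometric_convolution_le (R : realType) (x e : R) :
  0 < x -> x < 1 -> 0 < e -> exists2 C : R, 0 < C &
  forall n (y : nat -> R), (forall k, 0 <= y k) ->
    \sum_(0 <= m < n) (\sum_(0 <= k < n) x ^+ ((m - k) + (k - m)) * y k) `^ e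
      <= C * \sum_(0 <= k < n) y k `^ e.
Proof.
move=> x0 x1 e0.
pose s := Num.sqrt x; have s0 : 0 < s by rewrite sqrtr_gt0.
have sx : s * s = x by rewrite -expr2 sqr_sqrtr // ltW.
have s1 : s < 1 by rewrite -[ltRHS]sqrtr1 ltr_sqrt.
pose t := s `^ e; have t0 : 0 < t by rewrite powR_gt0.
have t1 : t < 1.
  have <- : 1 `^ e = 1 :> R by rewrite powR1.
  by rewrite /t gt0_ltr_powR // nnegrE ltW.
have s1' : 0 < 1 - s by rewrite subr_gt0.
have t1' : 0 < 1 - t by rewrite subr_gt0.
exists ((2 / (1 - s)) `^ e * (2 / (1 - t))).
  by rewrite mulr_gt0 ?powR_gt0 ?divr_gt0.
move=> n y y0.
pose X m := \sum_(0 <= k < n) t ^+ ((m - k) + (k - m)) * y k `^ e.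
have term0 m k : 0 <= t ^+ ((m - k) + (k - m)) * y k `^ e.
  by rewrite mulr_ge0 ?powR_ge0 ?exprn_ge0 // ltW.
have X0 m : 0 <= X m by rewrite sumr_ge0.
have sy m k : (k < n)%N -> s ^+ ((m - k) + (k - m)) * y k <= X m `^ e^-1.
  move=> kn; have sy0 : 0 <= s ^+ ((m - k) + (k - m)) * y k.
    by rewrite mulr_ge0 // exprn_ge0 // ltW.
  have -> : s ^+ ((m - k) + (k - m)) * y k =
      ((s ^+ ((m - k) + (k - m)) * y k) `^ e) `^ e^-1.
    by rewrite -powRrM mulfV ?gt_eqF // powRr1.
  rewrite ge0_ler_powR ?nnegrE ?invr_ge0 ?powR_ge0 ?(ltW e0) //.
  rewrite powRM // ?exprn_ge0 // ?(ltW s0) //.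
  have -> : (s ^+ ((m - k) + (k - m))) `^ e = t ^+ ((m - k) + (k - m)).
    by rewrite -[s ^+ _]powR_mulrn ?(ltW s0) // powRAC powR_mulrn ?powR_ge0.
  rewrite /X (bigD1_seq k) ?mem_index_iota ?iota_uniq //= lerDl.
  by rewrite sumr_ge0.
have inner m : \sum_(0 <= k < n) x ^+ ((m - k) + (k - m)) * y k <=
    2 / (1 - s) * X m `^ e^-1.
  apply: le_trans
    (ler_wpM2r (powR_ge0 _ _) (two_sided_geometric_sum_le n m s0 s1)).
  rewrite mulr_suml big_nat [leRHS]big_nat ler_sum // => k /andP[_ kn].
  rewrite -sx exprMn -mulrA addnC ler_wpM2l ?exprn_ge0 ?(ltW s0) //.
  by rewrite addnC sy.
have outer m :
    (\sum_(0 <= k < n) x ^+ ((m - k) + (k - m)) * y k) `^ e <=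
    (2 / (1 - s)) `^ e * X m.
  have sum0 : 0 <= \sum_(0 <= k < n) x ^+ ((m - k) + (k - m)) * y k.
    by rewrite sumr_ge0 // => k _; rewrite mulr_ge0 // exprn_ge0 // ltW.
  have c0 : 0 <= 2 / (1 - s) by rewrite divr_ge0 // ltW.
  apply: (le_trans (ge0_ler_powR (ltW e0) _ _ (inner m))).
  - by rewrite nnegrE.
  - by rewrite nnegrE mulr_ge0 // powR_ge0.
  by rewrite powRM // ?powR_ge0 // -powRrM mulVf ?gt_eqF // powRr1.
apply: (@le_trans _ _ (\sum_(0 <= m < n) (2 / (1 - s)) `^ e * X m)).
  by rewrite ler_sum.
rewrite -mulr_sumr -mulrA ler_wpM2l ?powR_ge0 //.
rewrite /X exchange_big /= mulr_sumr ler_sum // => k _.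
by rewrite -mulr_suml ler_wpM2r ?powR_ge0 // two_sided_geometric_sum_le.
Qed.

Lemma powRD_le (R : realType) (x y e : R) :
  0 < e -> 0 <= x -> 0 <= y -> (x + y) `^ e <= 2 `^ e * (x `^ e + y `^ e).
Proof.
move=> e0 x0 y0; wlog xy : x y x0 y0 / x <= y.
  move=> H; have [xy|/ltW yx] := leP x y; first exact: H.
  by rewrite [x + y]addrC [x `^ e + _]addrC; apply: H.
apply: (@le_trans _ _ ((2 * y) `^ e)).
  by rewrite ge0_ler_powR ?nnegrE ?(ltW e0) ?addr_ge0 ?mulr_ge0 //; lra.
by rewrite powRM // ler_wpM2l ?powR_ge0 // lerDr powR_ge0.
Qed.

(** The real-variable core of the atomic estimate.  The number [A k] is the
    probability of the support of the [k]-th atom and [G m] that of the square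
    function of their sum exceeding [2 ^+ m]: the atoms with [k < m] are
    controlled by their size, the others by their support.  Both parts are
    convolutions of [2 ^+ k * A k `^ p^-1], raised to the power [p / 2] and
    [p] respectively, with geometric sequences. *)
Lemma atomic_sum_le (R : realType) (p q : R) :
  0 < p -> p < 2 -> 0 < q -> exists2 C : R, 0 < C &
  forall n (A G : nat -> R), (forall k, 0 <= A k) -> (forall k, 0 <= G k) ->
    (forall m, (m < n)%N ->
      G m <= 2 * (2 ^+ m)^-2 *
               (\sum_(0 <= k < m) 2 ^+ k * A k `^ 2^-1) ^+ 2
             + \sum_(m <= k < n) A k) ->
    \sum_(0 <= m < n) (2 ^+ m * G m `^ p^-1) `^ q <=
    C * \sum_(0 <= k < n) (2 ^+ k * A k `^ p^-1) `^ q.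
Proof.
move=> p0 p2 q0.
pose e := q / p; have e0 : 0 < e by rewrite divr_gt0.
pose t : R := 2 `^ p; have t0 : 0 < t by rewrite powR_gt0.
have tE m : t ^+ m = (2 ^+ m) `^ p.
  by rewrite -[t ^+ m]powR_mulrn ?(ltW t0) // powRAC powR_mulrn.
have t1 : 1 < t.
  by rewrite -(powRr0 (2 : R)) /t /powR gt_eqF // ltr_expR ltr_pM2r ?ln_gt0 ?ltr1n.
pose u : R := 2 `^ (p / 2 - 1); have u0 : 0 < u by rewrite powR_gt0.
have u1 : u < 1.
  rewrite -(powRr0 (2 : R)) /u /powR gt_eqF // ltr_expR ltr_pM2r ?ln_gt0 ?ltr1n //.
  by rewrite subr_lt0 ltr_pdivrMr // mul1r.
have two0 m : 0 < (2 : R) ^+ m by rewrite exprn_gt0.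
have ut k m : (k < m)%N -> (2 ^+ m)^-1 * 2 ^+ k * (t ^+ k) `^ (- 2^-1) *
    (t ^+ m) `^ 2^-1 = u ^+ (m - k) :> R.
  move=> km.
  rewrite !tE -!powRrM -(powR_mulrn m) // -(powR_mulrn k) // -!powRrM -powRN.
  rewrite -!powRD ?pnatr_eq0 ?implybT // -powR_mulrn ?powR_ge0 //.
  rewrite -powRrM natrB 1?ltnW //; congr (_ `^ _); lra.
have t'1 : t^-1 < 1 by rewrite invf_lt1.
have t'0 : 0 < t^-1 by rewrite invr_gt0.
have [C1 C10 HC1] := geometric_convolution_le t'0 t'1 e0.
have [C2 C20 HC2] := geometric_convolution_le u0 u1 (mulr_gt0 (ltr0n _ 2) e0).
exists (2 `^ e * (2 `^ e * C2 + C1)).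
  by rewrite mulr_gt0 ?powR_gt0 // addr_gt0 // mulr_gt0 // powR_gt0.
move=> n A G A0 G0 GA.
pose y k := t ^+ k * A k.
have y0 k : 0 <= y k by rewrite mulr_ge0 // exprn_ge0 // ltW.
have powE (B : nat -> R) k : 0 <= B k ->
    (2 ^+ k * B k `^ p^-1) `^ q = (t ^+ k * B k) `^ e.
  move=> B0; rewrite /e [q / p]mulrC powRrM; congr (_ `^ _).
  rewrite powRM // ?exprn_ge0 // ?(ltW t0) //; congr (_ * _).
  by rewrite tE -powRrM mulfV ?gt_eqF // powRr1 // ltW.
suff tsum : \sum_(0 <= m < n) (t ^+ m * G m) `^ e <=
    2 `^ e * (2 `^ e * C2 + C1) * \sum_(0 <= k < n) y k `^ e.
  apply: le_trans (le_trans _ tsum) _.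
    by rewrite ler_sum // => m _; rewrite (powE G).
  rewrite ler_wpM2l //; last by rewrite ler_sum // => k _; rewrite (powE A).
  by rewrite mulr_ge0 ?powR_ge0 // addr_ge0 ?mulr_ge0 ?powR_ge0 // ltW.
pose small m := \sum_(0 <= k < n) u ^+ ((m - k) + (k - m)) * y k `^ 2^-1.
pose large m := \sum_(0 <= k < n) t^-1 ^+ ((m - k) + (k - m)) * y k.
have small0 m : 0 <= small m.
  by rewrite sumr_ge0 // => k _; rewrite mulr_ge0 ?powR_ge0 ?exprn_ge0 // ltW.
have large0 m : 0 <= large m.
  by rewrite sumr_ge0 // => k _; rewrite mulr_ge0 ?exprn_ge0 // ltW.
have tG m : (m < n)%N -> t ^+ m * G m <= 2 * small m ^+ 2 + large m.
  move=> mn; apply: (le_trans (ler_wpM2l (exprn_ge0 _ (ltW t0)) (GA _ mn))).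
  rewrite mulrDr lerD //.
    pose Z := \sum_(0 <= k < m) 2 ^+ k * A k `^ 2^-1.
    have Z0 : 0 <= Z.
      by rewrite sumr_ge0 // => k _; rewrite mulr_ge0 ?powR_ge0 // ltW.
    have -> : t ^+ m * (2 * (2 ^+ m)^-2 * Z ^+ 2) =
        2 * ((t ^+ m) `^ 2^-1 * (2 ^+ m)^-1 * Z) ^+ 2.
      rewrite !exprMn -[((t ^+ m) `^ _) ^+ 2]powR_mulrn ?powR_ge0 // -powRrM.
      by rewrite mulVf // powRr1 ?exprn_ge0 ?(ltW t0) // exprVn; ring.
    rewrite ler_wpM2l // lerXn2r ?nnegrE //.
      by rewrite !mulr_ge0 ?powR_ge0 ?invr_ge0 // ltW.
    rewrite /small /Z [leRHS](big_cat_nat (n := m)) //=; last exact: ltnW.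
    rewrite -[leLHS]addr0 lerD //; last first.
      by rewrite sumr_ge0 // => k _; rewrite mulr_ge0 ?powR_ge0 ?exprn_ge0 // ltW.
    rewrite mulr_sumr le_eqVlt; apply/orP; left; apply/eqP.
    apply: eq_big_nat => k /andP[_ km].
    have -> : (k - m = 0)%N by apply/eqP; rewrite subn_eq0 ltnW.
    rewrite addn0 -ut // /y powRM ?exprn_ge0 ?(ltW t0) //.
    have -> : (t ^+ k) `^ (- 2^-1) = ((t ^+ k) `^ 2^-1)^-1 by rewrite powRN.
    have nz : (t ^+ k) `^ 2^-1 != 0 by rewrite gt_eqF // powR_gt0 // exprn_gt0.
    by field; rewrite nz gt_eqF.
  rewrite mulr_sumr /large [leRHS](big_cat_nat (n := m)) //=; last exact: ltnW.
  rewrite -[leLHS]add0r lerD //.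
    by rewrite sumr_ge0 // => k _; rewrite mulr_ge0 ?exprn_ge0 // ltW.
  rewrite le_eqVlt; apply/orP; left; apply/eqP.
  apply: eq_big_nat => k /andP[mk _].
  have -> : (m - k = 0)%N by apply/eqP; rewrite subn_eq0.
  rewrite add0n /y mulrA exprVn; congr (_ * _).
  by rewrite -{2}(subnK mk) exprD mulrA mulVf ?mul1r // gt_eqF // exprn_gt0.
apply: (@le_trans _ _
    (\sum_(0 <= m < n) 2 `^ e * (2 `^ e * small m `^ (2 * e) + large m `^ e))).
  rewrite big_nat [leRHS]big_nat ler_sum // => m /andP[_ mn].
  have s0 : 0 <= 2 * small m ^+ 2 by rewrite mulr_ge0 // exprn_ge0.
  apply: (le_trans (ge0_ler_powR (ltW e0) _ _ (tG _ mn))).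
  - by rewrite nnegrE mulr_ge0 // exprn_ge0 // ltW.
  - by rewrite nnegrE addr_ge0.
  apply: (le_trans (powRD_le e0 s0 (large0 m))).
  by rewrite powRM ?exprn_ge0 // -[small m ^+ 2]powR_mulrn // -powRrM.
rewrite -mulr_sumr -mulrA ler_wpM2l ?powR_ge0 // big_split /= [leRHS]mulrDl.
rewrite lerD // ?HC1 //.
rewrite -mulr_sumr -mulrA ler_wpM2l ?powR_ge0 //.
have := HC2 n (fun k => y k `^ 2^-1) (fun k => powR_ge0 _ _).
congr (_ <= _ * _); apply: eq_bigr => k _.
by rewrite -powRrM mulrA mulVf // mul1r.
Qed.

(** The inclusion of [l^q] in [l^1] for [q <= 1]. *)
Lemma sum_le_powR_sum (R : realType) (q : R) n (x : nat -> R) :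
  0 < q -> q <= 1 -> (forall k, 0 <= x k) ->
  \sum_(0 <= k < n) x k <= (\sum_(0 <= k < n) x k `^ q) `^ q^-1.
Proof.
move=> q0 q1 x0; set S := \sum_(0 <= k < n) x k `^ q.
have S0 : 0 <= S by rewrite sumr_ge0 // => k _; rewrite powR_ge0.
pose M := S `^ q^-1; have M0 : 0 <= M by rewrite powR_ge0.
have xM k : (k < n)%N -> x k <= M.
  move=> kn; have -> : x k = (x k `^ q) `^ q^-1.
    by rewrite -powRrM mulfV ?gt_eqF // powRr1.
  rewrite ge0_ler_powR ?nnegrE ?invr_ge0 ?powR_ge0 ?(ltW q0) //.
  rewrite /S (bigD1_seq k) ?mem_index_iota ?iota_uniq //= lerDl.
  by rewrite sumr_ge0 // => i _; rewrite powR_ge0.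
have powD (z : R) : 0 <= z -> z = z `^ q * z `^ (1 - q).
  move=> z0; rewrite -powRD; last by rewrite addrC subrK oner_eq0.
  by rewrite addrC subrK powRr1.
rewrite -/M [leRHS]powD //.
have -> : M `^ q = S by rewrite /M -powRrM mulVf ?gt_eqF // powRr1.
rewrite /S mulr_suml big_nat [leRHS]big_nat ler_sum // => k /andP[_ kn].
rewrite [leLHS]powD // ler_wpM2l ?powR_ge0 //.
by rewrite ge0_ler_powR ?nnegrE ?subr_ge0 // xM.
Qed.

(** * The Hilbert space of square-integrable random variables *)

Notation L2 P := (Lfun P 2%:E).

Definition l2_inner d (T : measurableType d) (R : realType) (P : probability T R)
  (f g : T -> R) : R := \int[P]_x (f x * g x).

Definition l2_norm d (T : measurableType d) (R : realType) (P : probability T R)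
  (f : T -> R) : R := Num.sqrt (l2_inner P f f).

(** Applied to the square of the norm of [f + t g], it gives the
    Cauchy-Schwarz inequality. *)
Lemma discriminant_le0 (R : realType) (a b c : R) : 0 <= a ->
  (forall t, 0 <= a * t ^+ 2 + 2 * b * t + c) -> b ^+ 2 <= a * c.
Proof.
move=> a0 quad; move: a0; rewrite le_eqVlt => /orP[/eqP a0|a0].
  rewrite -a0 mul0r in quad *.
  have [->|b0] := eqVneq b 0; first by rewrite expr0n.
  have := quad (- (c + 1) / (2 * b)).
  by rewrite mul0r add0r [2 * b * _]mulrC divfK ?mulf_neq0 //; lra.
have := quad (- b / a).
have -> : a * (- b / a) ^+ 2 + 2 * b * (- b / a) + c = (a * c - b ^+ 2) / a.
  by field; rewrite gt_eqF.
by rewrite pmulr_lge0 ?invr_gt0 // subr_ge0.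
Qed.

Section L2_theory.
Context d (T : measurableType d) (R : realType) (P : probability T R).
Implicit Types (f g h : T -> R) (A B : set T).

Local Notation L2 := (Lfun P 2%:E).
Local Notation ip := (l2_inner P).
Local Notation nrm2 := (l2_norm P).

Lemma L2_measurable f : f \in L2 -> measurable_fun setT f.
Proof. by rewrite inE => /andP[/[!inE]]. Qed.

Lemma L2M_integrable f g : f \in L2 -> g \in L2 ->
  P.-integrable setT (fun x => (f x * g x)%:E).
Proof. by move=> f2 g2; apply/Lfun1_integrable/Lfun2_mul_Lfun1. Qed.

Lemma L2_integrable f : f \in L2 -> P.-integrable setT (EFin \o f).
Proof.
move=> f2; apply/Lfun1_integrable; apply: Lfun_subset12 => //.
by rewrite fin_num_measure.
Qed.

Lemma L2P f : measurable_fun setT f ->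
  (\int[P]_x (f x ^+ 2)%:E < +oo)%E -> f \in L2.
Proof.
move=> mf f2; rewrite inE; apply/andP; split; rewrite inE //=.
rewrite /finite_norm unlock /Lnorm poweR_lty // (le_lt_trans _ f2) //.
rewrite le_eqVlt; apply/orP; left; apply/eqP; apply: eq_integral => x _ /=.
by rewrite powR_mulrn // real_normK ?num_real.
Qed.

Lemma L2D f g : f \in L2 -> g \in L2 -> (f \+ g) \in L2.
Proof. by have [_ +] := @Lfun_addr_closed _ _ _ P 2%:E (lee1n 2); exact. Qed.

Lemma L2Z a f : f \in L2 -> (fun x => a * f x) \in L2.
Proof.
move=> f2; have -> : (fun x => a * f x) = a \o* f.
  by apply/funext => x; rewrite /= mulrC.
by apply: Lfun_scale => //; rewrite ler1n.
Qed.

Lemma L2B f g : f \in L2 -> g \in L2 -> (f \- g) \in L2.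
Proof.
move=> f2 g2; have -> : f \- g = f \+ (fun x => -1 * g x).
  by apply/funext => x; rewrite /= mulN1r.
exact: L2D f2 (L2Z (-1) g2).
Qed.

Lemma L2_cst a : cst a \in L2.
Proof. exact: Lfun_cst. Qed.

Lemma L2_sum (I : Type) (s : seq I) (F : I -> T -> R) (Q : pred I) :
  (forall i, Q i -> F i \in L2) -> (fun x => \sum_(i <- s | Q i) F i x) \in L2.
Proof.
move=> F2; elim: s => [|i s IH].
  by under eq_fun do rewrite big_nil; exact: L2_cst.
under eq_fun do rewrite big_cons.
by case Qi: (Q i) => //; exact: L2D (F2 _ Qi) IH.
Qed.

Lemma L2_le f g : measurable_fun setT f -> g \in L2 ->
  (forall x, `|f x| <= `|g x|) -> f \in L2.
Proof.
move=> mf g2 fg; apply: L2P => //.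
have /integrableP[mg] := Lfun2_integrable_sqr g2.
apply: le_lt_trans; apply: ge0_le_integral => //.
- by move=> x _; rewrite lee_fin sqr_ge0.
- by apply/measurable_EFinP; exact: measurable_funX.
- exact: measurableT_comp.
- move=> x _ /=; rewrite lee_fin ger0_norm ?sqr_ge0 //.
  by rewrite -(real_normK (num_real (f x))) -(real_normK (num_real (g x))) lerXn2r ?nnegrE.
Qed.

Lemma L2_indic f A : measurable A -> f \in L2 -> (fun x => \1_A x * f x) \in L2.
Proof.
move=> mA f2; apply: (L2_le _ f2).
  apply: measurable_funM; [exact: measurable_indic|exact: L2_measurable].
move=> x; rewrite normrM indicE; case: (x \in A); rewrite ?mul0r ?mul1r //=.
  by rewrite normr1 mul1r.
by rewrite normr0 mul0r.
Qed.

Lemma L2_bounded f (c : R) : measurable_fun setT f -> (forall x, `|f x| <= c) ->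
  f \in L2.
Proof.
move=> mf fc; apply: (L2_le mf (L2_cst c)) => x.
by rewrite (le_trans (fc x)) // ler_norm.
Qed.

Lemma L2_ae f g : measurable_fun setT g -> f = g %[ae P] -> f \in L2 -> g \in L2.
Proof.
move=> mg fg f2; apply: L2P => //.
have /integrableP[mf2 _] := Lfun2_integrable_sqr f2.
rewrite (ae_eq_integral (EFin \o (fun x => f x ^+ 2))) //.
- have /integrableP[_] := Lfun2_integrable_sqr f2.
  by under eq_integral do rewrite /= ger0_norm ?sqr_ge0 //.
- by apply/measurable_EFinP; exact: measurable_funX.
- by apply: filterS fg => x /= /(_ I) -> _.
Qed.

Lemma ipC f g : ip f g = ip g f.
Proof. by apply: eq_Rintegral => x _; rewrite mulrC. Qed.

Lemma ipDl f g h : f \in L2 -> g \in L2 -> h \in L2 ->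
  ip (f \+ g) h = ip f h + ip g h.
Proof.
move=> f2 g2 h2; rewrite -RintegralD //; try exact: L2M_integrable.
by apply: eq_Rintegral => x _; rewrite mulrDl.
Qed.

Lemma ipZl a f h : f \in L2 -> h \in L2 -> ip (fun x => a * f x) h = a * ip f h.
Proof.
move=> f2 h2; rewrite -RintegralZl //; try exact: L2M_integrable.
by apply: eq_Rintegral => x _; rewrite mulrA.
Qed.

Lemma ipBl f g h : f \in L2 -> g \in L2 -> h \in L2 ->
  ip (f \- g) h = ip f h - ip g h.
Proof.
move=> f2 g2 h2; rewrite -RintegralB //; try exact: L2M_integrable.
by apply: eq_Rintegral => x _; rewrite mulrBl.
Qed.

Lemma ipDr f g h : f \in L2 -> g \in L2 -> h \in L2 ->
  ip h (f \+ g) = ip h f + ip h g.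
Proof. by move=> *; rewrite ipC ipDl // ![ip _ h]ipC. Qed.

Lemma ipBr f g h : f \in L2 -> g \in L2 -> h \in L2 ->
  ip h (f \- g) = ip h f - ip h g.
Proof. by move=> *; rewrite ipC ipBl // ![ip _ h]ipC. Qed.

Lemma ipZr a f h : f \in L2 -> h \in L2 -> ip h (fun x => a * f x) = a * ip h f.
Proof. by move=> *; rewrite ipC ipZl // ipC. Qed.

Lemma ip0l f : ip (cst 0) f = 0.
Proof.
rewrite /l2_inner; under eq_Rintegral do rewrite mul0r.
by rewrite Rintegral_cst // mul0r.
Qed.

Lemma ip_suml (I : Type) (s : seq I) (F : I -> T -> R) (Q : pred I) h :
  (forall i, Q i -> F i \in L2) -> h \in L2 ->
  ip (fun x => \sum_(i <- s | Q i) F i x) h = \sum_(i <- s | Q i) ip (F i) h.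
Proof.
move=> F2 h2; elim: s => [|i s IH].
  by rewrite big_nil; under eq_fun do rewrite big_nil; rewrite ip0l.
rewrite big_cons; under eq_fun do rewrite big_cons.
case Qi: (Q i) => //; rewrite -IH.
by apply: ipDl => //; [exact: F2|exact: L2_sum].
Qed.

Lemma ip_ge0 f : 0 <= ip f f.
Proof. by apply: Rintegral_ge0 => x _; rewrite -expr2 sqr_ge0. Qed.

Lemma ip_ae f f' g : measurable_fun setT f -> measurable_fun setT f' ->
  measurable_fun setT g -> f = f' %[ae P] -> ip f g = ip f' g.
Proof.
move=> mf mf' mg ff'; congr fine; apply: ae_eq_integral => //.
- by apply/measurable_EFinP; exact: measurable_funM.
- by apply/measurable_EFinP; exact: measurable_funM.
- by apply: filterS ff' => x /= /(_ I) -> _.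
Qed.

Lemma ipE f : f \in L2 -> (\int[P]_x (f x ^+ 2)%:E)%E = (ip f f)%:E.
Proof.
move=> f2; rewrite /l2_inner /Rintegral fineK; first by apply: eq_integral.
exact: integrable_fin_num (L2M_integrable f2 f2).
Qed.

Lemma indic_in_L2 A : measurable A -> (\1_A : T -> R) \in L2.
Proof.
move=> mA; apply: (@L2_bounded _ 1); first exact: measurable_indic.
by move=> x; rewrite indicE; case: (_ \in _); rewrite ?normr1 ?normr0.
Qed.

Lemma integral_setE f A : measurable A -> f \in L2 ->
  (\int[P]_(x in A) (f x)%:E = (ip \1_A f)%:E)%E.
Proof.
move=> mA f2; rewrite /l2_inner /Rintegral fineK; last first.
  exact: integrable_fin_num (L2M_integrable (indic_in_L2 mA) f2).
rewrite [LHS]integral_mkcond; apply: eq_integral => x _.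
by rewrite patchE indicE; case: ifPn => xA; rewrite ?mul1r ?mul0r.
Qed.

Lemma nrm2_ge0 f : 0 <= nrm2 f.
Proof. exact: sqrtr_ge0. Qed.

Lemma sqr_nrm2 f : nrm2 f ^+ 2 = ip f f.
Proof. by rewrite sqr_sqrtr // ip_ge0. Qed.

Lemma cauchy_schwarz f g : f \in L2 -> g \in L2 -> `|ip f g| <= nrm2 f * nrm2 g.
Proof.
move=> f2 g2.
rewrite -[leLHS]sqrtr_sqr -sqrtrM ?ip_ge0 // ler_sqrt ?mulr_ge0 ?ip_ge0 //.
rewrite [leRHS]mulrC discriminant_le0 ?ip_ge0 // => t.
have := ip_ge0 (f \+ (fun x => t * g x)).
rewrite ipDl ?L2D ?L2Z // !ipDr ?L2Z // !ipZl ?L2Z // !ipZr // (ipC g f).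
by congr (0 <= _); ring.
Qed.

Lemma nrm2D f g : f \in L2 -> g \in L2 -> nrm2 (f \+ g) <= nrm2 f + nrm2 g.
Proof.
move=> f2 g2; rewrite -[leRHS]ger0_norm ?addr_ge0 ?nrm2_ge0 //.
rewrite -sqrtr_sqr ler_sqrt ?sqr_ge0 // ipDl ?L2D // !ipDr // sqrrD !sqr_nrm2.
have /ler_normlP[_] := cauchy_schwarz f2 g2; rewrite (ipC g f); lra.
Qed.

Lemma nrm2Z a f : f \in L2 -> nrm2 (fun x => a * f x) = `|a| * nrm2 f.
Proof.
move=> f2; rewrite /l2_norm ipZl ?L2Z // ipZr // mulrA -expr2.
by rewrite sqrtrM ?sqr_ge0 // sqrtr_sqr.
Qed.

Lemma nrm2_0 : nrm2 (cst 0) = 0.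
Proof. by rewrite /l2_norm ip0l sqrtr0. Qed.

Lemma nrm2_sum (I : Type) (s : seq I) (F : I -> T -> R) (Q : pred I) :
  (forall i, Q i -> F i \in L2) ->
  nrm2 (fun x => \sum_(i <- s | Q i) F i x) <= \sum_(i <- s | Q i) nrm2 (F i).
Proof.
move=> F2; elim: s => [|i s IH].
  by rewrite big_nil; under eq_fun do rewrite big_nil; rewrite nrm2_0.
rewrite big_cons; under eq_fun do rewrite big_cons.
case Qi: (Q i) => //; apply: le_trans (nrm2D (F2 _ Qi) (L2_sum _ F2)) _.
by rewrite lerD2l.
Qed.

Lemma nrm2_sym f g : nrm2 (f \- g) = nrm2 (g \- f).
Proof.
by congr Num.sqrt; apply: eq_Rintegral => x _ /=; rewrite -[RHS]mulrNN !opprB.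
Qed.

Lemma nrm2_triangle f g h : f \in L2 -> g \in L2 -> h \in L2 ->
  nrm2 (f \- h) <= nrm2 (f \- g) + nrm2 (g \- h).
Proof.
move=> f2 g2 h2.
have -> : f \- h = (f \- g) \+ (g \- h) by apply/funext => x /=; ring.
by rewrite nrm2D ?L2B.
Qed.

Lemma parallelogram f g : f \in L2 -> g \in L2 ->
  ip (f \+ g) (f \+ g) + ip (f \- g) (f \- g) = 2 * ip f f + 2 * ip g g.
Proof.
move=> f2 g2.
rewrite (ipDl f2 g2) ?L2D // (ipDr f2 g2) // (ipDr f2 g2) //.
rewrite (ipBl f2 g2) ?L2B // (ipBr f2 g2) // (ipBr f2 g2) // (ipC g f); ring.
Qed.

Lemma nneseries_le_bound (u : nat -> \bar R) (c : \bar R) :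
  (forall n, (0 <= u n)%E) ->
  (forall n, (\sum_(0 <= k < n) u k <= c)%E) -> (\sum_(0 <= k <oo) u k <= c)%E.
Proof.
move=> u0 uc; apply: lime_le; last exact: nearW.
by apply: is_cvg_nneseries => n _ _; exact: u0.
Qed.

Lemma limn_einf_le_bound (u : nat -> \bar R) (c : \bar R) :
  (\forall n \near \oo, (u n <= c)%E) -> (limn_einf u <= c)%E.
Proof.
move=> uc; rewrite limn_einf_lim; apply: lime_le; first exact: is_cvg_einfs.
apply: filterS uc => n; apply: le_trans.
by apply: ereal_inf_lbound; exists n => /=.
Qed.

(** The Cauchy-Schwarz inequality against the constant [1]. *)
Lemma ip_abs_le_nrm2 f : f \in L2 -> (\int[P]_x `|f x|%:E <= (nrm2 f)%:E)%E.
Proof.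
move=> f2; have mf := L2_measurable f2.
have n2 : Num.norm \o f \in L2.
  by apply: (L2_le _ f2) => [|x]; [exact: measurableT_comp|rewrite /= normr_id].
have -> : (\int[P]_x `|f x|%:E)%E = (ip (Num.norm \o f) (cst 1))%:E.
  rewrite /l2_inner /Rintegral fineK.
    by apply: eq_integral => x _; rewrite mulr1.
  exact: integrable_fin_num (L2M_integrable n2 (L2_cst 1)).
rewrite lee_fin; apply: (le_trans (ler_norm _)).
apply: (le_trans (cauchy_schwarz n2 (L2_cst 1))).
have -> : nrm2 (cst 1) = 1.
  rewrite /l2_norm /l2_inner; under eq_Rintegral do rewrite mulr1.
  by rewrite Rintegral_cst // mul1r (congr1 fine (probability_setT P)) sqrtr1.
rewrite mulr1 le_eqVlt; apply/orP; left; apply/eqP; congr Num.sqrt.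
by apply: eq_Rintegral => x _ /=; rewrite -normrM ger0_norm // -expr2 sqr_ge0.
Qed.

(** Riesz-Fischer, for sequences with geometrically small increments: these
    converge almost surely because the increments are summable in [L_1], and
    Fatou's lemma gives the rate in [L_2]. *)
Lemma L2_complete (f : nat -> T -> R) :
  (forall n, f n \in L2) ->
  (forall n, nrm2 (f n.+1 \- f n) <= 2^-1 ^+ n) ->
  exists2 g, g \in L2 & forall n, nrm2 (f n \- g) <= 2 * 2^-1 ^+ n.
Proof.
move=> f2 df; have mf n := L2_measurable (f2 n).
have df2 n : f n.+1 \- f n \in L2 by exact: L2B.
have cauchy n k : nrm2 (f (n + k)%N \- f n) <= 2 * 2^-1 ^+ n - 2 * 2^-1 ^+ (n + k).
  elim: k => [|k IH].
    rewrite addn0 subrr; have -> : f n \- f n = cst 0.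
      by apply/funext => x /=; rewrite subrr.
    by rewrite nrm2_0.
  apply: (le_trans (nrm2_triangle (f2 _) (f2 (n + k)%N) (f2 _))).
  have := lerD (df (n + k)%N) IH; rewrite -addnS; move/le_trans; apply.
  rewrite addnS [_ ^+ (n + k).+1]exprS; lra.
pose S x := (\sum_(0 <= n <oo) `|f n.+1 x - f n x|%:E)%E.
have mS : measurable_fun setT S.
  apply: ge0_emeasurable_sum => // n _; apply/measurable_EFinP.
  exact: measurableT_comp (L2_measurable (df2 n)).
have Sint : P.-integrable setT S.
  apply/integrableP; split => //.
  rewrite (@le_lt_trans _ _ 2%:E) ?ltry //.
  under eq_integral do rewrite gee0_abs ?nneseries_ge0 //.
  rewrite /S integral_nneseries //; last first.
    by move=> n; apply/measurable_EFinP; exact: measurableT_comp (L2_measurable (df2 n)).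
  apply: nneseries_le_bound => [n|n]; first exact: integral_ge0.
  apply: (@le_trans _ _ (\sum_(0 <= k < n) (2^-1 ^+ k)%:E)%E).
    apply: lee_sum => k _; apply: (le_trans (ip_abs_le_nrm2 (df2 k))).
    by rewrite lee_fin.
  have half : 1 - 2^-1 = 2^-1 :> R by lra.
  rewrite sumEFin lee_fin.
  have := @geometric_sum_le R 2^-1 n; rewrite half invrK; apply; lra.
pose N := [set x | (S x < +oo)%E].
have mN : measurable N.
  by rewrite -[N]setTI; exact: emeasurable_fun_infty_o.
pose g x := limn (fun n => \1_N x * f n x).
have cvgf x : (fun n => \1_N x * f n x) @ \oo --> g x.
  apply/cvg_ex => /=; rewrite /g indicE; case: (boolP (x \in N)) => [|_].
    rewrite inE => Nx.
    have /normed_cvg cv := nnseries_is_cvg (fun n => normr_ge0 _) Nx.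
    exists (f 0%N x + limn (series (telescope (f ^~ x)))).
    under eq_fun do rewrite mul1r (eq_sum_telescope (f ^~ x)).
    by apply: cvgD; [exact: cvg_cst|exact: cv].
  by exists 0; under eq_fun do rewrite mul0r; exact: cvg_cst.
have mg : measurable_fun setT g.
  apply: measurable_fun_cvg => [n|x _]; last exact: cvgf.
  by apply: measurable_funM; [exact: measurable_indic|exact: mf].
have Nae : \forall x \ae P, N x.
  apply: filterS (integrable_ae measurableT Sint) => x /(_ I).
  by rewrite ge0_fin_numE // nneseries_ge0.
have dist n : (\int[P]_x ((f n x - g x) ^+ 2)%:E <=
    ((2 * 2^-1 ^+ n) ^+ 2)%:E)%E.
  pose v m x := ((f n x - f m x) ^+ 2)%:E.
  have mv m : measurable_fun setT (v m).
    by apply/measurable_EFinP/measurable_funX; exact: measurable_funB.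
  have v0 m x : (0 <= v m x)%E by rewrite lee_fin sqr_ge0.
  have -> : (\int[P]_x ((f n x - g x) ^+ 2)%:E =
             \int[P]_x limn_einf (v ^~ x))%E.
    apply: ae_eq_integral => //.
    - by apply/measurable_EFinP/measurable_funX; exact: measurable_funB.
    - have -> : (fun x => limn_einf (v ^~ x)) =
          (fun x => - limn_esup (fun m => - v m x))%E.
        apply/funext => x; rewrite -limn_einfN; congr limn_einf.
        by apply/funext => m; rewrite /= opprK.
      apply: measurableT_comp => //.
      apply: (@measurable_fun_limn_esup _ _ _ setT (fun m x => - v m x)%E) => m.
      exact: measurableT_comp.
    apply: filterS Nae => x Nx _; apply/esym.
    have /cvg_limn_einf_sup[-> //] : v ^~ x @ \oo --> ((f n x - g x) ^+ 2)%:E.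
    apply: cvg_EFin; first exact: nearW.
    have cvx : f ^~ x @ \oo --> g x.
      by have := cvgf x; rewrite indicE mem_set //; under eq_fun do rewrite mul1r.
    have cd : (fun m => f n x - f m x) @ \oo --> f n x - g x.
      by apply: cvgB => //; exact: cvg_cst.
    exact: (cvgM cd cd).
  apply: (le_trans (fatou _ _ _ _)) => //.
  apply: limn_einf_le_bound; exists n => // m /= nm.
  have -> : (\int[P]_x v m x)%E = (nrm2 (f m \- f n) ^+ 2)%:E.
    rewrite nrm2_sym sqr_nrm2 -ipE ?L2B //.
  rewrite lee_fin lerXn2r ?nnegrE ?nrm2_ge0 ?mulr_ge0 ?exprn_ge0 //.
  rewrite -(subnKC nm); apply: (le_trans (cauchy _ _)).
  by rewrite gerBl mulr_ge0 // exprn_ge0.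
have fg2 n : f n \- g \in L2.
  apply: L2P; first exact: measurable_funB.
  by rewrite (le_lt_trans (dist n)) ?ltry.
exists g.
  have -> : g = f 0%N \- (f 0%N \- g) by apply/funext => x /=; rewrite opprB addrC subrK.
  exact: L2B.
move=> n; rewrite -(ger0_norm (nrm2_ge0 _)).
rewrite -[leRHS]ger0_norm ?mulr_ge0 ?exprn_ge0 //.
rewrite -ler_sqr ?nnegrE // !real_normK ?num_real //.
by rewrite sqr_nrm2 -lee_fin -ipE //; exact: dist.
Qed.

(** The Riesz representation theorem.  A minimizing sequence of
    [ip f f - 2 * psi f] is Cauchy by the parallelogram law, and the vanishing
    of the first variation at its limit is the representation. *)
Lemma riesz_L2 (psi : (T -> R) -> R) (C : R) :
  (forall a f g, f \in L2 -> g \in L2 ->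
     psi (fun x => a * f x + g x) = a * psi f + psi g) ->
  (forall f, f \in L2 -> `|psi f| <= C * nrm2 f) ->
  exists2 g, g \in L2 & forall f, f \in L2 -> psi f = ip f g.
Proof.
move=> lin bnd.
pose J f := ip f f - 2 * psi f.
have JC f : f \in L2 -> - C ^+ 2 <= J f.
  move=> f2; have /ler_normlP[_ h] := bnd _ f2.
  rewrite /J -sqr_nrm2; have := sqr_ge0 (nrm2 f - C); rewrite sqrrB; lra.
pose E := [set J f | f in [set f | f \in L2]].
have Einf : has_inf E.
  split; first by exists (J (cst 0)), (cst 0) => //=; exact: L2_cst.
  by exists (- C ^+ 2) => _ [f /= f2 <-]; exact: JC.
have mJ f : f \in L2 -> inf E <= J f.
  by move=> f2; apply: ge_inf; [case: Einf|exists f].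
pose e n : R := (4^-1 * 2^-1 ^+ n) ^+ 2.
have e0 n : 0 < e n by rewrite exprn_gt0 // mulr_gt0 // exprn_gt0.
have : forall n, exists f, f \in L2 /\ J f < inf E + e n.
  move=> n; have [_ [f f2 <-] Jf] := inf_adherent (e0 n) Einf.
  by exists f.
move=> /choice[f /all_and2[f2 Jf]].
have para g h : g \in L2 -> h \in L2 ->
    ip (g \- h) (g \- h) <= 2 * J g + 2 * J h - 4 * inf E.
  move=> g2 h2; pose k x := 2^-1 * (g \+ h) x.
  have gh2 := L2D g2 h2; have k2 : k \in L2 by exact: L2Z.
  have := mJ _ k2; rewrite /J ipZl // ipZr //.
  have -> : psi k = 2^-1 * psi g + 2^-1 * psi h.
    have -> : k = fun x => 2^-1 * g x + (fun y => 2^-1 * h y + cst 0 y) x.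
      by apply/funext => x; rewrite /k /= addr0 mulrDr.
    have z0 : psi (cst 0) = 0.
      have := bnd _ (L2_cst 0); rewrite nrm2_0 mulr0 normr_le0 => /eqP //.
    have hk : (fun y => 2^-1 * h y + cst 0 y) \in L2.
      exact: L2D (L2Z _ h2) (L2_cst 0).
    by rewrite lin // lin ?L2_cst // z0 addr0.
  have := parallelogram g2 h2; set X := ip (g \+ h) _; set Y := ip (g \- h) _.
  lra.
have [g g2 fg] : exists2 g, g \in L2 & forall n, nrm2 (f n \- g) <= 2 * 2^-1 ^+ n.
  apply: L2_complete => // n.
  rewrite -[leRHS]ger0_norm ?exprn_ge0 // -sqrtr_sqr ler_sqrt ?sqr_ge0 //.
  apply: (le_trans (para _ _ (f2 _) (f2 _))).
  have := Jf n; have := Jf n.+1; rewrite /e (exprS _ n).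
  set a := 2^-1 ^+ n; have := sqr_ge0 a; nra.
exists g => // h h2.
have var n : `|ip (f n) h - psi h| <= 4^-1 * 2^-1 ^+ n * nrm2 h.
  rewrite -[leRHS]ger0_norm ?mulr_ge0 ?nrm2_ge0 ?exprn_ge0 //.
  rewrite -sqrtr_sqr -[leRHS]sqrtr_sqr ler_sqrt ?sqr_ge0 //.
  rewrite exprMn sqr_nrm2 mulrC discriminant_le0 ?ip_ge0 // => t.
  have th2 := L2Z t h2.
  have := mJ _ (L2D th2 (f2 n)); have := Jf n; rewrite /J.
  rewrite (lin t h (f n)) // ipDl ?L2D // !ipDr // !ipZl // !ipZr //.
  rewrite (ipC h) /e; set X := ip h h; set Y := ip (f n) h; lra.
apply/eqP; rewrite -subr_eq0 -normr_eq0 eq_le normr_ge0 andbT.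
have small n : `|psi h - ip h g| <= 4 * nrm2 h * 2^-1 ^+ n.
  have -> : psi h - ip h g = ip (f n \- g) h - (ip (f n) h - psi h).
    by rewrite ipBl // (ipC g); ring.
  apply: (le_trans (ler_normB _ _)).
  have := cauchy_schwarz (L2B (f2 n) g2) h2.
  have := ler_wpM2r (nrm2_ge0 h) (fg n).
  have := var n; have := nrm2_ge0 h.
  have : 0 <= 2^-1 ^+ n :> R by rewrite exprn_ge0.
  set a := _ ^+ n => a0 n0; have := mulr_ge0 a0 n0; lra.
have : (fun n => 4 * nrm2 h * 2^-1 ^+ n) @ \oo --> 4 * nrm2 h * 0.
  by apply: cvgMr; apply: cvg_expr; rewrite ger0_norm // invf_lt1 // ltr1n.
rewrite mulr0 => cv0; apply: (ler_cvg_to _ cv0).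
  exact: cvg_cst.
exact: nearW.
Qed.

End L2_theory.

(** * Conditional expectations *)

Section conditional_expectation.
Context d (T : measurableType d) (R : realType) (P : probability T R).
Variable G : set (set T).
Hypothesis sG : sigma_algebra [set: T] G.
Hypothesis GM : G `<=` measurable.
Implicit Types (f g u w : T -> R) (h Y : T -> \bar R) (A B : set T).

Local Notation TG := (g_sigma_algebraType G).
Local Notation L2 := (Lfun P 2%:E).
Local Notation ip := (l2_inner P).

Lemma g_sigma_algebra_measurableE : (measurable : set (set TG)) = G.
Proof. exact: sigma_algebra_id. Qed.

Lemma measurable_id_g_sigma_algebra : measurable_fun setT (id : T -> TG).
Proof.
by move=> _ A; rewrite g_sigma_algebra_measurableE setTI => GA; exact: GM.
Qed.

Lemma measurable_wrtW d' (U : measurableType d') (f : T -> U) :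
  measurable_wrt G f -> measurable_fun setT f.
Proof.
by move=> mf; exact: (measurableT_comp mf measurable_id_g_sigma_algebra).
Qed.

Lemma measurable_wrt_preimage d' (U : measurableType d') (f : T -> U) (A : set U) :
  measurable_wrt G f -> measurable A -> G (f @^-1` A).
Proof.
move=> mf mA; rewrite -g_sigma_algebra_measurableE -[X in measurable X]setTI.
exact: mf.
Qed.

Lemma sub_sigma_algebraT : G setT.
Proof. by rewrite -g_sigma_algebra_measurableE. Qed.

Lemma sub_sigma_algebraI A B : G A -> G B -> G (A `&` B).
Proof. by rewrite -g_sigma_algebra_measurableE; exact: measurableI. Qed.

Lemma sub_sigma_algebraC A : G A -> G (~` A).
Proof. by rewrite -g_sigma_algebra_measurableE; exact: measurableC. Qed.

Let X_subproof : (id : T -> TG) \in mfun.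
Proof. by rewrite inE /=; exact: measurable_id_g_sigma_algebra. Qed.

(* The restriction of [P] to [G], as a probability measure on [TG]. *)
Let PG : probability TG R := distribution P (mfun_Sub X_subproof).

Let ge0_integral_restriction A h : G A -> measurable_wrt G h ->
  (forall x, (0 <= h x)%E) ->
  (\int[PG]_(x in A) h x = \int[P]_(x in A) h x)%E.
Proof.
move=> GA mh h0; rewrite ge0_integral_pushforward //.
- by rewrite g_sigma_algebra_measurableE.
- exact: measurable_funTS.
Qed.

Let integrable_restriction h : measurable_wrt G h ->
  PG.-integrable setT h <-> P.-integrable setT h.
Proof.
move=> mh; have mabs : measurable_wrt G (fun x => `|h x|%E).
  exact: measurableT_comp.
have E : (\int[PG]_x `|h x| = \int[P]_x `|h x|)%E.
  by apply: ge0_integral_restriction => //; exact: sub_sigma_algebraT.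
split=> /integrableP[_ fin]; apply/integrableP; split => //.
- exact: measurable_wrtW.
- by rewrite -E.
- by rewrite E.
Qed.

Let integral_restriction A h : G A -> measurable_wrt G h ->
  P.-integrable setT h -> (\int[PG]_(x in A) h x = \int[P]_(x in A) h x)%E.
Proof.
move=> GA mh ih; rewrite integral_pushforward //.
- exact: (@integrableS _ _ _ _ setT) (GM GA) _ ih.
- by rewrite g_sigma_algebra_measurableE.
Qed.

(** The Radon-Nikodym derivative of [f dP] with respect to [P], both
    restricted to [G], is a conditional expectation; so the chosen version is
    one. *)
Lemma cexpP f : P.-integrable setT (EFin \o f) -> is_cexp P G f (cexp P G f).
Proof.
move=> intf; rewrite /cexp; apply: xgetPex.
pose nu := pushforward (induced_charge intf) (mfun_Sub X_subproof : T -> TG).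
have nuPG : nu `<< PG.
  apply/null_content_dominatesP => A.
  rewrite g_sigma_algebra_measurableE => GA PA.
  rewrite /nu /pushforward /induced_charge; apply: null_set_integral => //.
  - exact: GM.
  - by apply: measurable_funTS; exact: measurable_int _ intf.
have mX : measurable_fun setT (mfun_Sub X_subproof : T -> TG) by [].
have [Z [Zfin Zint ZE]] : exists Z : TG -> \bar R,
    [/\ forall x, Z x \is a fin_num, PG.-integrable setT Z &
        forall A : set TG, measurable A -> nu A = (\int[PG]_(x in A) Z x)%E].
  have fin x := Radon_Nikodym_fin_num x nuPG.
  have int := Radon_Nikodym_integrable nuPG.
  have E (A : set TG) (mA : measurable A) := Radon_Nikodym_integral nuPG mA.
  eexists; split; [exact: fin mX|exact: int mX|by move=> A mA; exact (E mX A mA)].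
have mZ := measurable_int _ Zint.
pose Y x := fine (Z x).
have YE : EFin \o Y = Z by apply/funext => x; rewrite /= fineK.
exists Y; split.
- exact: measurableT_comp mZ.
- by rewrite YE; apply/integrable_restriction.
- move=> A GA; transitivity (\int[PG]_(x in A) (Y x)%:E)%E.
    have iY : P.-integrable setT (EFin \o Y).
      by rewrite YE; apply/integrable_restriction.
    by rewrite (integral_restriction GA _ iY) // YE.
  rewrite -[X in integral _ _ X]/(EFin \o Y) YE -ZE //.
  by rewrite g_sigma_algebra_measurableE.
Qed.

Lemma measurable_wrt_cexp f : P.-integrable setT (EFin \o f) ->
  measurable_wrt G (cexp P G f).
Proof. by move=> /cexpP[]. Qed.

Lemma measurable_cexp f : P.-integrable setT (EFin \o f) ->
  measurable_fun setT (cexp P G f).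
Proof. by move=> /measurable_wrt_cexp/measurable_wrtW. Qed.

Lemma integrable_cexp f : P.-integrable setT (EFin \o f) ->
  P.-integrable setT (EFin \o cexp P G f).
Proof. by move=> /cexpP[]. Qed.

Lemma integral_cexp f A : P.-integrable setT (EFin \o f) -> G A ->
  (\int[P]_(x in A) (cexp P G f x)%:E = \int[P]_(x in A) (f x)%:E)%E.
Proof. by move=> /cexpP[_ _]; exact. Qed.

(** The event where the inequality fails is itself in [G]. *)
Lemma ae_le_of_integral_le w1 w2 B : measurable_wrt G w1 -> measurable_wrt G w2 ->
  P.-integrable setT (EFin \o w1) -> P.-integrable setT (EFin \o w2) -> G B ->
  (forall A, G A -> A `<=` B ->
    (\int[P]_(x in A) (w1 x)%:E <= \int[P]_(x in A) (w2 x)%:E)%E) ->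
  \forall x \ae P, B x -> w1 x <= w2 x.
Proof.
move=> m1 m2 i1 i2 GB le12.
pose A := B `&` [set x | w2 x < w1 x].
have GA : G A.
  apply: sub_sigma_algebraI => //; rewrite -g_sigma_algebra_measurableE -[X in measurable X]setTI.
  exact: measurable_fun_ltr.
have mA := GM GA.
have i1A : P.-integrable A (EFin \o w1) by exact: (@integrableS _ _ _ _ setT).
have i2A : P.-integrable A (EFin \o w2) by exact: (@integrableS _ _ _ _ setT).
have iD : P.-integrable A (fun x => (w1 x - w2 x)%:E).
  exact: (integrableB mA i1A i2A).
have : (\int[P]_(x in A) `|(w1 x - w2 x)%:E| = 0)%E.
  apply/eqP; rewrite eq_le integral_ge0 // andbT.
  have -> : (\int[P]_(x in A) `|(w1 x - w2 x)%:E| =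
      \int[P]_(x in A) (w1 x)%:E - \int[P]_(x in A) (w2 x)%:E)%E.
    rewrite -integralB //; apply: eq_integral => x.
    by rewrite inE => -[_ /= w21] /=; rewrite ger0_norm // subr_ge0 ltW.
  rewrite leeBlDr ?add0e; first by apply: le12 => // x [].
  exact: integrable_fin_num.
move=> /(ae_eq_integral_abs P mA (measurable_int _ iD)).
apply: filterS => x /= D0 Bx; rewrite leNgt; apply/negP => w21.
have [/eqP] := D0 (conj Bx w21); rewrite subr_eq0 => /eqP w12.
by rewrite w12 ltxx in w21.
Qed.

(** Conditional expectations are compared on an event of [G] by looking only
    at the events of [G] inside it. *)
Lemma cexp_local f1 f2 B : P.-integrable setT (EFin \o f1) ->
  P.-integrable setT (EFin \o f2) -> G B ->
  (forall A, G A -> A `<=` B ->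
    (\int[P]_(x in A) (f1 x)%:E = \int[P]_(x in A) (f2 x)%:E)%E) ->
  \forall x \ae P, B x -> cexp P G f1 x = cexp P G f2 x.
Proof.
move=> i1 i2 GB E12.
have [m1 m2] := (measurable_wrt_cexp i1, measurable_wrt_cexp i2).
have [c1 c2] := (integrable_cexp i1, integrable_cexp i2).
have le12 : \forall x \ae P, B x -> cexp P G f1 x <= cexp P G f2 x.
  apply: (ae_le_of_integral_le m1 m2 c1 c2 GB) => A GA AB.
  by rewrite !integral_cexp // E12.
have le21 : \forall x \ae P, B x -> cexp P G f2 x <= cexp P G f1 x.
  apply: (ae_le_of_integral_le m2 m1 c2 c1 GB) => A GA AB.
  by rewrite !integral_cexp // E12.
by apply: filterS2 le12 le21 => x h1 h2 Bx; apply/eqP; rewrite eq_le h1 ?h2.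
Qed.

Lemma cexp_unique f v : P.-integrable setT (EFin \o f) -> is_cexp P G f v ->
  cexp P G f = v %[ae P].
Proof.
move=> intf [mv iv Ev]; have GT := sub_sigma_algebraT.
have [m1 c1] := (measurable_wrt_cexp intf, integrable_cexp intf).
have le12 : \forall x \ae P, setT x -> cexp P G f x <= v x.
  apply: (ae_le_of_integral_le m1 mv c1 iv GT) => A GA _.
  by rewrite integral_cexp // Ev.
have le21 : \forall x \ae P, setT x -> v x <= cexp P G f x.
  apply: (ae_le_of_integral_le mv m1 iv c1 GT) => A GA _.
  by rewrite integral_cexp // Ev.
by apply: filterS2 le12 le21 => x h1 h2 Bx; apply/eqP; rewrite eq_le h1 ?h2.
Qed.

(** The Riesz theorem in [L_2] of the restriction of [P] to [G] produces a
    function that represents [u |-> E(u f)] on all of that space, not only on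
    indicators; by uniqueness it is the conditional expectation. *)
Lemma cexp_L2 f : f \in L2 -> cexp P G f \in L2 /\
  forall u, u \in L2 -> measurable_wrt G u -> ip u (cexp P G f) = ip u f.
Proof.
move=> f2; have intf := L2_integrable f2.
have GtoT u : u \in Lfun PG 2%:E -> u \in L2.
  move=> u2; have mu := L2_measurable u2.
  apply: L2P; first exact: measurable_wrtW.
  have m2 : measurable_wrt G (fun x => (u x ^+ 2)%:E).
    by apply/measurable_EFinP; exact: measurable_funX.
  have /integrableP[_] := (integrable_restriction m2).1 (Lfun2_integrable_sqr u2).
  by under eq_integral do rewrite gee0_abs ?lee_fin ?sqr_ge0 //.
have TtoG u : u \in L2 -> measurable_wrt G u -> u \in Lfun PG 2%:E.
  move=> u2 mu; apply: L2P => //.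
  have m2 : measurable_wrt G (fun x => (u x ^+ 2)%:E).
    by apply/measurable_EFinP; exact: measurable_funX.
  have /integrableP[_] := (integrable_restriction m2).2 (Lfun2_integrable_sqr u2).
  by under eq_integral do rewrite gee0_abs ?lee_fin ?sqr_ge0 //.
have ipE u v : u \in Lfun PG 2%:E -> v \in Lfun PG 2%:E ->
    l2_inner PG u v = ip u v.
  move=> u2 v2; congr fine; apply: integral_restriction.
  - exact: sub_sigma_algebraT.
  - apply/measurable_EFinP; apply: measurable_funM.
      exact: (L2_measurable u2).
    exact: (L2_measurable v2).
  - by apply: L2M_integrable; exact: GtoT.
have [g g2 gE] : exists2 g : TG -> R, g \in Lfun PG 2%:E &
    forall u, u \in Lfun PG 2%:E -> ip f u = l2_inner PG u g.
  apply: (@riesz_L2 _ _ _ PG (fun u => ip f u) (l2_norm P f)).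
    move=> a u v /GtoT u2 /GtoT v2.
    by rewrite (ipDr (L2Z a u2) v2 f2) ipZr.
  move=> u u2; have := cauchy_schwarz f2 (GtoT _ u2).
  by rewrite /l2_norm -(ipE u u).
have cg : cexp P G f = g %[ae P].
  apply: cexp_unique => //; split; first exact: L2_measurable g2.
    exact: L2_integrable (GtoT _ g2).
  move=> A GA.
  have m1 : measurable_wrt G (\1_A : T -> R).
    by apply: measurable_indic; rewrite g_sigma_algebra_measurableE.
  have A2 : (\1_A : T -> R) \in Lfun PG 2%:E.
    by apply: indic_in_L2; rewrite g_sigma_algebra_measurableE.
  rewrite (integral_setE (GM GA) (GtoT _ g2)) (integral_setE (GM GA) f2); congr EFin.
  transitivity (l2_inner PG \1_A g); first by apply/esym/ipE.
  by rewrite -gE // ipC.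
have c2 : cexp P G f \in L2.
  apply: (L2_ae _ _ (GtoT _ g2)); first exact: measurable_cexp.
  exact: ae_eq_sym cg.
split=> // u u2 mu.
have gT := GtoT _ g2.
rewrite ipC (ip_ae (L2_measurable c2) (L2_measurable gT) (L2_measurable u2) cg).
have uG := TtoG _ u2 mu.
transitivity (l2_inner PG u g); first by rewrite (ipE _ _ uG g2) ipC.
by rewrite -(gE _ uG) ipC.
Qed.

Lemma cexp_in_L2 f : f \in L2 -> cexp P G f \in L2.
Proof. by move=> /cexp_L2[]. Qed.

Lemma ip_cexp u f : u \in L2 -> f \in L2 -> measurable_wrt G u ->
  ip u (cexp P G f) = ip u f.
Proof. by move=> u2 f2 mu; have [_ ->] := cexp_L2 f2. Qed.

End conditional_expectation.

Section conditional_expectation_ge0.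
Context d (T : measurableType d) (R : realType) (P : probability T R).
Variable G : set (set T).
Hypothesis sG : sigma_algebra [set: T] G.
Hypothesis GM : G `<=` measurable.
Implicit Types (h Y : T -> \bar R) (A B : set T).

Local Notation TG := (g_sigma_algebraType G).

(** Conditional expectation of a function that need not be integrable, as the
    sum of those of its bounded pieces. *)
Lemma cexp_ge0P (u : T -> R) : measurable_fun setT u -> (forall x, 0 <= u x) ->
  is_cexp_ge0 P G (EFin \o u) (cexp_ge0 P G (EFin \o u)).
Proof.
move=> mu u0; rewrite /cexp_ge0; apply: xgetPex.
pose B n := u @^-1` `[n%:R, n.+1%:R[.
have mB n : measurable (B n) by rewrite -[B n]setTI; exact: mu.
pose v n x := \1_(B n) x * u x.
have v0 n x : 0 <= v n x by rewrite /v indicE mulr_ge0.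
have mv n : measurable_fun setT (v n).
  by apply: measurable_funM => //; exact: measurable_indic.
have iv n : P.-integrable setT (EFin \o v n).
  apply: L2_integrable; apply: (@L2_bounded _ _ _ _ _ n.+1%:R) => // x.
  rewrite ger0_norm // /v indicE; case: (boolP (x \in B n)) => [|_].
    by rewrite inE /B /= in_itv => /andP[_ /ltW]; rewrite mul1r.
  by rewrite mul0r.
have sum_v x : (\sum_(0 <= n <oo) (v n x)%:E = (u x)%:E)%E.
  have Bx : B (Num.truncn (u x)) x by rewrite /B /= in_itv /= truncn_itv.
  rewrite (@nneseriesD1 _ _ (Num.truncn (u x))) //; last first.
    by move=> n _; rewrite lee_fin.
  rewrite {1}/v indicE mem_set // mul1r eseries0 ?adde0 // => n _ /= nx.
  rewrite /v indicE memNset ?mul0r // => Bnx.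
  by move/negP: nx; apply; rewrite eq_sym; apply/eqP/truncn_def.
pose c n x := Num.max (cexp P G (v n) x) 0.
have c0 n x : 0 <= c n x by rewrite le_max lexx orbT.
have mc n : measurable_wrt G (c n).
  by apply: measurable_maxr => //; exact: measurable_wrt_cexp.
have cE n A : G A -> (\int[P]_(x in A) (c n x)%:E = \int[P]_(x in A) (v n x)%:E)%E.
  move=> GA; rewrite -(integral_cexp sG GM (iv n) GA).
  have mcexp := measurable_cexp sG GM (iv n).
  apply: ae_eq_integral; first exact: GM.
  - by apply/measurable_EFinP/measurable_funTS; exact: measurable_wrtW (mc n).
  - exact/measurable_EFinP/measurable_funTS.
  have pos : \forall x \ae P, setT x -> cst 0 x <= cexp P G (v n) x.
    apply: (ae_le_of_integral_le sG GM _ _ _ (integrable_cexp sG GM (iv n))).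
    - exact: measurable_cst.
    - exact: measurable_wrt_cexp.
    - exact: (@integrable0 _ _ _ P setT).
    - exact: sub_sigma_algebraT.
    move=> A' GA' _; rewrite integral_cexp // integral0_eq //.
    by apply: integral_ge0 => x _; rewrite lee_fin.
  by apply: filterS pos => x /(_ I) h _; rewrite /c max_l.
have Eseries A (w : nat -> T -> R) : G A -> (forall n, measurable_fun setT (w n)) ->
    (forall n x, 0 <= w n x) ->
    (\int[P]_(x in A) (\sum_(0 <= n <oo) (w n x)%:E) =
     \sum_(0 <= n <oo) \int[P]_(x in A) (w n x)%:E)%E.
  move=> GA mw w0; rewrite integral_nneseries //; first exact: GM.
    by move=> n; apply/measurable_EFinP/measurable_funTS; exact: mw.
  by move=> n x _; rewrite lee_fin.
exists (fun x => \sum_(0 <= n <oo) (c n x)%:E)%E; split.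
- apply: ge0_emeasurable_sum => [n x _ _|n _]; first by rewrite lee_fin.
  by apply/measurable_EFinP; exact: mc.
- by move=> x; apply: nneseries_ge0 => n _ _; rewrite lee_fin.
move=> A GA; rewrite Eseries //; last by move=> n; exact: measurable_wrtW (mc n).
rewrite (eq_eseriesr (fun n _ => cE n A GA)) -Eseries //.
by apply: eq_integral => x _; rewrite sum_v.
Qed.

(** The integrals may be infinite, so the event where the inequality fails is
    exhausted by events where [Y2] is bounded and the gap is bounded below. *)
Lemma ae_ge0_le_of_integral_le Y1 Y2 B :
  measurable_wrt G Y1 -> measurable_wrt G Y2 ->
  (forall x, (0 <= Y1 x)%E) -> (forall x, (0 <= Y2 x)%E) -> G B ->
  (forall A, G A -> A `<=` B ->
    (\int[P]_(x in A) Y1 x <= \int[P]_(x in A) Y2 x)%E) ->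
  \forall x \ae P, B x -> (Y1 x <= Y2 x)%E.
Proof.
move=> m1 m2 p1 p2 GB le12.
pose e n : R := n.+1%:R^-1.
pose A n := B `&` ([set x | (Y2 x <= n.+1%:R%:E)%E] `&`
  [set x | (Y2 x + (e n)%:E <= Y1 x)%E]).
have GA n : G (A n).
  apply: sub_sigma_algebraI => //; rewrite -(g_sigma_algebra_measurableE sG).
  have mT := @measurableT _ TG.
  apply: measurableI; rewrite -[X in measurable X]setTI.
    exact: emeasurable_fun_le.
  by apply: emeasurable_fun_le => //; exact: emeasurable_funD.
have mW (Y : T -> \bar R) n : measurable_wrt G Y -> measurable_fun (A n) Y.
  by move=> mY; apply: measurable_funTS; exact: measurable_wrtW mY.
have PA n : P (A n) = 0%E.
  have mA := GM (GA n).
  have fin2 : (\int[P]_(x in A n) Y2 x \is a fin_num)%E.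
    rewrite ge0_fin_numE ?integral_ge0 //.
    apply: (@le_lt_trans _ _ (\int[P]_(x in A n) (cst n.+1%:R%:E x))%E).
      by apply: ge0_le_integral => //; [exact: mW|move=> x [_ []]].
    by rewrite integral_cst // lte_mul_pinfty // (le_lt_trans (probability_le1 P mA)) ?ltry.
  have : (\int[P]_(x in A n) Y2 x + (e n)%:E * P (A n) <= \int[P]_(x in A n) Y2 x)%E.
    rewrite -integral_cst // -ge0_integralD //; first last.
    - by move=> x _; rewrite lee_fin invr_ge0.
    - exact: mW.
    apply: le_trans (le12 _ (GA n) _); last by move=> x [].
    apply: ge0_le_integral => //.
    - by move=> x _; rewrite adde_ge0 // lee_fin invr_ge0.
    - by apply: emeasurable_funD => //; exact: mW.
    - exact: mW.
    - by move=> x [_ []].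
  rewrite -[leRHS]adde0 leeD2lE // => h; apply/eqP; rewrite eq_le measure_ge0 andbT.
  by move: h; rewrite pmule_rle0 // lte_fin invr_gt0.
have : P.-negligible (\bigcup_n A n).
  by apply: negligible_bigcup => n; apply/negligibleP; [exact: GM|exact: PA].
apply: negligibleS.
move=> x /= /not_implyP[Bx /negP]; rewrite -ltNge => Y12.
have Y2fin : Y2 x \is a fin_num.
  by rewrite ge0_fin_numE // (lt_le_trans Y12) // leey.
have [y y0 yE] : exists2 y : R, 0 < y & (Y2 x + y%:E <= Y1 x)%E.
  move: Y12 (p1 x); rewrite -(fineK Y2fin); case: (Y1 x) => [r| |] //.
    rewrite lte_fin => lt _; exists (r - fine (Y2 x)); first by rewrite subr_gt0.
    by rewrite -EFinD addrC subrK.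
  by move=> _ _; exists 1 => //; rewrite leey.
pose n := maxn (Num.truncn (fine (Y2 x))) (Num.truncn y^-1).
exists n => //; split => //; split => /=.
  rewrite -(fineK Y2fin) lee_fin ltW // (lt_le_trans (truncnS_gt _)) //.
  by rewrite ler_nat ltnS leq_maxl.
apply: le_trans yE; rewrite leeD2l // lee_fin /e invf_ple ?posrE //.
by rewrite ltW // (lt_le_trans (truncnS_gt _)) // ler_nat ltnS leq_maxr.
Qed.

(** Monotonicity, homogeneity and subadditivity come together, local to an event
    of [G], because they have the same proof. *)
Lemma cexp_ge0_le (u v w : T -> R) (a : R) B :
  measurable_fun setT u -> measurable_fun setT v -> measurable_fun setT w ->
  (forall x, 0 <= u x) -> (forall x, 0 <= v x) -> (forall x, 0 <= w x) ->
  0 <= a -> G B -> (\forall x \ae P, B x -> u x <= a * (v x + w x)) ->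
  \forall x \ae P, B x -> (cexp_ge0 P G (EFin \o u) x <= a%:E *
    (cexp_ge0 P G (EFin \o v) x + cexp_ge0 P G (EFin \o w) x))%E.
Proof.
move=> mu mv mw u0 v0 w0 a0 GB uvw.
have [mU U0 UE] := cexp_ge0P mu u0.
have [mV V0 VE] := cexp_ge0P mv v0.
have [mW W0 WE] := cexp_ge0P mw w0.
have mVW : measurable_wrt G
    (cexp_ge0 P G (EFin \o v) \+ cexp_ge0 P G (EFin \o w))%E.
  exact: emeasurable_funD.
apply: ae_ge0_le_of_integral_le => //.
- by apply: measurable_funeM.
- by move=> x; rewrite mule_ge0 ?adde_ge0.
move=> A GA AB; have mA := GM GA.
have mS (Y : T -> \bar R) : measurable_wrt G Y -> measurable_fun A Y.
  by move=> mY; apply: measurable_funTS; exact: measurable_wrtW mY.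
rewrite UE // ge0_integralZl //; last 2 first.
- exact: mS.
- by move=> x _; rewrite adde_ge0.
rewrite ge0_integralD //; last 2 first.
- exact: mS.
- exact: mS.
rewrite VE // WE // -ge0_integralD //; last 4 first.
- by move=> x _; rewrite lee_fin.
- exact/measurable_EFinP/measurable_funTS.
- by move=> x _; rewrite lee_fin.
- exact/measurable_EFinP/measurable_funTS.
rewrite -ge0_integralZl //; last 2 first.
- by apply/measurable_EFinP/measurable_funTS; exact: measurable_funD.
- by move=> x _; rewrite lee_fin addr_ge0.
apply: ae_ge0_le_integral => //.
- by move=> x _; rewrite lee_fin.
- exact/measurable_EFinP/measurable_funTS.
- by move=> x _; rewrite lee_fin mulr_ge0 ?addr_ge0.
- by apply/measurable_EFinP/measurable_funTS/measurable_funM => //; exact: measurable_funD.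
by apply: filterS uvw => x h Ax; rewrite lee_fin; exact/h/AB.
Qed.

Lemma cexp_ge0_eq0 (u : T -> R) B :
  measurable_fun setT u -> (forall x, 0 <= u x) ->
  G B -> (\forall x \ae P, B x -> u x = 0) ->
  \forall x \ae P, B x -> cexp_ge0 P G (EFin \o u) x = 0%E.
Proof.
move=> mu u0 GB uB.
have := @cexp_ge0_le u (cst 0) (cst 0) 0 B.
move=> /(_ mu (@measurable_cst _ _ _ _ _ _) (@measurable_cst _ _ _ _ _ _)).
move=> /(_ u0 (fun=> lexx _) (fun=> lexx _) (lexx _) GB) h.
have [_ U0 _] := cexp_ge0P mu u0.
apply: filterS (h _); last first.
  by apply: filterS uB => x + Bx => ->; rewrite ?mul0r.
by move=> x + Bx => /(_ Bx); rewrite mul0e => le0; apply/eqP; rewrite eq_le le0 U0.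
Qed.

Lemma cexp_ge0_mono (u v : T -> R) B :
  measurable_fun setT u -> measurable_fun setT v ->
  (forall x, 0 <= u x) -> (forall x, 0 <= v x) ->
  G B -> (\forall x \ae P, B x -> u x <= v x) ->
  \forall x \ae P, B x ->
    (cexp_ge0 P G (EFin \o u) x <= cexp_ge0 P G (EFin \o v) x)%E.
Proof.
move=> mu mv u0 v0 GB uv.
have m0 : measurable_fun setT (cst 0 : T -> R) by exact: measurable_cst.
have h : \forall x \ae P, B x -> u x <= 1 * (v x + cst 0 x).
  by apply: filterS uv => x + Bx; rewrite addr0 mul1r; exact.
have := cexp_ge0_le mu mv m0 u0 v0 (fun=> lexx 0) ler01 GB h.
have := @cexp_ge0_eq0 (cst 0) setT m0 (fun=> lexx 0) (sub_sigma_algebraT sG).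
move=> /(_ (aeW _ (fun _ _ => erefl))).
by apply: filterS2 => x /(_ I) -> + Bx => /(_ Bx); rewrite adde0 mul1e.
Qed.

End conditional_expectation_ge0.

(** * Square-integrable martingales *)

Section filtration.
Context d (T : measurableType d) (R : realType) (P : probability T R).
Variable F : nat -> set (set T).
Hypothesis FF : filtration F.
Implicit Types (f g h u v : T -> R) (A B : set T).

Local Notation L2 := (Lfun P 2%:E).
Local Notation ip := (l2_inner P).
Local Notation nrm2 := (l2_norm P).
Local Notation Ex n := (cexp P (F n)).

Lemma filtration_sigma n : sigma_algebra [set: T] (F n).
Proof. by case: FF. Qed.

Lemma filtration_measurable n : F n `<=` measurable.
Proof. by case: FF. Qed.

Lemma filtration_mono m n : (m <= n)%N -> F m `<=` F n.
Proof. by case: FF => _ _ + _; exact. Qed.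

Local Notation sF := filtration_sigma.
Local Notation FM := (@filtration_measurable).

Lemma measurable_wrt_mono m n d' (U : measurableType d') (f : T -> U) :
  (m <= n)%N -> measurable_wrt (F m) f -> measurable_wrt (F n) f.
Proof.
move=> mn mf _ A mA; rewrite setTI (g_sigma_algebra_measurableE (sF n)).
exact/(filtration_mono mn)/(measurable_wrt_preimage (sF m)).
Qed.

Lemma measurable_wrt_indic n A : F n A -> measurable_wrt (F n) (\1_A : T -> R).
Proof.
by move=> FA; apply: measurable_indic; rewrite (g_sigma_algebra_measurableE (sF n)).
Qed.

Lemma Ex_L2 n f : f \in L2 -> Ex n f \in L2.
Proof. exact: cexp_in_L2 (sF n) (FM n) _. Qed.

Lemma Ex_wrt n f : f \in L2 -> measurable_wrt (F n) (Ex n f).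
Proof. by move=> f2; exact: measurable_wrt_cexp (sF n) (FM n) _ (L2_integrable f2). Qed.

Lemma ip_Ex n u f : u \in L2 -> f \in L2 -> measurable_wrt (F n) u ->
  ip u (Ex n f) = ip u f.
Proof. exact: ip_cexp (sF n) (FM n) _ _. Qed.

(** Used for events that a stopping time determines, off which nothing is
    known about [f] and [g]. *)
Lemma Ex_local n f g B : f \in L2 -> g \in L2 -> F n B ->
  (forall A, F n A -> A `<=` B -> ip \1_A f = ip \1_A g) ->
  \forall x \ae P, B x -> Ex n f x = Ex n g x.
Proof.
move=> f2 g2 FB fg.
apply: (cexp_local (sF n) (FM n) (L2_integrable f2) (L2_integrable g2) FB).
by move=> A FA AB; rewrite !integral_setE ?(fg A) //; exact: FM _ _ FA.
Qed.

Lemma Ex_unique n f g : f \in L2 -> g \in L2 -> measurable_wrt (F n) g ->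
  (forall A, F n A -> ip \1_A f = ip \1_A g) -> Ex n f = g %[ae P].
Proof.
move=> f2 g2 mg fg.
apply: (cexp_unique (sF n) (FM n) (L2_integrable f2)); split => //.
  exact: L2_integrable.
by move=> A FA; rewrite !integral_setE ?(fg A) //; exact: FM _ _ FA.
Qed.

Lemma ip_Ex_Ex m n f : f \in L2 -> (m <= n)%N ->
  ip (Ex m f) (Ex n f) = ip (Ex m f) (Ex m f).
Proof.
move=> f2 mn; have m2 := Ex_L2 m f2; have mm := @Ex_wrt m _ f2.
rewrite (ip_Ex m2 f2 mm) ip_Ex //; exact: measurable_wrt_mono mn mm.
Qed.

Lemma nrm2_Ex_sub m n f : f \in L2 -> (m <= n)%N ->
  nrm2 (Ex n f \- Ex m f) ^+ 2 =
  ip (Ex n f) (Ex n f) - ip (Ex m f) (Ex m f).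
Proof.
move=> f2 mn; have [m2 n2] := (Ex_L2 m f2, Ex_L2 n f2).
rewrite sqr_nrm2 ipBl ?L2B // !ipBr // (ipC P _ (Ex m f)) ip_Ex_Ex //; ring.
Qed.

Lemma nrm2_Ex_le n f : f \in L2 -> ip (Ex n f) (Ex n f) <= ip f f.
Proof.
move=> f2; have n2 := Ex_L2 n f2.
have := ip_ge0 P (f \- Ex n f).
rewrite ipBl ?L2B // !ipBr // (ipC P f) -(ip_Ex n2 f2 (Ex_wrt f2)); lra.
Qed.

(** Since the filtration generates the whole sigma-algebra, integrals over the
    sets of the filtration determine a function. *)
Lemma ae_eq_of_filtration f g : f \in L2 -> g \in L2 ->
  (forall n A, F n A -> ip \1_A f = ip \1_A g) -> f = g %[ae P].
Proof.
move=> f2 g2 fg; have D2 := L2B f2 g2; have iD := L2_integrable D2.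
pose nu := induced_charge iD.
have nuF n A : F n A -> nu A = 0%E.
  move=> FA; have mA := FM _ _ FA; rewrite /nu /induced_charge integral_setE //.
  by rewrite ipBr ?indic_in_L2 // (fg n A FA) subrr.
have gen : (measurable : set (set T)) = <<s \bigcup_n F n >> by case: FF.
have nu0 A : measurable A -> nu A = 0%E.
  rewrite gen; move: A; apply: (dynkin_induction (P := fun A => nu A = 0%E) gen).
  - move=> A1 A2 [n _ F1] [m _ F2]; exists (maxn n m) => //.
    apply: (sub_sigma_algebraI (sF _)).
      exact: filtration_mono (leq_maxl _ _) _ F1.
    exact: filtration_mono (leq_maxr _ _) _ F2.
  - apply: (nuF 0%N); exact: sub_sigma_algebraT (sF _).
  - by move=> B [n _ FB]; exact: nuF FB.
  - move=> S mS nuS.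
    have : nu (S `|` ~` S) = (nu S + nu (~` S))%E.
      by apply: chargeU => //; [exact: measurableC|rewrite setICr].
    rewrite setUv nuS add0e => <-; apply: (nuF 0%N).
    exact: sub_sigma_algebraT (sF _).
  - move=> B mB tB nuB.
    have : (fun n => \sum_(0 <= i < n) nu (B i))%E @ \oo --> nu (\bigcup_n B n).
      apply: (charge_semi_sigma_additive (s := induced_charge iD)) => //.
      exact: bigcupT_measurable.
    under eq_fun do rewrite big1 //.
    by move=> /(cvg_unique (@ereal_hausdorff R)) /(_ (cvg_cst _)).
have D0 : EFin \o (f \- g) = cst 0%E %[ae P].
  apply: integral_ae_eq => // E _ mE.
  by rewrite integral0 -[RHS](nu0 _ mE).
by apply: filterS D0 => x /= /(_ I) [] /eqP; rewrite subr_eq0 => /eqP.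
Qed.

(** By orthogonality the squared distance of two conditional expectations is a
    difference of their squared norms, which increase and are bounded; so the
    sequence is Cauchy, and [ae_eq_of_filtration] identifies its limit. *)
Lemma Ex_cvg f : f \in L2 -> (fun n => nrm2 (Ex n f \- f)) @ \oo --> 0.
Proof.
move=> f2; pose a n := ip (Ex n f) (Ex n f).
have a_mono m n : (m <= n)%N -> a m <= a n.
  by move=> mn; rewrite -subr_ge0 /a -nrm2_Ex_sub // sqr_ge0.
have aub : has_ubound (range a).
  by exists (ip f f) => _ [n _ <-]; exact: nrm2_Ex_le.
pose e k : R := (2^-1 ^+ k) ^+ 2.
have e0 k : 0 < e k by rewrite !exprn_gt0.
have asup : has_sup (range a) by split; [exists (a 0%N), 0%N|].
have : forall k, exists n, sup (range a) - e k < a n.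
  by move=> k; have [_ [n _ <-]] := sup_adherent (e0 k) asup; exists n.
move=> /choice[n0 n0P].
pose n1 k := \max_(j < k.+1) maxn j (n0 j).
have n1_mono k : (n1 k <= n1 k.+1)%N.
  by rewrite /n1 [leqRHS]big_ord_recr /= leq_maxl.
have n1_ge k : (maxn k (n0 k) <= n1 k)%N.
  by rewrite /n1 big_ord_recr /= leq_maxr.
have near_sup k m : (n1 k <= m)%N -> nrm2 (Ex m f \- Ex (n1 k) f) <= 2^-1 ^+ k.
  move=> km; rewrite -ler_sqr ?nnegrE ?nrm2_ge0 ?exprn_ge0 // nrm2_Ex_sub //.
  rewrite lerBlDr -lerBlDl.
  have am : a m <= sup (range a) by apply: ub_le_sup => //; exists m.
  have := a_mono (n0 k) (n1 k) (leq_trans (leq_maxr _ _) (n1_ge k)).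
  by have := n0P k; rewrite /e -/(a m) -/(a (n1 k)); lra.
have [g g2 Eg] : exists2 g, g \in L2 &
    forall k, nrm2 (Ex (n1 k) f \- g) <= 2 * 2^-1 ^+ k.
  by apply: L2_complete => k; [exact: Ex_L2|exact: near_sup].
have half0 : (fun k => 2^-1 ^+ k) @ \oo --> (0 : R).
  by apply: cvg_expr; rewrite ger0_norm // invf_lt1 // ltr1n.
have fg : f = g %[ae P].
  apply: ae_eq_of_filtration => // n A FA.
  have A2 := indic_in_L2 P (FM _ _ FA).
  apply/eqP; rewrite -subr_eq0 -normr_eq0 eq_le normr_ge0 andbT.
  have cv0 : (fun k => nrm2 \1_A * (2 * 2^-1 ^+ k)) @ \oo --> nrm2 \1_A * (2 * 0).
    by apply: cvgMr; exact: cvgMr.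
  rewrite !mulr0 in cv0; apply: (ler_cvg_to _ cv0); first exact: cvg_cst.
  exists n => // k /= nk.
  have nk1 : (n <= n1 k)%N := leq_trans nk (leq_trans (leq_maxl _ _) (n1_ge k)).
  have k2 := Ex_L2 (n1 k) f2.
  rewrite -(ip_Ex A2 f2 (measurable_wrt_mono nk1 (measurable_wrt_indic FA))).
  rewrite -ipBr //; apply: (le_trans (cauchy_schwarz A2 (L2B k2 g2))).
  by rewrite ler_wpM2l ?nrm2_ge0.
have gf0 : nrm2 (g \- f) = 0.
  rewrite /l2_norm (ip_ae (f' := cst 0)) ?ip0l ?sqrtr0 //.
  - exact: L2_measurable (L2B g2 f2).
  - exact: L2_measurable (L2B g2 f2).
  - by apply: filterS fg => x /= /(_ I) -> _; rewrite subrr.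
apply/cvgr0Pnorm_lt => eps eps0.
have /cvgr0Pnorm_lt/(_ (eps / 3)) [|k _ /(_ k (leqnn k)) kP] := half0.
  by rewrite divr_gt0.
rewrite ger0_norm ?exprn_ge0 // in kP.
exists (n1 k) => // m /= km; rewrite ger0_norm ?nrm2_ge0 //.
have [m2 k2] := (Ex_L2 m f2, Ex_L2 (n1 k) f2).
have := nrm2_triangle m2 k2 f2; have := nrm2_triangle k2 g2 f2.
have := near_sup k m km; have := Eg k; rewrite gf0.
by set q := 2^-1 ^+ k in kP *; lra.
Qed.

End filtration.

(** The increments are not those of a given martingale: most of them are
    obtained by cutting increments off by predictable events. *)
Definition mart_diff d (T : measurableType d) (R : realType)
    (P : probability T R) (F : nat -> set (set T)) (u : nat -> T -> R) : Prop :=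
  forall i, [/\ u i \in L2 P, measurable_wrt (F i.+1) (u i) &
    forall A, F i A -> l2_inner P \1_A (u i) = 0].

(** The square of the conditional square function; without the root it is
    additive in the increments. *)
Definition cond_sq d (T : measurableType d) (R : realType)
    (P : probability T R) (F : nat -> set (set T)) (f : nat -> T -> R)
    (x : T) : \bar R :=
  (\sum_(0 <= i <oo)
      cexp_ge0 P (F i) (fun y => (`|f i.+1 y - f i y| ^+ 2)%:E) x)%E.

Section martingale_differences.
Context d (T : measurableType d) (R : realType) (P : probability T R).
Variable F : nat -> set (set T).
Hypothesis FF : filtration F.
Implicit Types (f g h : nat -> T -> R) (u : nat -> T -> R) (v w : T -> R).
Implicit Types (A B : set T).

Local Notation L2 := (Lfun P 2%:E).
Local Notation ip := (l2_inner P).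
Local Notation Ex n := (cexp P (F n)).
Local Notation sF := (filtration_sigma FF).
Local Notation FM n := (@filtration_measurable _ _ _ FF n).
Local Notation FMs := (filtration_measurable FF).
Local Notation csq f i := (cexp_ge0 P (F i) (fun y => (`|f i.+1 y - f i y| ^+ 2)%:E)).

Section mart_diff.
Variable u : nat -> T -> R.
Hypothesis Hu : mart_diff P F u.

Lemma mart_diff_L2 i : u i \in L2. Proof. by case: (Hu i). Qed.

Lemma mart_diff_wrt i : measurable_wrt (F i.+1) (u i). Proof. by case: (Hu i). Qed.

Lemma mart_diff_orth i v : v \in L2 -> measurable_wrt (F i) v -> ip (u i) v = 0.
Proof.
move=> v2 mv; have [u2 _ uA] := Hu i.
have m0 : measurable_wrt (F i) (cst 0 : T -> R) by exact: measurable_cst.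
have Eu0 : Ex i (u i) = cst 0 %[ae P].
  apply: Ex_unique => // [|A FA]; first exact: L2_cst.
  by rewrite uA // ipC ip0l.
rewrite ipC -(ip_Ex FF v2 u2 mv) ipC (ip_ae _ _ _ Eu0) ?ip0l //.
- exact: L2_measurable (Ex_L2 FF _ u2).
- exact: L2_measurable v2.
Qed.

(** The pairing only sees the increment of [v] at the same time. *)
Lemma mart_diff_ip i v : v \in L2 -> ip (u i) v = ip (u i) (Ex i.+1 v \- Ex i v).
Proof.
move=> v2; have [u2 mu _] := Hu i; have [E1 E0] := (Ex_L2 FF i.+1 v2, Ex_L2 FF i v2).
rewrite ipBr // (ip_Ex FF u2 v2 mu) (mart_diff_orth E0) ?subr0 //.
exact: Ex_wrt.
Qed.

Lemma mart_diff_sum_L2 n : (fun x => \sum_(0 <= i < n) u i x) \in L2.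
Proof. by apply: L2_sum => i _; exact: mart_diff_L2. Qed.

Lemma mart_diff_sum_wrt n j : (n <= j)%N ->
  measurable_wrt (F j) (fun x => \sum_(0 <= i < n) u i x).
Proof.
move=> nj; rewrite /measurable_wrt; under eq_fun do rewrite big_mkord.
apply: measurable_sum => i.
have ij : (i.+1 <= j)%N := leq_trans (ltn_ord i) nj.
exact: (measurable_wrt_mono FF ij (@mart_diff_wrt i)).
Qed.

Lemma mart_diff_Ex n j :
  Ex j (fun x => \sum_(0 <= i < n) u i x) =
  (fun x => \sum_(0 <= i < minn j n) u i x) %[ae P].
Proof.
apply: Ex_unique => //; do ?exact: mart_diff_sum_L2.
  exact: mart_diff_sum_wrt (geq_minl _ _).
move=> A FA; have A2 := indic_in_L2 P (FMs FA).
rewrite ipC [RHS]ipC !ip_suml //; do ?by move=> i _; exact: mart_diff_L2.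
rewrite (big_cat_nat (n := minn j n)) ?geq_minr //= [X in _ + X]big1_seq ?addr0 //.
move=> i /andP[_]; rewrite mem_index_iota geq_min => /andP[/orP[ji|ni] iltn].
  apply: mart_diff_orth => //.
  exact (measurable_wrt_mono FF ji (measurable_wrt_indic FF FA)).
by rewrite leqNgt iltn in ni.
Qed.

Lemma mart_diff_sum_ip n : let w x := \sum_(0 <= i < n) u i x in
  ip w w = \sum_(0 <= i < n) ip (u i) (u i).
Proof.
elim: n => [|n IH] /=.
  by under eq_fun do rewrite big_nil; rewrite big_nil ip0l.
have sum2 := mart_diff_sum_L2 n; have u2 := mart_diff_L2 n.
rewrite big_nat_recr //= -IH.
have -> : (fun x => \sum_(0 <= i < n.+1) u i x) =
    (fun x => \sum_(0 <= i < n) u i x) \+ u n.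
  by apply/funext => x; rewrite big_nat_recr.
rewrite ipDl ?L2D // !ipDr // (ipC _ _ (u n)) mart_diff_orth //; first by ring.
exact: mart_diff_sum_wrt.
Qed.

End mart_diff.

Lemma Ex_mart_diff v : v \in L2 -> mart_diff P F (fun i => Ex i.+1 v \- Ex i v).
Proof.
move=> v2 i; have [E1 E0] := (Ex_L2 FF i.+1 v2, Ex_L2 FF i v2); split.
- exact: L2B.
- apply: measurable_funB; first exact: Ex_wrt.
  exact (measurable_wrt_mono FF (leqnSn i) (Ex_wrt FF v2)).
move=> A FA; have A2 := indic_in_L2 P (FMs FA).
have mA : measurable_wrt (F i) (\1_A : T -> R) := measurable_wrt_indic FF FA.
rewrite ipBr // (ip_Ex FF A2 v2 mA) (ip_Ex FF A2 v2) ?subrr //.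
exact (measurable_wrt_mono FF (leqnSn i) mA).
Qed.

Lemma bessel v n : v \in L2 ->
  \sum_(0 <= i < n) ip (Ex i.+1 v \- Ex i v) (Ex i.+1 v \- Ex i v) <= ip v v.
Proof.
move=> v2; under eq_bigr do rewrite -sqr_nrm2 (nrm2_Ex_sub FF) //.
rewrite (@telescope_sumr _ _ _ (fun i => ip (Ex i v) (Ex i v))) //.
apply: le_trans (nrm2_Ex_le FF n v2).
by rewrite gerBl ip_ge0.
Qed.

(** Cutting off by events of the past preserves the martingale property. The
    increments of a martingale in the Hardy space need not be
    square-integrable; this is what brings them into [L_2]. *)
Lemma martingale_mart_diff f (B : nat -> set T) : martingale0 P F f ->
  (forall i, F i (B i)) ->
  (forall i, (\int[P]_(x in B i) (`|f i.+1 x - f i x| ^+ 2)%:E < +oo)%E) ->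
  mart_diff P F (fun i x => \1_(B i) x * (f i.+1 x - f i x)).
Proof.
move=> [mf intf Ef _] FB fin i; have mB := FMs (FB i).
have mD : measurable_wrt (F i.+1) (fun x => f i.+1 x - f i x).
  apply: measurable_funB; first exact: mf.
  exact (measurable_wrt_mono FF (leqnSn i) (mf i)).
have mu : measurable_wrt (F i.+1) (fun x => \1_(B i) x * (f i.+1 x - f i x)).
  have FB1 : F i.+1 (B i) := filtration_mono FF (leqnSn i) (FB i).
  by apply: measurable_funM => //; exact (measurable_wrt_indic FF FB1).
have u2 : (fun x => \1_(B i) x * (f i.+1 x - f i x)) \in L2.
  apply: L2P; first exact (measurable_wrtW (sF i.+1) (FM i.+1) mu).
  apply: le_lt_trans (fin i); rewrite [leRHS]integral_mkcond.
  rewrite le_eqVlt; apply/orP; left; apply/eqP; apply: eq_integral => x _.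
  rewrite patchE indicE real_normK ?num_real //.
  by case: ifP => _; rewrite ?mul1r ?mul0r ?expr0n.
split => // A FA; have mA := FMs FA.
have FAB := sub_sigma_algebraI (sF i) FA (FB i).
apply: EFin_inj; rewrite -integral_setE //.
have -> : (\int[P]_(x in A) (\1_(B i) x * (f i.+1 x - f i x))%:E =
    \int[P]_(x in A `&` B i) ((f i.+1 x)%:E - (f i x)%:E))%E.
  rewrite [RHS]integral_mkcondr; apply: eq_integral => x _.
  by rewrite patchE indicE; case: ifP => _; rewrite ?mul1r ?mul0r.
have iS n : P.-integrable (A `&` B i) (EFin \o f n).
  by apply: (@integrableS _ _ _ _ setT) => //; exact: FMs FAB.
rewrite integralB; [|exact: FMs FAB|exact: iS|exact: iS].
rewrite -(integral_cexp (sF i) (FM i) (intf i.+1) FAB).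
have -> : (\int[P]_(x in A `&` B i) (cexp P (F i) (f i.+1) x)%:E =
    \int[P]_(x in A `&` B i) (f i x)%:E)%E.
  apply: ae_eq_integral; first exact: FMs FAB.
  - apply/measurable_EFinP/measurable_funTS.
    exact (measurable_cexp (sF i) (FM i) (intf i.+1)).
  - apply/measurable_EFinP/measurable_funTS.
    exact (measurable_wrtW (sF i) (FM i) (mf i)).
  by apply: filterS (Ef _ _ (leqnSn i)) => x /(_ I) -> _.
by rewrite subee // (integrable_fin_num (FMs FAB) (iS i)).
Qed.

Section square_function.

Let msq f i : (forall n, measurable_fun setT (f n)) ->
  measurable_fun setT (fun y => `|f i.+1 y - f i y| ^+ 2).
Proof.
by move=> mf; apply/measurable_funX/measurableT_comp => //; exact: measurable_funB.
Qed.

Let sq0 f i x : 0 <= `|f i.+1 x - f i x| ^+ 2.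
Proof. by rewrite exprn_ge0. Qed.

Lemma csqP f i : (forall n, measurable_fun setT (f n)) ->
  is_cexp_ge0 P (F i) (fun y => (`|f i.+1 y - f i y| ^+ 2)%:E) (csq f i).
Proof. by move=> mf; exact (cexp_ge0P P (sF i) (FM i) (@msq f i mf) (sq0 f i)). Qed.

Lemma csq_ge0 f i x : (forall n, measurable_fun setT (f n)) -> (0 <= csq f i x)%E.
Proof. by move=> mf; have [] := @csqP f i mf. Qed.

Lemma csq_wrt f i : (forall n, measurable_fun setT (f n)) ->
  measurable_wrt (F i) (csq f i).
Proof. by move=> mf; have [] := @csqP f i mf. Qed.

Lemma csq_measurable f i : (forall n, measurable_fun setT (f n)) ->
  measurable_fun setT (csq f i).
Proof. by move=> mf; exact (measurable_wrtW (sF i) (FM i) (csq_wrt mf)). Qed.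

Lemma cond_sq_ge0 f x : (forall n, measurable_fun setT (f n)) ->
  (0 <= cond_sq P F f x)%E.
Proof. by move=> mf; apply: nneseries_ge0 => i _ _; exact: csq_ge0. Qed.

Lemma cond_sq_measurable f : (forall n, measurable_fun setT (f n)) ->
  measurable_fun setT (cond_sq P F f).
Proof.
move=> mf; apply: ge0_emeasurable_sum => [i x _ _|i _]; first exact: csq_ge0.
exact: csq_measurable.
Qed.

Lemma csq_le f g h i (a : R) B :
  (forall n, measurable_fun setT (f n)) -> (forall n, measurable_fun setT (g n)) ->
  (forall n, measurable_fun setT (h n)) -> 0 <= a -> F i B ->
  (\forall x \ae P, B x -> `|f i.+1 x - f i x| ^+ 2 <=
     a * (`|g i.+1 x - g i x| ^+ 2 + `|h i.+1 x - h i x| ^+ 2)) ->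
  \forall x \ae P, B x -> (csq f i x <= a%:E * (csq g i x + csq h i x))%E.
Proof.
move=> mf mg mh a0 FB; exact (cexp_ge0_le (sF i) (FM i) (@msq f i mf) (@msq g i mg)
  (@msq h i mh) (sq0 f i) (sq0 g i) (sq0 h i) a0 FB).
Qed.

Lemma csq_mono f g i B :
  (forall n, measurable_fun setT (f n)) -> (forall n, measurable_fun setT (g n)) ->
  F i B -> (\forall x \ae P, B x -> f i.+1 x - f i x = g i.+1 x - g i x) ->
  \forall x \ae P, B x -> (csq f i x <= csq g i x)%E.
Proof.
move=> mf mg FB fg; apply: (cexp_ge0_mono (sF i) (FM i) (@msq f i mf) (@msq g i mg)
  (sq0 f i) (sq0 g i) FB).
by apply: filterS fg => x h Bx; rewrite h.
Qed.

Lemma csq_eq0 f i B : (forall n, measurable_fun setT (f n)) -> F i B ->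
  (\forall x \ae P, B x -> f i.+1 x - f i x = 0) ->
  \forall x \ae P, B x -> csq f i x = 0%E.
Proof.
move=> mf FB fB; apply: (cexp_ge0_eq0 (sF i) (FM i) (@msq f i mf) (sq0 f i) FB).
by apply: filterS fB => x h Bx; rewrite h // normr0 expr0n.
Qed.

Lemma ae_forall_nat (Q : nat -> T -> Prop) :
  (forall i, \forall x \ae P, Q i x) -> \forall x \ae P, forall i, Q i x.
Proof.
move=> h; have := negligible_bigcup h.
by apply: negligibleS => x /= /existsNP[i Qi]; exists i.
Qed.

Lemma cond_sq_le f g h (a : R) :
  (forall n, measurable_fun setT (f n)) -> (forall n, measurable_fun setT (g n)) ->
  (forall n, measurable_fun setT (h n)) -> 0 <= a ->
  (forall i, \forall x \ae P, `|f i.+1 x - f i x| ^+ 2 <=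
     a * (`|g i.+1 x - g i x| ^+ 2 + `|h i.+1 x - h i x| ^+ 2)) ->
  \forall x \ae P,
    (cond_sq P F f x <= a%:E * (cond_sq P F g x + cond_sq P F h x))%E.
Proof.
move=> mf mg mh a0 fgh.
have : \forall x \ae P, forall i, (csq f i x <= a%:E * (csq g i x + csq h i x))%E.
  apply: ae_forall_nat => i.
  have fghT : \forall x \ae P, setT x -> `|f i.+1 x - f i x| ^+ 2 <=
     a * (`|g i.+1 x - g i x| ^+ 2 + `|h i.+1 x - h i x| ^+ 2).
    by apply: filterS (fgh i).
  have := csq_le mf mg mh a0 (sub_sigma_algebraT (sF i)) fghT.
  by apply: filterS => x; exact.
apply: filterS => x cle.
rewrite /cond_sq -nneseriesD; do ?by move=> i _ _; exact: csq_ge0.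
rewrite -nneseriesZl; last by move=> i _; rewrite adde_ge0 ?csq_ge0.
by apply: lee_nneseries => i _; [move=> _; exact: csq_ge0|exact: cle].
Qed.

(** The events [B i] may depend on time: a martingale started at a stopping
    time has no increments before it. *)
Lemma cond_sq_eq0 f (B : nat -> set T) : (forall n, measurable_fun setT (f n)) ->
  (forall i, F i (B i)) ->
  (forall i, \forall x \ae P, B i x -> f i.+1 x - f i x = 0) ->
  \forall x \ae P, (forall i, B i x) -> cond_sq P F f x = 0%E.
Proof.
move=> mf FB fB.
have : \forall x \ae P, forall i, B i x -> csq f i x = 0%E.
  by apply: ae_forall_nat => i; exact: csq_eq0.
apply: filterS => x c0 Bx; rewrite /cond_sq eseries0 // => i _ _.
exact: c0.
Qed.

Lemma integral_cond_sq_le v : v \in L2 ->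
  (\int[P]_x cond_sq P F (mart P F v) x <= (ip v v)%:E)%E.
Proof.
move=> v2; have mm n : measurable_fun setT (mart P F v n).
  exact: L2_measurable (Ex_L2 FF n v2).
rewrite /cond_sq integral_nneseries //; last 2 first.
- by move=> i; exact: csq_measurable.
- by move=> i x _; exact: csq_ge0.
apply: nneseries_le_bound => [i|n].
  by apply: integral_ge0 => x _; exact: csq_ge0.
apply: le_trans (_ : ((\sum_(0 <= i < n)
   ip (Ex i.+1 v \- Ex i v) (Ex i.+1 v \- Ex i v))%:E <= _)%E); last first.
  by rewrite lee_fin; exact: bessel.
rewrite -sumEFin; apply: lee_sum => i _.
have [_ _ ->] := @csqP _ i mm; last exact: sub_sigma_algebraT (sF i).
rewrite -ipE; last by apply: L2B; exact: Ex_L2.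
by under eq_integral do rewrite real_normK ?num_real //.
Qed.

End square_function.

End martingale_differences.

(** * Lorentz quasi-norms as dyadic sums *)

Definition dyadic_sum (R : realType) (p q : R) (a : int -> R) : \bar R :=
  (\esum_(k in [set: int]) ((2 ^ k * a k `^ p^-1) `^ q)%:E)%E.

(** Sums over all integers are handled as sums over [0 <= j < N.*2] of the
    terms at [window N j], which ranges over [- N <= k < N]. *)
Definition window (N j : nat) : int := j%:Z - N%:Z.

Section integer_sums.
Context (R : realType).
Implicit Types (a b c x y z : int -> R).

Lemma window_inj N : injective (window N).
Proof. by move=> i j /addIr[]. Qed.

Lemma window_surj N (k : int) : (absz k < N)%N ->
  exists2 j, (j < N.*2)%N & k = window N j.
Proof.
move=> kN; exists (absz (k + N%:Z)%R); first by rewrite -addnn; lia.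
by rewrite /window; lia.
Qed.

Lemma window_sum_le_esum x N : (forall k, 0 <= x k) ->
  ((\sum_(0 <= j < N.*2) x (window N j))%:E <=
    \esum_(k in [set: int]) (x k)%:E)%E.
Proof.
move=> x0; apply: esum_ge.
pose s := [seq window N j | j <- index_iota 0 N.*2].
exists [set` s]; first by split => //; exact: finite_seq.
rewrite -fsbig_seq; first by rewrite /s big_map sumEFin.
by rewrite map_inj_uniq ?iota_uniq //; exact: window_inj.
Qed.

Lemma esum_le_window_sum N0 x (B : \bar R) : (forall k, 0 <= x k) ->
  (forall N, (N0 <= N)%N -> ((\sum_(0 <= j < N.*2) x (window N j))%:E <= B)%E) ->
  (\esum_(k in [set: int]) (x k)%:E <= B)%E.
Proof.
move=> x0 xB; apply: ge_ereal_sup => _ [A [finA _] <-].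
have /finite_seqP[s sA] := finA.
pose N := maxn N0 (\max_(k <- s) absz k).+1.
apply: le_trans (xB N (leq_maxl _ _)).
pose w := [seq window N j | j <- index_iota 0 N.*2].
have -> : ((\sum_(0 <= j < N.*2) x (window N j))%:E =
    \sum_(k \in [set` w]) (x k)%:E)%E.
  rewrite -fsbig_seq; first by rewrite /w big_map sumEFin.
  by rewrite map_inj_uniq ?iota_uniq //; exact: window_inj.
apply: lee_fsum_nneg_subset; [exact: finA|exact: finite_seq| |by move=> k _; rewrite lee_fin].
move=> k; rewrite sA inE => ks; suff : k \in w by rewrite inE.
have [j jN ->] : exists2 j, (j < N.*2)%N & k = window N j.
  by apply: window_surj; rewrite leq_max ltnS (leq_bigmax_seq k) ?orbT.
by apply/mapP; exists j => //; rewrite mem_index_iota.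
Qed.

Lemma esum_le_combination (C : R) x y z : 0 <= C ->
  (forall k, 0 <= x k) -> (forall k, 0 <= y k) -> (forall k, 0 <= z k) ->
  (forall k, x k <= C * (y k + z k)) ->
  (\esum_(k in [set: int]) (x k)%:E <= C%:E *
    (\esum_(k in [set: int]) (y k)%:E + \esum_(k in [set: int]) (z k)%:E))%E.
Proof.
move=> C0 x0 y0 z0 xyz; apply: (esum_le_window_sum (N0 := 0)) => // N _.
apply: le_trans (_ : (C * (\sum_(0 <= j < N.*2) y (window N j) +
    \sum_(0 <= j < N.*2) z (window N j)))%:E <= _)%E.
  by rewrite lee_fin -big_split mulr_sumr ler_sum.
rewrite EFinM EFinD; apply: lee_wpmul2l; first by rewrite lee_fin.
by apply: leeD; exact: window_sum_le_esum.
Qed.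

Section dyadic.
Variables (p q : R).
Hypotheses (p0 : 0 < p) (q0 : 0 < q).
Local Notation dy := (dyadic_sum p q).

Let term0 a k : 0 <= (2 ^ k * a k `^ p^-1) `^ q.
Proof. exact: powR_ge0. Qed.

Let two0 (k : int) : 0 < (2 : R) ^ k.
Proof. by rewrite exprz_gt0. Qed.

Lemma dyadic_sum_ge0 a : (0 <= dy a)%E.
Proof. by apply: esum_ge0 => k _; rewrite lee_fin. Qed.

Lemma dyadic_sum0 : dy (fun=> 0) = 0%E.
Proof.
rewrite /dyadic_sum; apply: esum1 => k _.
by rewrite powR0 ?invr_neq0 ?gt_eqF // mulr0 powR0 ?gt_eqF.
Qed.

Lemma term_le a b k : 0 <= a k -> a k <= b k ->
  (2 ^ k * a k `^ p^-1) `^ q <= (2 ^ k * b k `^ p^-1) `^ q.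
Proof.
move=> a0 ab; rewrite ge0_ler_powR ?nnegrE ?(ltW q0) ?mulr_ge0 ?powR_ge0 ?(ltW (two0 _)) //.
rewrite ler_wpM2l ?(ltW (two0 _)) // ge0_ler_powR ?nnegrE ?invr_ge0 ?(ltW p0) //.
exact: le_trans ab.
Qed.

Lemma dyadic_sum_le a b : (forall k, 0 <= a k) -> (forall k, a k <= b k) ->
  (dy a <= dy b)%E.
Proof. by move=> a0 ab; apply: le_esum => k _; rewrite lee_fin term_le. Qed.

(** A shift of the index is a dilation of the function, so this is homogeneity
    for powers of [2]. *)
Lemma dyadic_sum_shift a b (s : int) :
  (forall k, 0 <= a k) -> (forall k, a k <= b (k - s)) ->
  (dy a <= ((2 ^ s) `^ q)%:E * dy b)%E.
Proof.
move=> a0 ab.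
have -> : dy a = (\esum_(k in [set: int])
    ((2 ^ (k + s) * a (k + s) `^ p^-1) `^ q)%:E)%E.
  apply: (@reindex_esum _ _ _ _ _ (fun k : int => k + s)); split => //.
    by move=> i j _ _ /addIr.
  by move=> k _; exists (k - s) => //; rewrite subrK.
have := @esum_le_combination ((2 ^ s) `^ q)
  (fun k => (2 ^ (k + s) * a (k + s) `^ p^-1) `^ q)
  (fun k => (2 ^ k * b k `^ p^-1) `^ q) (fun=> 0).
rewrite (@esum1 _ _ _ (fun=> 0%:E)) // adde0; apply => //.
  exact: powR_ge0.
move=> k; rewrite addr0 -powRM ?mulr_ge0 ?powR_ge0 ?(ltW (two0 _)) //.
rewrite mulrA (_ : 2 ^ s * 2 ^ k = 2 ^ (s + k)); last first.
  by rewrite expfzDr // pnatr_eq0.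
have := @term_le (fun k => a k) (fun k => b (k - s)) (s + k) (a0 _) (ab _).
by rewrite addrAC subrr add0r [(s + k)%R]addrC.
Qed.

Lemma dyadic_sum_add : exists2 C : R, 0 < C & forall a b c,
  (forall k, 0 <= a k) -> (forall k, 0 <= b k) -> (forall k, 0 <= c k) ->
  (forall k, a k <= b k + c k) -> (dy a <= C%:E * (dy b + dy c))%E.
Proof.
have p'0 : 0 < p^-1 by rewrite invr_gt0.
pose C := (2 `^ p^-1) `^ q * (2 `^ q) : R.
have C0 : 0 < C by rewrite mulr_gt0 ?powR_gt0.
exists C => // a b c a0 b0 c0 abc.
apply: esum_le_combination => // [|k]; first exact: ltW.
apply: (le_trans (term_le (b := fun k => b k + c k) (a0 _) (abc _))).
have t0 := ltW (two0 k).
apply: (@le_trans _ _ ((2 `^ p^-1 * (2 ^ k * b k `^ p^-1 + 2 ^ k * c k `^ p^-1)) `^ q)).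
  rewrite ge0_ler_powR ?nnegrE ?(ltW q0) ?mulr_ge0 ?addr_ge0 ?mulr_ge0 ?powR_ge0 //.
  rewrite -mulrDr mulrCA ler_wpM2l //; exact: powRD_le.
rewrite powRM ?powR_ge0 ?addr_ge0 ?mulr_ge0 ?powR_ge0 // /C -mulrA.
by rewrite ler_wpM2l ?powR_ge0 // powRD_le // mulr_ge0 ?powR_ge0.
Qed.

End dyadic.
End integer_sums.

Lemma dyadic_exponent (R : realType) (x : R) : 0 < x ->
  exists2 j : int, x <= 2 ^ j & 2 ^ j <= 2 * x.
Proof.
move=> x0; have l2 : 0 < ln (2 : R) by rewrite ln_gt0 // ltr1n.
exists (Num.ceil (ln x / ln 2)); rewrite -powR_intmul // /powR pnatr_eq0 /=.
  rewrite -{1}(lnK x0) ler_expR -ler_pdivrMr //; exact: ceil_ge.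
have -> : 2 * x = expR (ln 2 + ln x) by rewrite expRD !lnK ?posrE.
rewrite ler_expR -ler_pdivlMr // mulrDl mulfV ?gt_eqF // -lerBlDl.
by apply: ltW; have /andP[+ _] := ceil_itv (ln x / ln 2); rewrite intrD rmorphN1.
Qed.

Lemma poweR_rootK (R : realType) (Z : \bar R) (q : R) : 0 < q -> (0 <= Z)%E ->
  ((Z `^ q^-1) `^ q = Z)%E.
Proof. by move=> q0 Z0; rewrite -poweRrM mulVf ?gt_eqF // poweRe1. Qed.

Section lorentz.
Context d (T : measurableType d) (R : realType) (P : probability T R).
Variables (p q : R).
Hypotheses (p0 : 0 < p) (q0 : 0 < q).
Implicit Types (u : T -> \bar R).

Local Notation tail u t := (fine (P [set x | (t%:E < `|u x|)%E])).
Local Notation level u := (fun k : int => tail u (2 ^ k)).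

Lemma tail_measurable u (t : R) : measurable_fun setT u ->
  measurable [set x | (t%:E < `|u x|)%E].
Proof.
move=> mu; rewrite -[X in measurable X]setTI.
by apply: emeasurable_fun_o_infty => //; exact: measurableT_comp.
Qed.

Lemma fine_prob_le A B : measurable A -> measurable B -> A `<=` B ->
  fine (P A) <= fine (P B).
Proof.
move=> mA mB AB; rewrite fine_le ?fin_num_measure //.
by apply: le_measure => //; rewrite inE.
Qed.

Lemma fine_prob_ge0 A : 0 <= fine (P A).
Proof. exact/fine_ge0/measure_ge0. Qed.

Lemma tail_le u (s t : R) : measurable_fun setT u -> s <= t -> tail u t <= tail u s.
Proof.
move=> mu st; apply: fine_prob_le; [exact: tail_measurable..|].
by move=> x /=; apply: le_lt_trans; rewrite lee_fin.
Qed.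

Let itg u (t : R) := (t * tail u t `^ p^-1) `^ q / t.

Let itg_ge0 u (t : R) : 0 <= t -> 0 <= itg u t.
Proof. by move=> t0; rewrite divr_ge0 ?powR_ge0. Qed.

Let itg_measurable u : measurable_fun setT u ->
  measurable_fun (`]0, +oo[%classic : set R) (EFin \o itg u).
Proof.
move=> mu; apply/measurable_EFinP.
refine (eq_measurable_fun (fun t : R => (t * tail u t `^ p^-1) `^ q * t `^ (-1)) _ _).
  move=> t; rewrite inE /= in_itv /= andbT => t0.
  by rewrite powR_inv1 // ltW.
have mt : measurable_fun (`]0, +oo[%classic : set R) (fun t : R => tail u t).
  by apply: nonincreasing_measurable => // s t; exact: tail_le.
apply: measurable_funM.
  apply: (measurableT_comp (measurable_powR q)).
  by apply: measurable_funM => //; exact: (measurableT_comp (measurable_powR _)).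
by apply: measurable_funTS; exact: measurable_powR.
Qed.

Local Notation leb := (@lebesgue_measure R).

Let itg_window u N : measurable_fun setT u -> forall n,
  (\int[leb]_(t in `]2 ^ window N 0, 2 ^ window N n]) (itg u t)%:E =
   \sum_(0 <= j < n)
     \int[leb]_(t in `]2 ^ window N j, 2 ^ window N j.+1]) (itg u t)%:E)%E.
Proof.
move=> mu; have mono (i j : nat) : (i <= j)%N -> (2 : R) ^ window N i <= 2 ^ window N j.
  by move=> ij; rewrite ler_weXz2l ?ler1n // /window lerB // lez_nat.
have pos j : 0 < (2 : R) ^ window N j by rewrite exprz_gt0.
elim=> [|n IH].
  by rewrite big_geq // set_itvoc0 integral_set0.
rewrite big_nat_recr //= -IH -ge0_integral_setU //.
- congr (integral _ _ _); apply/seteqP; split => t /=; rewrite !in_itv /=.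
    move=> /andP[t1 t2]; have [tn|tn] := leP t (2 ^ window N n); [left|right].
      by apply/andP; split.
    by apply/andP; split.
  case=> /andP[t1 t2]; apply/andP; split => //.
    exact: le_trans t2 (mono _ _ (leqnSn n)).
  exact: le_lt_trans (mono 0%N n _) t1.
- apply: measurable_funS (itg_measurable mu) => // t.
  by case=> /=; rewrite !in_itv /= andbT => /andP[+ _]; apply: lt_trans.
- by move=> t [|] /=; rewrite in_itv /= => /andP[t1 _]; rewrite lee_fin itg_ge0 //;
    rewrite ltW // (lt_trans _ t1).
- apply/disj_setPS => t [] /=; rewrite !in_itv /= => /andP[_ t1] /andP[t2 _].
  by rewrite leNgt t2 in t1.
Qed.

(* On a dyadic interval the tail is between its values at the end points, and
    the other factors vary by a bounded ratio. *)
Let itg_le_piece u (k : int) : measurable_fun setT u ->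
  (\int[leb]_(t in `]2 ^ k, 2 ^ (k + 1)]) (itg u t)%:E <=
   (2 `^ q * (2 ^ k * level u k `^ p^-1) `^ q)%:E)%E.
Proof.
move=> mu; have k0 : 0 < (2 : R) ^ k by rewrite exprz_gt0.
pose c := 2 `^ q * (2 ^ k * level u k `^ p^-1) `^ q / 2 ^ k.
have k1 : (2 : R) ^ (k + 1) = 2 ^ k + 2 ^ k.
  by rewrite expfzDr ?pnatr_eq0 // expr1z mulr2n mulrDr mulr1.
apply: (@le_trans _ _ (\int[leb]_(t in `]2 ^ k, 2 ^ (k + 1)]) (cst c%:E t))%E).
  apply: ge0_le_integral => //.
  - move=> t /=; rewrite in_itv /= => /andP[t1 _].
    by rewrite lee_fin itg_ge0 // ltW // (lt_trans k0).
  - apply: measurable_funS (itg_measurable mu) => // t /=.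
    by rewrite !in_itv /= andbT => /andP[+ _]; exact: lt_trans.
  move=> t /=; rewrite in_itv /= lee_fin => /andP[t1 t2].
  have t0 := lt_trans k0 t1.
  rewrite /itg /c ler_pM ?powR_ge0 ?invr_ge0 ?(ltW t0) //; last first.
    by rewrite lef_pV2 ?posrE // ltW.
  rewrite -powRM ?mulr_ge0 ?powR_ge0 ?(ltW k0) //.
  rewrite ge0_ler_powR ?nnegrE ?(ltW q0) ?mulr_ge0 ?powR_ge0 ?(ltW k0) ?(ltW t0) //.
  rewrite mulrA ler_pM ?powR_ge0 ?(ltW t0) //.
    by rewrite mulr2n mulrDl mul1r -k1.
  by rewrite ge0_ler_powR ?nnegrE ?invr_ge0 ?(ltW p0) ?fine_prob_ge0 ?tail_le // ltW.
rewrite integral_cst //= lebesgue_measure_itv /= lte_fin k1 ltrDl k0.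
by rewrite -EFinB addrK -EFinM /c divfK ?gt_eqF.
Qed.

Let itg_ge_piece u (k : int) : measurable_fun setT u ->
  ((2 `^ (- q) / 2 * (2 ^ (k + 1) * level u (k + 1) `^ p^-1) `^ q)%:E <=
    \int[leb]_(t in `]2 ^ k, 2 ^ (k + 1)]) (itg u t)%:E)%E.
Proof.
move=> mu; have k0 : 0 < (2 : R) ^ k by rewrite exprz_gt0.
have k10 : 0 < (2 : R) ^ (k + 1) by rewrite exprz_gt0.
pose c := 2 `^ (- q) * (2 ^ (k + 1) * level u (k + 1) `^ p^-1) `^ q / 2 ^ (k + 1).
have k1 : (2 : R) ^ (k + 1) = 2 ^ k + 2 ^ k.
  by rewrite expfzDr ?pnatr_eq0 // expr1z mulr2n mulrDr mulr1.
apply: (@le_trans _ _ (\int[leb]_(t in `]2 ^ k, 2 ^ (k + 1)]) (cst c%:E t))%E).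
  rewrite integral_cst //= lebesgue_measure_itv /= lte_fin k1 ltrDl k0.
  rewrite -EFinB addrK -EFinM lee_fin /c k1 le_eqVlt; apply/orP; left; apply/eqP.
  by field; rewrite gt_eqF // addr_gt0.
apply: ge0_le_integral => //.
- by move=> t _; rewrite lee_fin !mulr_ge0 ?powR_ge0 // invr_ge0 ltW.
- apply: measurable_funS (itg_measurable mu) => // t /=.
  by rewrite !in_itv /= andbT => /andP[+ _]; exact: lt_trans.
move=> t /=; rewrite in_itv /= lee_fin => /andP[t1 t2].
have t0 := lt_trans k0 t1.
rewrite /itg /c ler_pM ?mulr_ge0 ?powR_ge0 ?invr_ge0 ?(ltW k10) //; last first.
  by rewrite lef_pV2 ?posrE.
have -> : 2 `^ (- q) = (2^-1) `^ q :> R by rewrite powRN -powR_inv1 // powRAC powR_inv1 ?powR_ge0.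
rewrite -powRM ?mulr_ge0 ?powR_ge0 ?invr_ge0 ?(ltW k10) //.
rewrite ge0_ler_powR ?nnegrE ?(ltW q0) ?mulr_ge0 ?powR_ge0 ?invr_ge0 ?(ltW k10) ?(ltW t0) //.
rewrite mulrA ler_pM ?powR_ge0 ?mulr_ge0 ?invr_ge0 ?(ltW k10) //.
  by rewrite (le_trans _ (ltW t1)) // k1; lra.
by rewrite ge0_ler_powR ?nnegrE ?invr_ge0 ?(ltW p0) ?fine_prob_ge0 ?tail_le.
Qed.

Let I u := (\int[leb]_(t in `]0%R, +oo[) (itg u t)%:E)%E.

Let windowS N j : window N j.+1 = window N j + 1.
Proof. by rewrite /window; lia. Qed.

Let term_ge0 u k : 0 <= (2 ^ k * level u k `^ p^-1) `^ q.
Proof. exact: powR_ge0. Qed.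

Let lorentz_integral_le u : measurable_fun setT u ->
  (I u <= (2 `^ q)%:E * dyadic_sum p q (level u))%E.
Proof.
move=> mu; pose J N := `]((2 : R) ^ window N 0), (2 ^ window N N.*2)].
have JE : `]0%R, +oo[%classic = \bigcup_N [set` J N].
  apply/seteqP; split => t /=; rewrite in_itv /= andbT.
    move=> t0; pose n := (Num.truncn t + Num.truncn t^-1).+1.
    have pow_gt (m : nat) : m%:R < 2 ^+ m :> R by rewrite -natrX ltr_nat ltn_expl.
    exists n => //=; rewrite in_itv /= /window add0r -addnn.
    have -> : (n + n)%:Z - n%:Z = n :> int by lia.
    rewrite -exprnN; apply/andP; split.
      rewrite invf_plt ?posrE ?exprn_gt0 // (lt_trans (truncnS_gt _)) //.
      by rewrite (le_lt_trans _ (pow_gt _)) // ler_nat ltnS leq_addl.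
    rewrite ltW // (lt_trans (truncnS_gt _)) //.
    by rewrite (le_lt_trans _ (pow_gt _)) // ler_nat ltnS leq_addr.
  by move=> [N _] /=; rewrite in_itv /= => /andP[+ _]; apply: lt_trans; rewrite exprz_gt0.
have pos (k : int) : 0 < (2 : R) ^ k by rewrite exprz_gt0.
have JS N : [set` J N] `<=` `]0%R, +oo[.
  by move=> t /=; rewrite !in_itv /= andbT => /andP[+ _]; exact: lt_trans.
have cv : (fun N => \int[leb]_(t in [set` J N]) (itg u t)%:E)%E @ \oo --> I u.
  rewrite /I JE; apply: ge0_nondecreasing_set_cvg_integral => //.
  - move=> m n mn; apply/subsetPset => t /=; rewrite !in_itv /= => /andP[t1 t2].
    apply/andP; split.
      by apply: le_lt_trans t1; rewrite ler_weXz2l ?ler1n // /window; lia.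
    apply: (le_trans t2); rewrite ler_weXz2l ?ler1n // /window -!addnn; lia.
  - by move=> N; apply: measurable_funS (itg_measurable mu) => //; exact: JS.
  - by move=> N t /JS /=; rewrite in_itv /= andbT lee_fin => /ltW; exact: itg_ge0.
rewrite -(cvg_lim _ cv) //; apply: lime_le; first exact: cvgP cv.
apply: nearW => N; rewrite itg_window //.
apply: (@le_trans _ _ ((2 `^ q)%:E * (\sum_(0 <= j < N.*2)
    (2 ^ window N j * level u (window N j) `^ p^-1) `^ q)%:E)%E).
  rewrite -EFinM mulr_sumr -sumEFin; apply: lee_sum => j _.
  by rewrite windowS; exact: itg_le_piece.
by apply: lee_wpmul2l; [rewrite lee_fin powR_ge0|exact: window_sum_le_esum].
Qed.

Let dyadic_sum_le_lorentz_integral u : measurable_fun setT u ->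
  ((2 `^ (- q) / 2)%:E * dyadic_sum p q (level u) <= I u)%E.
Proof.
move=> mu; pose C : R := 2 `^ (- q) / 2.
have C0 : 0 < C by rewrite divr_gt0 // powR_gt0.
have le_div : (dyadic_sum p q (level u) <= C^-1%:E * I u)%E.
  apply: (esum_le_window_sum (N0 := 0)) => // N _.
  have -> : (\sum_(0 <= j < N.*2) (2 ^ window N j * level u (window N j) `^ p^-1) `^ q =
      C^-1 * \sum_(0 <= j < N.*2) C * (2 ^ window N j * level u (window N j) `^ p^-1) `^ q).
    by rewrite -mulr_sumr mulKf // gt_eqF.
  rewrite EFinM; apply: lee_wpmul2l; first by rewrite lee_fin invr_ge0 ltW.
  have win j : window N j = window N.+1 j + 1 by rewrite /window; lia.
  apply: (@le_trans _ _ (\sum_(0 <= j < N.*2)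
     \int[leb]_(t in `]2 ^ window N.+1 j, 2 ^ window N.+1 j.+1]) (itg u t)%:E)%E).
    rewrite -sumEFin; apply: lee_sum => j _.
    by rewrite win windowS; exact: itg_ge_piece.
  rewrite -itg_window //; apply: ge0_subset_integral => //.
  - exact: itg_measurable.
  - by move=> t /=; rewrite in_itv /= andbT lee_fin => /ltW; exact: itg_ge0.
  by move=> t /=; rewrite !in_itv /= andbT => /andP[+ _]; apply: lt_trans; rewrite exprz_gt0.
apply: (le_trans (lee_wpmul2l _ le_div)); first by rewrite lee_fin ltW.
by rewrite muleA -EFinM mulfV ?gt_eqF // mul1e.
Qed.

(** The integral is cut at the powers of [2]. *)
Lemma lorentz_norm_dyadic u : measurable_fun setT u ->
  ((q * (2 `^ (- q) / 2))%:E * dyadic_sum p q (level u) <=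
     lorentz_norm P p q u `^ q)%E /\
  (lorentz_norm P p q u `^ q <= (q * 2 `^ q)%:E * dyadic_sum p q (level u))%E.
Proof.
move=> mu; have lo := dyadic_sum_le_lorentz_integral mu.
have hi := lorentz_integral_le mu.
have -> : lorentz_norm P p q u = ((q%:E * I u) `^ q^-1)%E by [].
have I0 : (0 <= I u)%E.
  by apply: integral_ge0 => t /=; rewrite in_itv /= andbT lee_fin => /ltW; exact: itg_ge0.
move: (I u) I0 lo hi => J J0 lo hi.
have qE0 : (0 <= q%:E)%E by rewrite lee_fin ltW.
rewrite poweR_rootK ?mule_ge0 //; split; rewrite EFinM -muleA.
  exact: lee_wpmul2l.
exact: lee_wpmul2l.
Qed.

End lorentz.

(** * The Hardy-Lorentz quasi-norm *)

Section probability_lemmas.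
Context d (T : measurableType d) (R : realType) (P : probability T R).
Implicit Types (A B C : set T).

Lemma fine_prob_le_ae A B : measurable A -> measurable B ->
  (\forall x \ae P, A x -> B x) -> fine (P A) <= fine (P B).
Proof.
move=> mA mB AB.
have mD : measurable (A `\` B) by exact: measurableD.
have D0 : P (A `\` B) = 0%E.
  apply/negligibleP => //; apply: negligibleS AB.
  by move=> x [Ax nBx] /= h; exact/nBx/h.
have -> : P A = P (A `&` B).
  transitivity (P (A `\` B) + P (A `&` B))%E; first exact: measureDI.
  by rewrite D0 add0e.
by apply: fine_prob_le => //; exact: measurableI.
Qed.

Lemma fine_probU_le A B : measurable A -> measurable B ->
  fine (P (A `|` B)) <= fine (P A) + fine (P B).
Proof.
move=> mA mB; have mAB := measurableU _ _ mA mB.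
rewrite -lee_fin EFinD !fineK ?fin_num_measure //; exact: measureU2.
Qed.

Lemma fine_prob_bigU_le (A : nat -> set T) m n : (forall j, measurable (A j)) ->
  fine (P [set x | exists2 j, (m <= j < n)%N & A j x]) <=
  \sum_(m <= j < n) fine (P (A j)).
Proof.
move=> mA; have [nm|/ltnW mn] := leqP n m.
  rewrite big_geq // (_ : [set x | _] = set0) ?measure0 //.
  apply/seteqP; split => x //= -[j /andP[mj jn]].
  by have := leq_trans jn (leq_trans nm mj); rewrite ltnn.
rewrite -(subnKC mn); elim: (n - m)%N => [|k IH].
  rewrite addn0 big_geq // (_ : [set x | _] = set0) ?measure0 //.
  apply/seteqP; split => x //= -[j /andP[mj jm]].
  by have := leq_trans jm mj; rewrite ltnn.
have mU l : measurable [set x | exists2 j, (m <= j < l)%N & A j x].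
  rewrite (_ : [set x | _] = \bigcup_(j in [set j | (m <= j < l)%N]) A j).
    by apply: bigcup_measurable => j _.
  by apply/seteqP; split => x /= [j]; exists j.
rewrite addnS big_nat_recr ?leq_addr //=.
rewrite (_ : [set x | _] =
  [set x | exists2 j, (m <= j < m + k)%N & A j x] `|` A (m + k)%N).
  by apply: (le_trans (fine_probU_le _ _)) => //; rewrite lerD2r.
apply/seteqP; split => x /=.
  move=> [j /andP[mj]]; rewrite ltnS leq_eqVlt => /orP[/eqP ->|jk Aj]; first by right.
  by left; exists j; rewrite ?mj.
move=> [[j /andP[mj jk] Aj]|Ak]; first by exists j => //; rewrite mj ltnW.
by exists (m + k)%N => //; rewrite leq_addr ltnSn.
Qed.

Lemma chebyshev_ge0 (Y : T -> \bar R) (s b : R) : measurable_fun setT Y ->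
  (forall x, (0 <= Y x)%E) -> 0 < s -> (\int[P]_x Y x <= b%:E)%E ->
  fine (P [set x | (s%:E < Y x)%E]) <= b / s.
Proof.
move=> mY Y0 s0 Yb.
have mA : measurable [set x | (s%:E < Y x)%E].
  by rewrite -[X in measurable X]setTI; exact: emeasurable_fun_o_infty.
rewrite ler_pdivlMr // mulrC -lee_fin EFinM fineK ?fin_num_measure //.
apply: le_trans Yb; rewrite -integral_cst //.
apply: (@le_trans _ _ (\int[P]_(x in [set x | (s%:E < Y x)%E]) Y x)%E).
  apply: ge0_le_integral => //.
  - by move=> x _; rewrite lee_fin ltW.
  - exact: measurable_funTS.
  - by move=> x /= /ltW.
by apply: ge0_subset_integral.
Qed.

End probability_lemmas.

Lemma poweR_le_inv (R : realType) (X Y : \bar R) (a q : R) :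
  0 < q -> 0 <= a -> (0 <= X)%E -> (0 <= Y)%E ->
  (X `^ q <= a%:E * Y `^ q)%E -> (X <= (a `^ q^-1)%:E * Y)%E.
Proof.
move=> q0 a0 X0 Y0 XY.
have E (Z : \bar R) : (0 <= Z)%E -> ((Z `^ q) `^ q^-1 = Z)%E.
  by move=> Z0; rewrite -poweRrM mulfV ?gt_eqF // poweRe1.
rewrite -(E X X0) -[X in (_ <= _ * X)%E](E Y Y0) -poweR_EFin -poweRM ?lee_fin ?poweR_ge0 //.
rewrite gt0_ler_poweR ?invr_ge0 ?(ltW q0) // in_itv /= leey andbT.
  exact: poweR_ge0.
by rewrite mule_ge0 ?poweR_ge0 // lee_fin.
Qed.

(** Transfer of estimates from dyadic sums [A], [B] to the quasi-norms [X],
    [Y] whose [q]-th powers they are equivalent to. *)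
Lemma poweR_le_scale (R : realType) (q c C b : R) (X Y A B : \bar R) :
  0 < q -> 0 < c -> 0 < C -> 0 <= b -> (0 <= X)%E -> (0 <= Y)%E ->
  (X `^ q <= C%:E * A)%E -> (c%:E * B <= Y `^ q)%E -> (A <= (b `^ q)%:E * B)%E ->
  (X <= ((C / c) `^ q^-1 * b)%:E * Y)%E.
Proof.
move=> q0 c0 C0 b0 X0 Y0 XA BY AB.
have K0 : 0 <= C / c by rewrite divr_ge0 // ltW.
have -> : (C / c) `^ q^-1 * b = (C / c * b `^ q) `^ q^-1.
  by rewrite [RHS]powRM ?powR_ge0 // -powRrM mulfV ?gt_eqF // powRr1.
apply: poweR_le_inv => //; first by rewrite mulr_ge0 ?powR_ge0.
apply: (le_trans XA); apply: (le_trans (lee_wpmul2l _ AB)); first by rewrite lee_fin ltW.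
rewrite muleA -EFinM (_ : C * b `^ q = C / c * b `^ q * c); last first.
  by field; rewrite gt_eqF.
rewrite EFinM -muleA; apply: lee_wpmul2l => //.
by rewrite lee_fin mulr_ge0 ?powR_ge0.
Qed.

Lemma poweR_le_quasi (R : realType) (q c C K : R) (X Y Z A B D : \bar R) :
  0 < q -> 0 < c -> 0 < C -> 0 < K -> (0 <= X)%E -> (0 <= Y)%E -> (0 <= Z)%E ->
  (0 <= B)%E -> (0 <= D)%E ->
  (X `^ q <= C%:E * A)%E -> (c%:E * B <= Y `^ q)%E -> (c%:E * D <= Z `^ q)%E ->
  (A <= K%:E * (B + D))%E ->
  (X <= ((C / (c / 2)) `^ q^-1 * K `^ q^-1)%:E * (Y + Z))%E.
Proof.
move=> q0 c0 C0 K0 X0 Y0 Z0 B0 D0 XA BY DZ ABD.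
apply: (@poweR_le_scale _ q (c / 2) C _ _ _ A (B + D)) => //.
- by rewrite divr_gt0.
- exact: powR_ge0.
- exact: adde_ge0.
- rewrite mulrC EFinM -muleA ge0_muleDr //.
  apply: (@le_trans _ _ ((2^-1)%:E * (Y `^ q + Z `^ q))%E).
    by apply: lee_wpmul2l; [rewrite lee_fin|exact: leeD].
  have mono (W : \bar R) : (0 <= W)%E -> (W <= Y + Z)%E -> (W `^ q <= (Y + Z) `^ q)%E.
    move=> W0 WYZ; rewrite gt0_ler_poweR ?(ltW q0) // in_itv /= leey andbT //.
    exact: adde_ge0.
  apply: (@le_trans _ _ ((2^-1)%:E * ((Y + Z) `^ q + (Y + Z) `^ q))%E).
    apply: lee_wpmul2l; first by rewrite lee_fin.
    by apply: leeD; apply: mono => //; rewrite ?leeDl ?leeDr.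
  have half : (2^-1 + 2^-1 = 1 :> R) by lra.
  rewrite ge0_muleDr ?poweR_ge0 // -ge0_muleDl ?lee_fin ?invr_ge0 //.
  by rewrite -EFinD half mul1e.
- by rewrite -powRrM mulVf ?gt_eqF // powRr1 // ltW.
Qed.

Lemma lee_mul_add (R : realType) (K s : R) (a b B D : \bar R) :
  0 <= K -> (0 <= B)%E -> (0 <= D)%E -> (a <= s%:E * B)%E -> (b <= s%:E * D)%E ->
  (K%:E * (a + b) <= (K * s)%:E * (B + D))%E.
Proof.
move=> K0 B0 D0 aB bD; rewrite EFinM -muleA; apply: lee_wpmul2l => //.
by rewrite ge0_muleDr // leeD.
Qed.

Section hardy_norm.
Context d (T : measurableType d) (R : realType) (P : probability T R).
Variable F : nat -> set (set T).
Hypothesis FF : filtration F.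
Variables (p q : R).
Hypotheses (p0 : 0 < p) (q0 : 0 < q).
Implicit Types (f g h : nat -> T -> R).

Local Notation L2 := (Lfun P 2%:E).
Local Notation Ex n := (cexp P (F n)).
Local Notation N f := (hardy_norm P F p q f).
Local Notation Sq f := (cond_sq P F f).

Definition sq_level f (k : int) : R :=
  fine (P [set x | (((2 ^ k) ^+ 2)%:E < Sq f x)%E]).

Local Notation hd f := (dyadic_sum p q (sq_level f)).

Definition measurable_seq f := forall n, measurable_fun setT (f n).

Lemma sq_level_ge0 f k : 0 <= sq_level f k.
Proof. exact: fine_prob_ge0. Qed.

Lemma sq_set_measurable f (s : \bar R) : measurable_seq f ->
  measurable [set x | (s < Sq f x)%E].
Proof.
move=> mf; rewrite -[X in measurable X]setTI.
have := emeasurable_fun_o_infty measurableT (cond_sq_measurable P FF mf) s.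
exact.
Qed.

Lemma cond_square_funE f x : measurable_seq f ->
  cond_square_fun P F f x = (Sq f x `^ 2^-1)%E.
Proof. by []. Qed.

Lemma lt_cond_square_fun f x (t : R) : measurable_seq f -> 0 <= t ->
  (t%:E < `|cond_square_fun P F f x|)%E = ((t ^+ 2)%:E < Sq f x)%E.
Proof.
move=> mf t0; rewrite cond_square_funE // gee0_abs ?poweR_ge0 //.
have := cond_sq_ge0 P FF x mf; case: (Sq f x) => [r| |] //.
  rewrite lee_fin => r0; rewrite poweR_EFin !lte_fin powR12_sqrt //.
  by rewrite -{1}(ger0_norm t0) -sqrtr_sqr !ltNge ler_sqrt ?sqr_ge0.
by move=> _; rewrite poweRyr ?ltry ?invr_eq0.
Qed.

Lemma cond_square_fun_measurable f : measurable_seq f ->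
  measurable_fun setT (cond_square_fun P F f).
Proof.
move=> mf; apply: (measurableT_comp (measurable_poweR _)).
exact: cond_sq_measurable.
Qed.

Lemma hardy_norm_ge0 f : (0 <= N f)%E.
Proof. exact: poweR_ge0. Qed.

(** The quasi-norm and its dyadic form are equivalent; from here on only the
    dyadic form is estimated. *)
Lemma hardy_norm_dyadic : exists c C : R, [/\ 0 < c, 0 < C &
  forall f, measurable_seq f ->
    (c%:E * hd f <= N f `^ q)%E /\ (N f `^ q <= C%:E * hd f)%E].
Proof.
exists (q * (2 `^ (- q) / 2)), (q * 2 `^ q); split.
- by rewrite mulr_gt0 // divr_gt0 // powR_gt0.
- by rewrite mulr_gt0 // powR_gt0.
move=> f mf; have ms := cond_square_fun_measurable mf.
have hdE : hd f = dyadic_sum p q (fun k : int =>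
    fine (P [set x | ((2 ^ k)%:E < `|cond_square_fun P F f x|)%E])).
  apply: eq_esum => k _; congr (((_ * (fine (P _)) `^ _) `^ _)%:E).
  apply/seteqP; split => x /=; rewrite lt_cond_square_fun // ltW // exprz_gt0 //.
rewrite hdE; exact: lorentz_norm_dyadic.
Qed.

Lemma hardy_norm_fin f : measurable_seq f -> (N f < +oo)%E <-> (hd f < +oo)%E.
Proof.
move=> mf; have [c [C [c0 C0 /(_ f mf)[lo hi]]]] := hardy_norm_dyadic.
split=> fin.
  rewrite ltey; apply/eqP => hoo; move: lo; rewrite hoo gt0_muley ?lte_fin //.
  by rewrite leye_eq => /eqP Noo; have := poweR_lty q fin; rewrite Noo ltxx.
have : (N f `^ q < +oo)%E by rewrite (le_lt_trans hi) // lte_mul_pinfty ?lee_fin ?(ltW C0).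
exact: lty_poweRy (lt0r_neq0 q0).
Qed.

Lemma sq_level_quasi f g h k : measurable_seq f -> measurable_seq g -> measurable_seq h ->
  (\forall x \ae P, (Sq f x <= 2%:E * (Sq g x + Sq h x))%E) ->
  sq_level f k <= sq_level g (k - 1) + sq_level h (k - 1).
Proof.
move=> mf mg mh fgh.
apply: le_trans (fine_probU_le P (sq_set_measurable _ mg) (sq_set_measurable _ mh)).
apply: fine_prob_le_ae; first exact: sq_set_measurable.
  by apply: measurableU; exact: sq_set_measurable.
apply: filterS fgh => x fgh fk.
have [gk|gk] := ltP ((2 ^ (k - 1)) ^+ 2)%:E (Sq g x); first by left.
have [hk|hk] := ltP ((2 ^ (k - 1)) ^+ 2)%:E (Sq h x); first by right.
exfalso; move: fk; rewrite /mkset ltNge => /negP; apply.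
apply: (le_trans fgh); apply: (le_trans (lee_wpmul2l _ (leeD gk hk))) => //.
rewrite -EFinD -EFinM lee_fin expfzDr ?pnatr_eq0 // exprN1 exprMn.
by have := sqr_ge0 ((2 : R) ^ k); lra.
Qed.

Lemma hardy_norm_quasi : exists2 C : R, 0 < C & forall f g h,
  measurable_seq f -> measurable_seq g -> measurable_seq h ->
  (\forall x \ae P, (Sq f x <= 2%:E * (Sq g x + Sq h x))%E) ->
  (N f <= C%:E * (N g + N h))%E.
Proof.
have [c [C [c0 C0 NE]]] := hardy_norm_dyadic.
have [K K0 add] := dyadic_sum_add p0 q0.
pose s : R := (2 ^ 1%:Z) `^ q; have s0 : 0 < s by rewrite powR_gt0.
have Ks0 : 0 < K * s by rewrite mulr_gt0.
exists ((C / (c / 2)) `^ q^-1 * (K * s) `^ q^-1).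
  by rewrite mulr_gt0 ?powR_gt0 // !divr_gt0.
move=> f g h mf mg mh fgh.
have [[[_ hi] [glo _]] [hlo _]] := (NE _ mf, NE _ mg, NE _ mh).
have hd0 u := dyadic_sum_ge0 p q (sq_level u).
apply: (poweR_le_quasi q0 c0 C0 Ks0 (hardy_norm_ge0 f) (hardy_norm_ge0 g)
  (hardy_norm_ge0 h) (hd0 g) (hd0 h) hi glo hlo).
have shift u : (dyadic_sum p q (fun k => sq_level u (k - 1)) <= s%:E * hd u)%E.
  by apply: (dyadic_sum_shift p0 q0) => // k; exact: sq_level_ge0.
apply: (le_trans (add _ (fun k => sq_level g (k - 1)) (fun k => sq_level h (k - 1))
  (sq_level_ge0 f) (fun k => sq_level_ge0 g _) (fun k => sq_level_ge0 h _)
  (fun k => sq_level_quasi k mf mg mh fgh))).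
exact: (lee_mul_add (ltW K0) (hd0 g) (hd0 h) (shift g) (shift h)).
Qed.

(** The factor is rounded up to a power of [2], which shifts the dyadic sum;
    hence the constant. *)
Lemma hardy_norm_scale : exists2 C : R, 0 < C & forall f g (a : R),
  measurable_seq f -> measurable_seq g ->
  (\forall x \ae P, (Sq f x <= (a ^+ 2)%:E * Sq g x)%E) ->
  (N f <= (C * `|a|)%:E * N g)%E.
Proof.
have [c [C [c0 C0 NE]]] := hardy_norm_dyadic.
pose K := C / c; have K0 : 0 < K by rewrite divr_gt0.
exists (K `^ q^-1 * 2); first by rewrite mulr_gt0 // powR_gt0.
move=> f g a mf mg fg.
have [[_ hi] [glo _]] := (NE _ mf, NE _ mg).
have scaled (b : R) : 0 <= b -> (hd f <= (b `^ q)%:E * hd g)%E ->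
    (N f <= (K `^ q^-1 * b)%:E * N g)%E.
  by move=> b0; exact: (poweR_le_scale q0 c0 C0 b0 (hardy_norm_ge0 f) (hardy_norm_ge0 g)).
have [a0|a0] := eqVneq a 0.
  have E : K `^ q^-1 * 2 * `|a| = K `^ q^-1 * 0 by rewrite a0 normr0 !mulr0.
  rewrite E; apply: (scaled 0 (lexx 0)).
  have z0 : ((((0 : R) `^ q)%:E * hd g) = dyadic_sum p q (fun=> 0%R))%E.
    by rewrite dyadic_sum0 // powR0 ?gt_eqF // mul0e.
  rewrite z0; apply: (dyadic_sum_le p0 q0) => k; first exact: sq_level_ge0.
  have P0 : fine (P set0) = 0 by rewrite measure0.
  rewrite -P0 /sq_level; apply: fine_prob_le_ae => //; first exact: sq_set_measurable.
  apply: filterS fg => x; rewrite a0 expr0n mul0e => f0 /=.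
  by rewrite ltNge (le_trans f0) ?lee_fin ?sqr_ge0.
have [j aj ja] : exists2 j : int, `|a| <= 2 ^ j & 2 ^ j <= 2 * `|a|.
  by apply: dyadic_exponent; rewrite normr_gt0.
have E : K `^ q^-1 * 2 * `|a| = K `^ q^-1 * (2 * `|a|) by rewrite mulrA.
have a20 : 0 <= 2 * `|a| by rewrite mulr_ge0.
rewrite E; apply: (scaled _ a20).
apply: (@le_trans _ _ (((2 ^ j) `^ q)%:E * hd g)%E); last first.
  apply: lee_wpmul2r; first exact: dyadic_sum_ge0.
  by rewrite lee_fin ge0_ler_powR ?nnegrE ?(ltW q0) ?mulr_ge0 // ltW // exprz_gt0.
apply: (dyadic_sum_shift p0 q0) => k; first exact: sq_level_ge0.
apply: fine_prob_le_ae; [exact: sq_set_measurable..|].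
apply: filterS fg => x fg /= fk; rewrite ltNge; apply/negP => gk.
move: fk; rewrite ltNge => /negP; apply; apply: (le_trans fg).
have sqa : (0 <= (a ^+ 2)%:E)%E by rewrite lee_fin sqr_ge0.
apply: (le_trans (lee_wpmul2l sqa gk)); rewrite -EFinM lee_fin -exprMn.
have ka : 2 ^ (k - j) * `|a| <= 2 ^ k.
  apply: (le_trans (ler_wpM2l _ aj)); first by rewrite ltW // exprz_gt0.
  by rewrite -expfzDr ?pnatr_eq0 // subrK.
rewrite -(real_normK (num_real (a * _))) normrM mulrC [`|2 ^ _|]ger0_norm; last first.
  by rewrite ltW // exprz_gt0.
by rewrite lerXn2r ?nnegrE ?mulr_ge0 // ltW // exprz_gt0.
Qed.

(** If the square function were infinite with probability [e > 0], then every
    term of the dyadic sum would be at least its value for [a = e], and these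
    are unbounded. *)
Lemma cond_sq_fin_ae f : measurable_seq f -> (N f < +oo)%E ->
  \forall x \ae P, (Sq f x < +oo)%E.
Proof.
move=> mf /(hardy_norm_fin mf) fin.
pose A := [set x | Sq f x = +oo%E].
have mA : measurable A.
  have -> : A = ~` [set x | (Sq f x < +oo)%E].
    apply/seteqP; split => x /=; first by move=> ->; rewrite ltxx.
    by move=> /negP; rewrite -leNgt leye_eq => /eqP.
  apply: measurableC; rewrite -[X in measurable X]setTI.
  exact: (emeasurable_fun_infty_o _ (cond_sq_measurable P FF mf)).
pose e := fine (P A); have e0 : 0 <= e by exact: fine_prob_ge0.
suff e_eq0 : e = 0.
  have : P.-negligible A.
    by apply/negligibleP => //; rewrite -(fineK (fin_num_measure P _ mA)) -/e e_eq0.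
  apply: negligibleS => x /= /negP; rewrite -leNgt leye_eq => /eqP //.
apply/eqP; rewrite eq_le e0 andbT leNgt; apply/negP => e_gt0.
pose M := fine (hd f).
have ME : hd f = M%:E by rewrite fineK // ge0_fin_numE ?dyadic_sum_ge0.
have M0 : 0 <= M by exact/fine_ge0/dyadic_sum_ge0.
have e_lev n : e <= sq_level f n%:Z.
  apply: fine_prob_le; [exact: mA|exact: sq_set_measurable|].
  by move=> x; rewrite /A /mkset => ->; rewrite ltry.
have eM n : (2 ^+ n * e `^ p^-1) `^ q <= M.
  apply: (le_trans (term_le p0 q0 (a := fun=> e) (b := sq_level f) (k := n%:Z) e0 (e_lev n))).
  rewrite -lee_fin -ME; apply: esum_ge; exists [set n%:Z].
    by split; [exact: finite_set1|].
  by rewrite fsbig_set1.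
have eb n : 2 ^+ n * e `^ p^-1 <= M `^ q^-1.
  have z0 : 0 <= 2 ^+ n * e `^ p^-1 by rewrite mulr_ge0 ?powR_ge0.
  have -> : 2 ^+ n * e `^ p^-1 = ((2 ^+ n * e `^ p^-1) `^ q) `^ q^-1.
    by rewrite -powRrM mulfV ?gt_eqF // powRr1.
  by rewrite ge0_ler_powR ?nnegrE ?invr_ge0 ?powR_ge0 ?(ltW q0).
have ep : 0 < e `^ p^-1 by rewrite powR_gt0.
pose n := (Num.truncn (M `^ q^-1 / e `^ p^-1)).+1.
have := eb n; rewrite -ler_pdivlMr // leNgt => /negP; apply.
apply: (lt_trans (truncnS_gt _)).
by rewrite -natrX ltr_nat ltn_expl.
Qed.

Lemma mart_measurable_seq v : v \in L2 -> measurable_seq (mart P F v).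
Proof. by move=> v2 n; exact: L2_measurable (Ex_L2 FF n v2). Qed.

Lemma Ex_linear n (a : R) v w : v \in L2 -> w \in L2 ->
  Ex n (fun x => a * v x + w x) = (fun x => a * Ex n v x + Ex n w x) %[ae P].
Proof.
move=> v2 w2; have [Ev2 Ew2] := (Ex_L2 FF n v2, Ex_L2 FF n w2).
have [av2 aE2] := (L2Z a v2, L2Z a Ev2).
apply: Ex_unique => //.
- exact: (L2D av2 w2).
- exact: (L2D aE2 Ew2).
- apply: measurable_funD; last exact: Ex_wrt.
  by apply: measurable_funM; [exact: measurable_cst|exact: Ex_wrt].
move=> A FA; have A2 := indic_in_L2 P (filtration_measurable FF FA).
have mA : measurable_wrt (F n) (\1_A : T -> R) := measurable_wrt_indic FF FA.
rewrite (ipDr av2 w2 A2) (ipDr aE2 Ew2 A2) !ipZr //.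
by rewrite (ip_Ex FF A2 v2 mA) (ip_Ex FF A2 w2 mA).
Qed.

Lemma sq_quasi_of_ae f g h : measurable_seq f -> measurable_seq g -> measurable_seq h ->
  (forall n, f n = (fun x => g n x + h n x) %[ae P]) ->
  \forall x \ae P, (Sq f x <= 2%:E * (Sq g x + Sq h x))%E.
Proof.
move=> mf mg mh fgh; apply: cond_sq_le => // i.
apply: filterS2 (fgh i) (fgh i.+1) => x /(_ I) -> /(_ I) ->.
rewrite !real_normK ?num_real //.
set a := g i.+1 x - g i x; set b := h i.+1 x - h i x.
have -> : g i.+1 x + h i.+1 x - (g i x + h i x) = a + b by rewrite /a /b; ring.
rewrite -subr_ge0 (_ : _ - _ = (a - b) ^+ 2) ?sqr_ge0 //; ring.
Qed.

End hardy_norm.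

(** * Sums of atoms *)

Lemma poweR_mono (R : realType) (r : R) (X Y : \bar R) :
  0 <= r -> (0 <= X)%E -> (X <= Y)%E -> (X `^ r <= Y `^ r)%E.
Proof.
move=> r0 X0 XY; rewrite gt0_ler_poweR // in_itv /= leey andbT //.
exact: le_trans XY.
Qed.

Section atomic_estimate.
Context d (T : measurableType d) (R : realType) (P : probability T R).
Variable F : nat -> set (set T).
Hypothesis FF : filtration F.
Variables (p q : R).
Hypotheses (p0 : 0 < p) (p2 : p < 2) (q0 : 0 < q).

Local Notation L2 := (Lfun P 2%:E).
Local Notation nrm2 := (l2_norm P).
Local Notation Sq f := (cond_sq P F f).
Local Notation hd f := (dyadic_sum p q (sq_level P F f)).

Lemma mart_add n (v w : T -> R) : v \in L2 -> w \in L2 ->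
  mart P F (v \+ w) n = (fun x => mart P F v n x + mart P F w n x) %[ae P].
Proof.
move=> v2 w2; have := Ex_linear FF n 1 v2 w2.
have -> : (fun x => 1 * v x + w x) = v \+ w by apply/funext => x; rewrite mul1r.
by apply: filterS => x; rewrite /mart mul1r.
Qed.

Local Opaque cond_sq hardy_norm mart.

(** The part [v] is controlled by its size, through the Chebyshev inequality,
    and [w] by its support. *)
Lemma sq_level_split (v w : T -> R) (A : set T) (k : int) (b : R) :
  v \in L2 -> w \in L2 -> measurable A -> nrm2 v <= b ->
  (\forall x \ae P, ~ A x -> Sq (mart P F w) x = 0%E) ->
  sq_level P F (mart P F (v \+ w)) k <= 2 * (2 ^ k) ^- 2 * b ^+ 2 + fine (P A).
Proof.
move=> v2 w2 mA vb wA; have vw2 := L2D v2 w2.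
have [[mv mw] mvw] := (mart_measurable_seq FF v2, mart_measurable_seq FF w2,
  mart_measurable_seq FF vw2).
have quasi := sq_quasi_of_ae FF mvw mv mw (fun n => mart_add n v2 w2).
have t0 : 0 < ((2 : R) ^ k) ^+ 2 by rewrite exprn_gt0 // exprz_gt0.
pose s : R := (2 ^ k) ^+ 2 / 2; have s0 : 0 < s by rewrite divr_gt0.
have mS : measurable [set x | (s%:E < Sq (mart P F v) x)%E].
  by apply: sq_set_measurable.
apply: (@le_trans _ _ (fine (P ([set x | (s%:E < Sq (mart P F v) x)%E] `|` A)))).
  apply: fine_prob_le_ae; [by apply: sq_set_measurable|exact: measurableU|].
  apply: filterS2 quasi wA => x quasi wA /= lt.
  have [Ax|nAx] := pselect (A x); [by right|left].
  move: quasi; rewrite (wA nAx) adde0 => quasi; rewrite ltNge; apply/negP => vs.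
  move: lt; rewrite ltNge => /negP; apply; apply: (le_trans quasi).
  have E2 : 2 * s = (2 ^ k) ^+ 2 by rewrite /s mulrC divfK.
  have two0 : (0 <= 2%:E :> \bar R)%E by rewrite lee_fin.
  by have := lee_wpmul2l two0 vs; rewrite -EFinM E2.
apply: (le_trans (fine_probU_le P mS mA)); rewrite lerD2r.
have := chebyshev_ge0 (cond_sq_measurable P FF mv)
  (fun x => cond_sq_ge0 P FF x mv) s0 (integral_cond_sq_le FF v2).
move/le_trans; apply.
rewrite ler_pdivrMr // /s.
have -> : 2 * (2 ^ k) ^- 2 * b ^+ 2 * ((2 ^ k) ^+ 2 / 2) = b ^+ 2.
  by field; rewrite expfz_neq0 // pnatr_eq0.
by rewrite -sqr_nrm2 lerXn2r // nnegrE ?nrm2_ge0 // (le_trans (nrm2_ge0 P v)).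
Qed.

(** The converse of the atomic decomposition: [h k] is the multiple [2 ^ k] of
    an atom carried by [A k], in the sense that tails of the sum have a square
    function vanishing off the union of the carriers. *)
Lemma atomic_estimate : exists2 C : R, 0 < C &
  forall N0 (f : T -> R) (h : int -> T -> R) (A : int -> set T),
    (forall k, h k \in L2) -> (forall k, measurable (A k)) ->
    (forall k, nrm2 (h k) <= 2 ^ k * fine (P (A k)) `^ 2^-1) ->
    (forall N, (N0 <= N)%N ->
      f = fun x => \sum_(0 <= j < N.*2) h (window N j) x) ->
    (forall N m, \forall x \ae P,
      ~ (exists2 j, (m <= j < N.*2)%N & A (window N j) x) ->
      Sq (mart P F (fun x => \sum_(m <= j < N.*2) h (window N j) x)) x = 0%E) ->
    (hd (mart P F f) <= C%:E * dyadic_sum p q (fun k => fine (P (A k))))%E.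
Proof.
have [C C0 HC] := atomic_sum_le p0 p2 q0; exists C => //.
move=> N0 f h A h2 mA hA fE supp.
apply: (esum_le_window_sum (N0 := N0)) => [k|N N0N]; first exact: powR_ge0.
apply: (@le_trans _ _ (C * \sum_(0 <= j < N.*2)
  (2 ^ window N j * fine (P (A (window N j))) `^ p^-1) `^ q)%:E); last first.
  rewrite EFinM; apply: lee_wpmul2l; first by rewrite lee_fin ltW.
  by apply: window_sum_le_esum => k; exact: powR_ge0.
rewrite lee_fin.
pose c : R := 2 ^ (- N%:Z); have c0 : 0 < c by rewrite exprz_gt0.
have powE j : 2 ^ window N j = c * 2 ^+ j :> R.
  by rewrite /window expfzDr ?pnatr_eq0 // mulrC.
have scale (x : nat -> R) : (forall j, 0 <= x j) ->
    \sum_(0 <= j < N.*2) (2 ^ window N j * x j `^ p^-1) `^ q =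
    c `^ q * \sum_(0 <= j < N.*2) (2 ^+ j * x j `^ p^-1) `^ q.
  move=> x0; rewrite mulr_sumr; apply: eq_bigr => j _.
  by rewrite powE -mulrA [LHS]powRM ?(ltW c0) ?mulr_ge0 ?powR_ge0 ?exprn_ge0.
have conv (r r' t t' : R) : r = r' -> t = t' -> r' <= C * t' -> r <= C * t.
  by move=> -> ->.
apply: (conv _ _ _ _
  (scale (fun j => sq_level P F (mart P F f) (window N j)) (fun j => sq_level_ge0 _ _ _ _))
  (scale (fun j => fine (P (A (window N j)))) (fun j => fine_prob_ge0 _ _))).
rewrite mulrCA ler_wpM2l ?powR_ge0 //; apply: HC.
- by move=> j; exact: fine_prob_ge0.
- by move=> j; exact: sq_level_ge0.
move=> m mN.
pose v x := \sum_(0 <= j < m) h (window N j) x.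
pose w x := \sum_(m <= j < N.*2) h (window N j) x.
have v2 : v \in L2 by apply: L2_sum => j _; exact: h2.
have w2 : w \in L2 by apply: L2_sum => j _; exact: h2.
have -> : f = v \+ w.
  by rewrite (fE _ N0N); apply/funext => x; rewrite (big_cat_nat (n := m)) // ltnW.
pose b := c * \sum_(0 <= k < m) 2 ^+ k * fine (P (A (window N k))) `^ 2^-1.
have vb : nrm2 v <= b.
  apply: (le_trans (nrm2_sum _ (fun j _ => h2 (window N j)))).
  by rewrite /b mulr_sumr ler_sum // => j _; rewrite mulrA -powE.
pose U := [set x | exists2 j, (m <= j < N.*2)%N & A (window N j) x].
have mU : measurable U.
  rewrite (_ : U = \bigcup_(j in [set j | (m <= j < N.*2)%N]) A (window N j)).
    by apply: bigcup_measurable => j _.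
  by apply/seteqP; split => x /= [j]; exists j.
apply: (le_trans (sq_level_split (window N m) v2 w2 mU vb (supp N m))).
rewrite lerD //; last exact: (fine_prob_bigU_le P (A := fun j => A (window N j))).
rewrite /b powE le_eqVlt; apply/orP; left; apply/eqP.
set S := \sum_(0 <= k < m) _.
by field; rewrite expf_neq0 ?pnatr_eq0 //= gt_eqF.
Qed.

End atomic_estimate.

(** * Stopping times *)

Section stopping.
Context d (T : measurableType d) (R : realType) (P : probability T R).
Variable F : nat -> set (set T).
Hypothesis FF : filtration F.
Implicit Types (nu : T -> option nat) (g : T -> R).

Local Notation L2 := (Lfun P 2%:E).
Local Notation ip := (l2_inner P).
Local Notation nrm2 := (l2_norm P).
Local Notation Ex n := (cexp P (F n)).
Local Notation sF := (filtration_sigma FF).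
Local Notation FMs := (filtration_measurable FF).

Definition stops_by nu n := [set x : T | exists2 m, (m <= n)%N & nu x = Some m].
Definition stops_at nu n := [set x : T | nu x = Some n].
Definition stops nu := [set x : T | nu x <> None].

Lemma stops_atE nu n x : stops_at nu n x -> stops_by nu n x.
Proof. by exists n. Qed.

Lemma stops_at_F nu m n : stopping_time F nu -> (m <= n)%N -> F n (stops_at nu m).
Proof.
move=> st mn; apply: (filtration_mono FF mn).
case: m {mn} => [|m].
  have -> : stops_at nu 0 = stops_by nu 0.
    apply/seteqP; split => x; first exact: stops_atE.
    by move=> [k]; rewrite leqn0 => /eqP ->.
  exact: st.
have -> : stops_at nu m.+1 = stops_by nu m.+1 `&` ~` stops_by nu m.
  apply/seteqP; split => x /=.
    by move=> xm; split; [exact: stops_atE|move=> [k km]; rewrite xm => -[mk]; rewrite -mk ltnn in km].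
  move=> [[k km xk] nm]; rewrite /stops_at /= xk; congr Some; apply/eqP.
  rewrite eqn_leq km ltnNge; apply/negP => km'; apply: nm; exists k => //.
apply: (sub_sigma_algebraI (sF _)); first exact: st.
apply: (sub_sigma_algebraC (sF _)); apply: (filtration_mono FF (leqnSn m)).
exact: st.
Qed.

Lemma stops_measurable nu : stopping_time F nu -> measurable (stops nu).
Proof.
move=> st; have -> : stops nu = \bigcup_n stops_by nu n.
  apply/seteqP; split => x /=; last by move=> [n _ [m _ xm]]; rewrite /stops /= xm.
  by rewrite /stops /=; case E: (nu x) => [m|] // _; exists m => //; exists m.
by apply: bigcup_measurable => n _; apply: FMs; exact: st.
Qed.

Lemma prob_finiteE nu : prob_finite P nu = fine (P (stops nu)).
Proof. by []. Qed.

(** The function [g - g^nu] on the event [nu < N], and 0 elsewhere. Being a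
    finite sum it is computed with directly, and at each point it agrees with
    [g - g^nu] from some [N] on. *)
Definition stopped_tail g nu (N : nat) (x : T) : R :=
  \sum_(0 <= m < N) \1_(stops_at nu m) x * (g x - Ex m g x).

Lemma stopped_tailE g nu N x : stopped_tail g nu N x =
  if nu x is Some m then (if (m < N)%N then g x - Ex m g x else 0) else 0.
Proof.
rewrite /stopped_tail; case E: (nu x) => [m|]; last first.
  by rewrite big1 // => i _; rewrite indicE memNset ?mul0r // /stops_at /= E.
have i0 i : i != m -> \1_(stops_at nu i) x = 0 :> R.
  move=> im; rewrite indicE memNset // /stops_at /= E => -[mi].
  by rewrite mi eqxx in im.
case: ltnP => mN.
  rewrite (bigD1_seq m) ?mem_index_iota ?iota_uniq //= indicE mem_set // mul1r.
  by rewrite big1 ?addr0 // => i /i0 ->; rewrite mul0r.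
rewrite big_nat big1 // => i /andP[_ iN]; rewrite i0 ?mul0r //.
by rewrite neq_ltn (leq_trans iN mN).
Qed.

Section stopped_tail.
Variables (g : T -> R) (nu : T -> option nat).
Hypotheses (g2 : g \in L2) (st : stopping_time F nu).
Local Notation U := (stopped_tail g nu).

Let atom m x := \1_(stops_at nu m) x * (g x - Ex m g x).

Let atom_L2 m : atom m \in L2.
Proof.
apply: L2_indic; first exact: FMs (stops_at_F st (leqnn m)).
by apply: L2B => //; exact: Ex_L2.
Qed.

Let atom_ip0 m (A : set T) : F m A -> ip \1_A (atom m) = 0.
Proof.
move=> FA; have FB := stops_at_F st (leqnn m).
have FAB := sub_sigma_algebraI (sF m) FA FB.
have -> : ip \1_A (atom m) = ip \1_(A `&` stops_at nu m) (g \- Ex m g).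
  by apply: eq_Rintegral => x _; rewrite indicI /atom /= mulrA.
have A2 := indic_in_L2 P (FMs FAB); have Eg2 := Ex_L2 FF m g2.
rewrite ipBr // (ip_Ex FF A2 g2) ?subrr //.
exact (measurable_wrt_indic FF FAB).
Qed.

Lemma stopped_tail_L2 N : U N \in L2.
Proof. by apply: L2_sum => m _; exact: atom_L2. Qed.

Lemma stopped_tail_ip_F0 N (A : set T) : F 0%N A -> ip \1_A (U N) = 0.
Proof.
move=> FA; have A2 := indic_in_L2 P (FMs FA).
rewrite ipC ip_suml //; last by move=> m _; exact: atom_L2.
by rewrite big1 // => m _; rewrite ipC atom_ip0 //; exact (filtration_mono FF (leq0n m) FA).
Qed.

(** Before time [nu], all of [g - g^nu] lies in the future and averages out.
    The index [j] may be [i] or [i.+1] because [nu > i] is decided at time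
    [i]. *)
Lemma Ex_stopped_tail_before N i j : (i <= j <= i.+1)%N ->
  \forall x \ae P, ~ stops_by nu i x -> Ex j (U N) x = 0.
Proof.
move=> /andP[ij ji].
have FB : F j (~` stops_by nu i).
  by apply: (filtration_mono FF ij); apply: (sub_sigma_algebraC (sF i)); exact: st.
have loc := Ex_local FF (stopped_tail_L2 N) (L2_cst P 0) FB.
have E0 : Ex j (cst 0) = cst 0 %[ae P].
  apply: (Ex_unique FF (L2_cst P 0) (L2_cst P 0)) => //.
  exact: measurable_cst.
apply: filterS2 E0 (loc _) => [x /(_ I) -> //|A FA AB].
have A2 := indic_in_L2 P (FMs FA).
rewrite [RHS]ipC ip0l ipC ip_suml //; last by move=> m _; exact: atom_L2.
rewrite big1 // => m _; have [mi|im] := leqP m i; last first.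
  by rewrite ipC atom_ip0 //; exact (filtration_mono FF (leq_trans ji im) FA).
rewrite -[RHS](ip0l P \1_A); apply: eq_Rintegral => x _.
rewrite /atom !indicE mul0r; have [xA|] := boolP (x \in A); last by rewrite mulr0.
rewrite (memNset (A := stops_at nu m)) ?mul0r // => xm.
by move: xA; rewrite inE => /AB; apply; exists m.
Qed.

Lemma Ex_stopped_tail_after N m j : (m < N)%N -> (m <= j)%N ->
  \forall x \ae P, stops_at nu m x -> Ex j (U N) x = Ex j g x - Ex m g x.
Proof.
move=> mN mj; have FB := stops_at_F st mj; have Eg2 := Ex_L2 FF m g2.
have loc := Ex_local FF (stopped_tail_L2 N) (L2B g2 Eg2) FB.
have sub : Ex j (g \- Ex m g) = (fun x => Ex j g x - Ex m g x) %[ae P].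
  have Ej2 := Ex_L2 FF j g2; have mm := measurable_wrt_mono FF mj (Ex_wrt FF g2).
  apply: (Ex_unique FF (L2B g2 Eg2) (L2B Ej2 Eg2)).
    by apply: measurable_funB => //; exact: Ex_wrt.
  move=> A FA; have A2 := indic_in_L2 P (FMs FA).
  have m1 : measurable_wrt (F j) (\1_A : T -> R) := measurable_wrt_indic FF FA.
  by rewrite (ipBr g2 Eg2 A2) (ipBr Ej2 Eg2 A2) (ip_Ex FF A2 g2 m1).
apply: filterS2 sub (loc _) => [x /(_ I) -> //|A FA AB].
apply: eq_Rintegral => x _; rewrite !indicE.
have [xA|] := boolP (x \in A); last by rewrite !mul0r.
have xm : nu x = Some m by move: xA; rewrite inE => /AB.
by rewrite stopped_tailE xm mN.
Qed.

Lemma diff_stopped_tail_before N i :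
  \forall x \ae P, ~ stops_by nu i x -> Ex i.+1 (U N) x - Ex i (U N) x = 0.
Proof.
have h0 := @Ex_stopped_tail_before N i i; have h1 := @Ex_stopped_tail_before N i i.+1.
rewrite leqnn leqnSn in h0; rewrite leqnn leqnSn in h1.
by apply: filterS2 (h0 isT) (h1 isT) => x e0 e1 nx; rewrite e0 // e1 // subrr.
Qed.

Lemma diff_stopped_tail_after N i : (i < N)%N ->
  \forall x \ae P, stops_by nu i x ->
    Ex i.+1 (U N) x - Ex i (U N) x = Ex i.+1 g x - Ex i g x.
Proof.
move=> iN.
have : \forall x \ae P, forall m, (m <= i)%N -> stops_at nu m x ->
    Ex i.+1 (U N) x - Ex i (U N) x = Ex i.+1 g x - Ex i g x.
  apply: ae_forall_nat => m; have [mi|im] := leqP m i; last first.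
    by apply: aeW => x.
  have h0 := Ex_stopped_tail_after (leq_ltn_trans mi iN) mi.
  have h1 := Ex_stopped_tail_after (leq_ltn_trans mi iN) (leqW mi).
  by apply: filterS2 h0 h1 => x e0 e1 _ xm; rewrite e0 // e1 //; ring.
by apply: filterS => x h [m mi xm]; exact: h xm.
Qed.

(** On the event that [nu] is [m], the function [g - E_m g] is orthogonal to
    [E_m g], because the event is in [F m]. *)
Lemma ip_stopped_tail N : ip (U N) g = ip (U N) (U N).
Proof.
have U2 := stopped_tail_L2 N.
apply/eqP; rewrite -subr_eq0 -ipBr //; apply/eqP.
pose w m x := \1_(stops_at nu m) x * Ex m g x.
have FB m := stops_at_F st (leqnn m).
have w2 m : w m \in L2 by apply: L2_indic; [exact: FMs (FB m)|exact: Ex_L2].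
have ww m : measurable_wrt (F m) (w m).
  apply: measurable_funM; last exact: Ex_wrt.
  exact (measurable_wrt_indic FF (FB m)).
transitivity (ip (fun x => \sum_(0 <= m < N) atom m x * w m x) (cst 1)).
  apply: eq_Rintegral => x _; rewrite mulr1 /atom /w /= !stopped_tailE.
  have big0 n : nu x <> Some n ->
      \1_(stops_at nu n) x * (g x - Ex n g x) * (\1_(stops_at nu n) x * Ex n g x) = 0.
    by move=> xn; rewrite !indicE memNset // !mul0r.
  case E: (nu x) => [m|]; last by rewrite mul0r big1 // => n _; rewrite big0 // E.
  case: ltnP => mN; last first.
    rewrite mul0r big_nat big1 // => n /andP[_ nN]; rewrite big0 // E => -[mn].
    by rewrite mn leqNgt nN in mN.
  rewrite (bigD1_seq m) ?mem_index_iota ?iota_uniq //= !indicE mem_set // !mul1r.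
  rewrite big1 ?addr0; last first.
    by move=> n nm; rewrite big0 // E => -[mn]; rewrite mn eqxx in nm.
  by congr (_ * _); ring.
pose wg m : T -> R := atom m \* w m.
have int m : P.-integrable setT (EFin \o wg m) by exact: L2M_integrable.
have ip0 m : \int[P]_x wg m x = 0.
  have -> : \int[P]_x wg m x = ip (g \- Ex m g) (w m).
    apply: eq_Rintegral => x _; rewrite /wg /atom /w /= !indicE.
    by case: (_ \in _); rewrite ?mul1r // !mul0r mulr0.
  have Eg2 := Ex_L2 FF m g2.
  by rewrite ipBl // (ipC P _ (w m)) (ipC P (Ex m g)) (ip_Ex FF (w2 m) g2 (ww m)) subrr.
rewrite /l2_inner; under eq_Rintegral do rewrite mulr1.
have sum n : P.-integrable setT (EFin \o (fun x => \sum_(0 <= m < n) wg m x)) /\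
    \int[P]_x (\sum_(0 <= m < n) wg m x) = 0.
  elim: n => [|n [IHi IH0]].
    split; first by under eq_fun do rewrite big_geq //; exact: integrable0.
    by under eq_Rintegral do rewrite big_geq //; rewrite Rintegral_cst // mul0r.
  have E : (fun x => \sum_(0 <= m < n.+1) wg m x) =
      (fun x => \sum_(0 <= m < n) wg m x + wg n x).
    by apply/funext => x; rewrite big_nat_recr.
  split; first by rewrite E; exact: (integrableD measurableT IHi (int n)).
  by under eq_Rintegral do rewrite big_nat_recr //=; rewrite RintegralD // IH0 ip0 addr0.
exact: (sum N).2.
Qed.

Lemma stopped_diff_measurable : measurable_fun setT (g \- stopped_limit P F g nu).
Proof.
apply: (@measurable_fun_cvg _ _ _ _ U) => [N|x _]; first exact: L2_measurable (stopped_tail_L2 N).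
apply: cvg_near_cst.
rewrite /stopped_limit /=; case E: (nu x) => [m|].
  by exists m.+1 => // N /= mN; rewrite stopped_tailE E mN.
by apply: nearW => N; rewrite stopped_tailE E subrr.
Qed.

Lemma stopped_tail_cases N x : U N x = (g \- stopped_limit P F g nu) x \/ U N x = 0.
Proof.
rewrite stopped_tailE /stopped_limit /=; case: (nu x) => [m|]; last by right.
by case: ltnP; [left|right].
Qed.

Lemma nrm2_stopped_tail_le N :
  ((nrm2 (U N))%:E <= stopped_diff_norm P F 2 g nu)%E.
Proof.
have -> : ((nrm2 (U N))%:E = (\int[P]_x ((U N x) ^+ 2)%:E) `^ 2^-1)%E.
  by rewrite ipE ?stopped_tail_L2 // poweR_EFin powR12_sqrt ?ip_ge0.
rewrite /stopped_diff_norm unlock /Lnorm.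
apply: poweR_mono; [by rewrite invr_ge0|by apply: integral_ge0 => x _; rewrite lee_fin sqr_ge0|].
have mD := stopped_diff_measurable.
apply: ge0_le_integral => //.
- by move=> x _; rewrite lee_fin sqr_ge0.
- apply/measurable_EFinP/measurable_funX.
  exact: L2_measurable (stopped_tail_L2 N).
- apply: (measurableT_comp (measurable_poweR _)).
  by apply: measurableT_comp => //; exact/measurable_EFinP.
move=> x _ /=; rewrite lee_fin powR_mulrn // real_normK ?num_real //.
by case: (stopped_tail_cases N x) => -> //; rewrite expr0n sqr_ge0.
Qed.

Lemma stopped_diff_norm_le (b : R) : 0 <= b -> (forall N, nrm2 (U N) <= b) ->
  (stopped_diff_norm P F 2 g nu <= b%:E)%E.
Proof.
move=> b0 Ub; rewrite /stopped_diff_norm unlock /Lnorm.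
have -> : (b%:E = (b ^+ 2)%:E `^ 2^-1)%E.
  by rewrite poweR_EFin powR12_sqrt ?sqr_ge0 // sqrtr_sqr ger0_norm.
apply: poweR_mono; [by rewrite invr_ge0|by apply: integral_ge0 => x _; exact: poweR_ge0|].
pose Y N x := (U N x ^+ 2)%:E.
have mY N : measurable_fun setT (Y N).
  apply/measurable_EFinP/measurable_funX.
  exact: L2_measurable (stopped_tail_L2 N).
have cvY x : Y^~ x @ \oo --> (`|(g \- stopped_limit P F g nu) x|%:E `^ 2)%E.
  apply: cvg_near_cst; rewrite /Y /stopped_limit /=; case E: (nu x) => [m|].
    exists m.+1 => // N /= mN; rewrite stopped_tailE E mN.
    by rewrite powR_mulrn // real_normK ?num_real.
  apply: nearW => N; rewrite stopped_tailE E subrr normr0 powR0 ?expr0n //.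
have -> : (\int[P]_x (`|(EFin \o (g \- stopped_limit P F g nu)%R) x| `^ 2) =
    \int[P]_x limn_einf (Y^~ x))%E.
  by apply: eq_integral => x _; have [-> _] := cvg_limn_einf_sup (cvY x).
apply: (le_trans (fatou _ _ _ _)) => //.
  by move=> N x _; rewrite lee_fin sqr_ge0.
apply: limn_einf_le_bound; apply: nearW => N.
rewrite ipE ?stopped_tail_L2 // lee_fin -sqr_nrm2.
by rewrite lerXn2r // nnegrE nrm2_ge0.
Qed.

End stopped_tail.
End stopping.

(** * The pairing estimate *)

(** The predictable partial sums of the square function: [psq P F f i] is
    measurable with respect to [F i] although it involves [f i.+1]. *)
Definition psq d (T : measurableType d) (R : realType) (P : probability T R)
    (F : nat -> set (set T)) (f : nat -> T -> R) (i : nat) (x : T) : \bar R :=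
  (\sum_(0 <= j < i.+1)
     cexp_ge0 P (F j) (fun y => (`|f j.+1 y - f j y| ^+ 2)%:E) x)%E.

(** Since [psq P F f i] includes the increment that follows time [i], the
    martingale is stopped before the increment that would exceed [t]. *)
Definition passage_time d (T : measurableType d) (R : realType)
    (P : probability T R) (F : nat -> set (set T)) (f : nat -> T -> R)
    (t : \bar R) (x : T) : option nat :=
  if pselect (exists i, (t < psq P F f i x)%E) is left h
  then Some (ex_minn h) else None.

Section predictable.
Context d (T : measurableType d) (R : realType) (P : probability T R).
Variable F : nat -> set (set T).
Hypothesis FF : filtration F.
Variable f : nat -> T -> R.
Hypothesis mf : measurable_seq f.

Local Notation ip := (l2_inner P).
Local Notation sF := (filtration_sigma FF).
Local Notation FMs := (filtration_measurable FF).
Local Notation csq i := (cexp_ge0 P (F i) (fun y => (`|f i.+1 y - f i y| ^+ 2)%:E)).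
Local Notation pq := (psq P F f).

Let csq0 i x : (0 <= csq i x)%E.
Proof. exact: csq_ge0. Qed.

Lemma psq_mono i j x : (i <= j)%N -> (pq i x <= pq j x)%E.
Proof.
by move=> ij; rewrite /psq [leRHS](big_cat_nat (n := i.+1)) //= leeDl // sume_ge0.
Qed.

Lemma csq_le_psq i x : (csq i x <= pq i x)%E.
Proof. by rewrite /psq big_nat_recr //= leeDr // sume_ge0. Qed.

Lemma psq_wrt i : measurable_wrt (F i) (pq i).
Proof.
rewrite /measurable_wrt /psq; under eq_fun do rewrite big_mkord.
apply: emeasurable_sum => j.
have ji : (j <= i)%N by rewrite -ltnS.
exact (measurable_wrt_mono FF ji (csq_wrt P FF (i := j) mf)).
Qed.

Lemma psq_gt_F i t : F i [set x | (t < pq i x)%E].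
Proof.
rewrite -(g_sigma_algebra_measurableE (sF i)) -[X in measurable X]setTI.
have := emeasurable_fun_o_infty measurableT (psq_wrt (i := i)) t; exact.
Qed.

Lemma psq_le_F i t : F i [set x | (pq i x <= t)%E].
Proof.
have -> : [set x | (pq i x <= t)%E] = ~` [set x | (t < pq i x)%E].
  apply/seteqP; split => x /=; first by move=> le; apply/negP; rewrite -leNgt.
  by move=> /negP; rewrite -leNgt.
exact: sub_sigma_algebraC (sF i) _ (psq_gt_F i t).
Qed.

Lemma lt_cond_sq t x : (0 <= t)%E ->
  (t < cond_sq P F f x)%E <-> exists i, (t < pq i x)%E.
Proof.
move=> t0; split=> [|[i]].
  rewrite ltNge => /negP h; apply: contrapT => /forallNP H; apply: h.
  apply: nneseries_le_bound => [i|[|n]]; [exact: csq0|by rewrite big_geq|].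
  by rewrite leNgt; apply/negP; exact: H.
by move/lt_le_trans; apply; apply: nneseries_lim_ge => j _ _; exact: csq0.
Qed.

Lemma psq_le_cond_sq i x : (pq i x <= cond_sq P F f x)%E.
Proof. by apply: nneseries_lim_ge => j _ _; exact: csq0. Qed.

Lemma stops_by_passage t n :
  stops_by (passage_time P F f t) n = [set x | (t < pq n x)%E].
Proof.
apply/seteqP; split => x /=.
  move=> [m mn]; rewrite /passage_time; case: pselect => //= h [].
  case: ex_minnP => k tk _ km; apply: (lt_le_trans tk); apply: psq_mono.
  by rewrite km.
move=> tn; rewrite /stops_by /= /passage_time; case: pselect => [h|]; last by case; exists n.
exists (ex_minn h) => //; case: ex_minnP => k _; exact.
Qed.

Lemma passage_stopping_time t : stopping_time F (passage_time P F f t).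
Proof. by move=> n; have := psq_gt_F n t; rewrite -stops_by_passage. Qed.

Lemma stops_passage t : (0 <= t)%E ->
  stops (passage_time P F f t) = [set x | (t < cond_sq P F f x)%E].
Proof.
move=> t0; apply/seteqP; split => x.
  rewrite /stops /mkset /passage_time; case: pselect => // h _.
  by apply/(lt_cond_sq x t0).
rewrite /mkset => /(lt_cond_sq x t0) h.
by rewrite /stops /mkset /passage_time; case: pselect.
Qed.

(** The last increment that is counted leaves [psq], hence the sum so far, at
    most [t]. *)
Lemma sum_csq_le n (t : \bar R) x : (0 <= t)%E ->
  (\sum_(0 <= i < n) (if (pq i x <= t)%E then csq i x else 0) <= t)%E.
Proof.
move=> t0; elim: n => [|n IH]; first by rewrite big_geq.
have [nt|nt] := leP (pq n x) t; last first.
  by rewrite big_nat_recr //=; case: ifP => [/(lt_le_trans nt)|_]; rewrite ?ltxx // adde0.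
apply: le_trans nt; rewrite /psq; apply: lee_sum => i _.
by case: ifP.
Qed.

Lemma integral_csq i A : F i A ->
  (\int[P]_(x in A) csq i x = \int[P]_(x in A) (`|f i.+1 x - f i x| ^+ 2)%:E)%E.
Proof. by move=> FA; have [_ _ ->] := csqP P FF i mf. Qed.

Lemma integral_sq_fin i (t : R) A : 0 <= t -> F i A ->
  A `<=` [set x | (pq i x <= t%:E)%E] ->
  (\int[P]_(x in A) (`|f i.+1 x - f i x| ^+ 2)%:E < +oo)%E.
Proof.
move=> t0 FA At; rewrite -integral_csq //; have mA := FMs FA.
apply: (@le_lt_trans _ _ (\int[P]_(x in A) (cst t%:E x))%E).
  apply: ge0_le_integral => //.
  - by apply: measurable_funTS; exact: csq_measurable.
  - by move=> x /At; apply: le_trans; exact: csq_le_psq.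
by rewrite integral_cst // lte_mul_pinfty // (le_lt_trans (probability_le1 P mA)) ?ltry.
Qed.

(** The increments are orthogonal, and on an event of [F i] the energy of the
    increment of index [i] is the integral of its conditional square. *)
Lemma cut_norm_le n (B : nat -> set T) (t : R) (A : set T) :
  0 <= t -> measurable A -> (forall i, F i (B i)) -> (forall i, B i `<=` A) ->
  (forall i, B i `<=` [set x | (pq i x <= t%:E)%E]) ->
  mart_diff P F (fun i x => \1_(B i) x * (f i.+1 x - f i x)) ->
  ip (fun x => \sum_(0 <= i < n) \1_(B i) x * (f i.+1 x - f i x))
     (fun x => \sum_(0 <= i < n) \1_(B i) x * (f i.+1 x - f i x)) <= t * fine (P A).
Proof.
move=> t0 mA FB BA Bt md; set w := (fun x => _).
have -> : ip w w = \sum_(0 <= i < n) ip (fun x => \1_(B i) x * (f i.+1 x - f i x))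
    (fun x => \1_(B i) x * (f i.+1 x - f i x)).
  exact: (mart_diff_sum_ip FF md).
rewrite -lee_fin -sumEFin EFinM fineK ?fin_num_measure //.
have mcsqB i : measurable_fun setT (csq i \_ (B i)).
  apply/(measurable_restrictT _ (FMs (FB i))); apply: measurable_funTS.
  exact: csq_measurable.
apply: (@le_trans _ _ (\int[P]_x (\sum_(0 <= i < n) (csq i \_ (B i)) x))%E).
  rewrite ge0_integral_sum //; last first.
  - by move=> i x _; rewrite patchE; case: ifP.
  apply: lee_sum => i _; rewrite -integral_mkcond integral_csq //.
  rewrite -ipE; last exact: (mart_diff_L2 md).
  rewrite [leRHS]integral_mkcond le_eqVlt; apply/orP; left; apply/eqP.
  apply: eq_integral => x _; rewrite patchE indicE.
  by case: ifP => _; rewrite ?mul1r ?mul0r ?expr0n // real_normK ?num_real.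
rewrite -integral_cst // [leRHS]integral_mkcond.
apply: ge0_le_integral => //.
- by move=> x _; apply: sume_ge0 => i; rewrite patchE; case: ifP.
- by apply: emeasurable_sum => i; exact: mcsqB.
- apply/(measurable_restrictT _ mA); exact: measurable_cst.
move=> x _; rewrite patchE; have [xA|xA] := boolP (x \in A).
  apply: le_trans (sum_csq_le n x (t := t%:E) _); last by rewrite lee_fin.
  apply: lee_sum => i _; rewrite patchE.
  have [|_] := boolP (x \in B i); last by case: ifP.
  by rewrite inE => /Bt /= ->.
rewrite big1 // => i _; rewrite patchE; case: ifPn => //.
by rewrite inE => /BA Ax; rewrite mem_set in xA.
Qed.

End predictable.

Lemma indicator_split (R : realType) (a b c s : \bar R) :
  (a <= b)%E -> (b <= c)%E ->
  ((a < s)%E && (s <= b)%E)%:R + ((b < s)%E && (s <= c)%E)%:R =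
  ((a < s)%E && (s <= c)%E)%:R :> R.
Proof.
move=> ab bc; have [sb|bs] := leP s b.
  by rewrite addr0 (le_trans sb bc).
by rewrite andbF add0r (le_lt_trans ab bs).
Qed.

Lemma ip_ae_mul d (T : measurableType d) (R : realType) (P : probability T R)
  (f g f' g' : T -> R) :
  measurable_fun setT f -> measurable_fun setT g ->
  measurable_fun setT f' -> measurable_fun setT g' ->
  (\forall x \ae P, f x * g x = f' x * g' x) -> l2_inner P f g = l2_inner P f' g'.
Proof.
move=> mf mg mf' mg' e; congr fine; apply: ae_eq_integral => //.
- by apply/measurable_EFinP; exact: measurable_funM.
- by apply/measurable_EFinP; exact: measurable_funM.
- by apply: filterS e => x /= ->.
Qed.

Section pairing.
Context d (T : measurableType d) (R : realType) (P : probability T R).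
Variable F : nat -> set (set T).
Hypothesis FF : filtration F.
Variables v g : T -> R.
Hypotheses (v2 : v \in Lfun P 2%:E) (g2 : g \in Lfun P 2%:E).

Local Notation L2 := (Lfun P 2%:E).
Local Notation ip := (l2_inner P).
Local Notation nrm2 := (l2_norm P).
Local Notation Ex n := (cexp P (F n)).
Local Notation FMs := (filtration_measurable FF).
Local Notation f := (mart P F v).
Local Notation sq k := (((2 : R) ^ k) ^+ 2).
Local Notation nu k := (passage_time P F f (sq k)%:E).

Let mf : measurable_seq f. Proof. exact: mart_measurable_seq. Qed.

Let sq_ge0 k : 0 <= sq k. Proof. by rewrite exprn_ge0 // ltW // exprz_gt0. Qed.

Let sq_mono (k l : int) : k <= l -> sq k <= sq l.
Proof. by move=> kl; rewrite lerXn2r ?nnegrE ?ler_weXz2l ?ler1n // ltW // exprz_gt0. Qed.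

(* The increments of [f] on these events form one layer of its atomic
    decomposition. *)
Let B (k l : int) i := [set x | ((sq k)%:E < psq P F f i x)%E] `&`
  [set x | (psq P F f i x <= (sq l)%:E)%E].

Let FB k l i : F i (B k l i).
Proof.
by apply: (sub_sigma_algebraI (filtration_sigma FF i)); [exact: psq_gt_F|exact: psq_le_F].
Qed.

Let u k l i x := \1_(B k l i) x * (f i.+1 x - f i x).

Let u_md k l : mart_diff P F (u k l).
Proof.
move=> i; have [d2 dw dA] := Ex_mart_diff FF v2 i.
have mB := FMs (FB k l i).
have mBw : measurable_wrt (F i) (\1_(B k l i) : T -> R) := measurable_wrt_indic FF (FB k l i).
split.
- exact: L2_indic.
- apply: measurable_funM => //; exact (measurable_wrt_mono FF (leqnSn i) mBw).
move=> A FA; have FAB := sub_sigma_algebraI (filtration_sigma FF i) FA (FB k l i).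
rewrite -[RHS](dA _ FAB); apply: eq_Rintegral => x _.
by rewrite indicI /= mulrA.
Qed.

Let w n k l x := \sum_(0 <= i < n) u k l i x.

Let w_L2 n k l : w n k l \in L2.
Proof. exact: (mart_diff_sum_L2 (u_md k l)). Qed.

Let stops_sub k l i : B k l i `<=` stops (nu k).
Proof.
move=> x [tx _]; have t0 : (0 <= (sq k)%:E)%E by rewrite lee_fin.
by rewrite (stops_passage P FF mf t0) /mkset; apply/(lt_cond_sq P FF mf x t0); exists i.
Qed.

Let w_norm n k : nrm2 (w n k (k + 1)) <= 2 ^ (k + 1) * fine (P (stops (nu k))) `^ 2^-1.
Proof.
have mS := stops_measurable FF (passage_stopping_time P FF mf (sq k)%:E).
have h : ip (w n k (k + 1)) (w n k (k + 1)) <= sq (k + 1) * fine (P (stops (nu k))).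
  apply: (cut_norm_le FF mf n _ mS (FB k (k + 1)) (@stops_sub k (k + 1)) _ (u_md k (k + 1))) => //.
  by move=> i x [].
rewrite powR12_sqrt ?fine_prob_ge0 //.
have p0 : 0 <= (2 : R) ^ (k + 1) by rewrite ltW // exprz_gt0.
rewrite -{1}(ger0_norm p0) -sqrtr_sqr -sqrtrM ?sqr_ge0 // ler_sqrt //.
by rewrite mulr_ge0 ?sqr_ge0 ?fine_prob_ge0.
Qed.

(* The layer lives after the passage time of its lower level, where [g] and
    [g - g^nu] have the same increments. *)
Let ip_w n k : ip (w n k (k + 1)) g = ip (w n k (k + 1)) (stopped_tail P F g (nu k) n).
Proof.
have st := passage_stopping_time P FF mf (sq k)%:E.
have U2 := stopped_tail_L2 FF g2 st n.
have md := u_md k (k + 1).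
rewrite !ip_suml //; do ?by move=> i _; exact: (mart_diff_L2 md).
rewrite !big_nat; apply: eq_bigr => i /= iN.
rewrite (mart_diff_ip FF md i g2) (mart_diff_ip FF md i U2).
have diff_m h : h \in L2 -> measurable_fun setT (Ex i.+1 h \- Ex i h).
  by move=> h2; apply: L2_measurable; apply: L2B; exact: Ex_L2.
have um := L2_measurable (mart_diff_L2 md i).
apply: (ip_ae_mul um (diff_m _ g2) um (diff_m _ U2)).
apply: filterS (diff_stopped_tail_after FF g2 st iN) => x h.
rewrite /u indicE; case: (boolP (x \in _)) => [|_]; last by rewrite !mul0r.
by rewrite inE => -[xk _]; rewrite /= h // stops_by_passage.
Qed.

Let w_window n L x :
  \sum_(0 <= j < L.*2) w n (window L j) (window L j + 1) x =
  w n (window L 0) (window L L.*2) x.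
Proof.
rewrite /w exchange_big /=; apply: eq_bigr => i _.
rewrite -mulr_suml; congr (_ * _).
elim: (L.*2) => [|n' IH].
  rewrite big_geq // indicE memNset // => -[/= h1 h2].
  by have := lt_le_trans h1 h2; rewrite ltxx.
rewrite big_nat_recr //= {}IH.
have wS : window L n'.+1 = window L n' + 1 by rewrite /window; lia.
rewrite -wS !indicE.
have l1 : (sq (window L 0) <= sq (window L n')) by apply: sq_mono; rewrite /window; lia.
have l2 : (sq (window L n') <= sq (window L n'.+1)) by apply: sq_mono; rewrite /window; lia.
have mem k l : (x \in B k l i) = ((sq k)%:E < psq P F f i x)%E && (psq P F f i x <= (sq l)%:E)%E.
  by apply/idP/idP; rewrite inE => /andP.
rewrite !mem; apply: indicator_split; by rewrite lee_fin.
Qed.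

Let window_bound n L (b : R) :
  \sum_(0 <= j < L.*2) 2 ^ (window L j + 1) *
     fine (P (stops (nu (window L j)))) `^ 2^-1 *
     nrm2 (stopped_tail P F g (nu (window L j)) n) <= b ->
  `|ip (w n (window L 0) (window L L.*2)) g| <= b.
Proof.
apply: le_trans.
have -> : w n (window L 0) (window L L.*2) =
    (fun x => \sum_(0 <= j < L.*2) w n (window L j) (window L j + 1) x).
  by apply/funext => x; rewrite w_window.
rewrite ip_suml //.
apply: (le_trans (ler_norm_sum _ _ _)); apply: ler_sum => j _.
have st := passage_stopping_time P FF mf (sq (window L j))%:E.
rewrite ip_w; apply: (le_trans (cauchy_schwarz (w_L2 _ _ _) (stopped_tail_L2 FF g2 st n))).
by rewrite ler_wpM2r ?nrm2_ge0.
Qed.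

(* So no increment escapes all the layers between powers of [2]. *)
Let diff_ae i : \forall x \ae P, f i.+1 x - f i x != 0 ->
  ((0 < psq P F f i x) /\ (psq P F f i x < +oo))%E.
Proof.
have fin : \forall x \ae P, (cond_sq P F f x < +oo)%E.
  have int : P.-integrable setT (cond_sq P F f).
    apply/integrableP; split; first exact: cond_sq_measurable.
    under eq_integral do rewrite gee0_abs ?cond_sq_ge0 //.
    exact: le_lt_trans (integral_cond_sq_le FF v2) (ltry _).
  apply: filterS (integrable_ae measurableT int) => x /(_ I).
  by rewrite ge0_fin_numE // cond_sq_ge0.
have F0 := psq_le_F P FF mf i 0%E.
have m0 := FMs F0.
have z : \forall x \ae P, [set x | (psq P F f i x <= 0)%E] x -> f i.+1 x - f i x = 0.
  have : (\int[P]_(x in [set x | (psq P F f i x <= 0)%E])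
      `|(`|f i.+1 x - f i x| ^+ 2)%:E| = 0)%E.
    under eq_integral do rewrite gee0_abs ?lee_fin ?exprn_ge0 //.
    rewrite -(integral_csq P FF mf F0); apply: integral0_eq => x /= x0.
    apply/eqP; rewrite eq_le csq_ge0 // andbT; apply: le_trans x0.
    exact: csq_le_psq.
  have md : measurable_fun [set x | (psq P F f i x <= 0)%E]
      (fun x => (`|f i.+1 x - f i x| ^+ 2)%:E).
    apply: measurable_funTS; apply/measurable_EFinP/measurable_funX/measurableT_comp => //.
    exact: measurable_funB.
  move=> /(ae_eq_integral_abs P m0 md); apply: filterS => x /[apply] /= -[] /eqP.
  by rewrite sqrf_eq0 normr_eq0 => /eqP.
apply: filterS2 fin z => x fin z nz; split.
  by rewrite ltNge; apply: contra_neqN nz => /z.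
by apply: le_lt_trans fin; exact: psq_le_cond_sq.
Qed.

Let window_cvg i : (fun L => ip (u (window L 0) (window L L.*2) i) g) @ \oo -->
  ip (Ex i.+1 v \- Ex i v) g.
Proof.
have d2 : Ex i.+1 v \- Ex i v \in L2 by apply: L2B; exact: Ex_L2.
have intd := L2M_integrable d2 g2.
pose h L x := ((u (window L 0) (window L L.*2) i x) * g x)%:E.
have uL2 L : u (window L 0) (window L L.*2) i \in L2 by exact: (mart_diff_L2 (u_md _ _)).
have mh L : measurable_fun setT (h L).
  by case/integrableP: (L2M_integrable (uL2 L) g2).
have cvh : \forall x \ae P, setT x -> h^~ x @ \oo -->
    ((Ex i.+1 v \- Ex i v) x * g x)%:E.
  apply: filterS (diff_ae i) => x hx _.
  have [d0|/hx[pos fin]] := eqVneq (f i.+1 x - f i x) 0.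
    apply: cvg_near_cst; apply: nearW => L.
    by rewrite /h /u d0 mulr0 [in RHS]/= -[Ex i.+1 v x - _]/(f i.+1 x - f i x) d0.
  apply: cvg_near_cst.
  have pE : psq P F f i x = (fine (psq P F f i x))%:E.
    by rewrite fineK // ge0_fin_numE // ltW.
  set s := fine (psq P F f i x) in pE; have s0 : 0 < s by rewrite -lte_fin -pE.
  have pow_gt (m : nat) : m%:R < 2 ^+ m :> R by rewrite -natrX ltr_nat ltn_expl.
  exists (Num.truncn s + Num.truncn s^-1).+1 => // L /= nL.
  have big (t : R) : 0 < t -> (Num.truncn t <= Num.truncn s + Num.truncn s^-1)%N -> t < (2 ^+ L) ^+ 2.
    move=> t0 tn; apply: (lt_trans (truncnS_gt _)).
    apply: (@lt_le_trans _ _ (2 ^+ L)).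
      by apply: le_lt_trans (pow_gt _); rewrite ler_nat (leq_trans _ nL).
    by rewrite expr2 ler_pMl ?exprn_gt0 // exprn_ege1 // ler1n.
  rewrite /h /u indicE mem_set ?mul1r //; split => /=; rewrite pE ?lte_fin ?lee_fin.
    rewrite /window sub0r -exprnN exprVn invf_plt ?posrE ?exprn_gt0 //.
    by apply: big; rewrite ?invr_gt0 // leq_addl.
  have -> : window L L.*2 = L by rewrite /window -addnn; lia.
  by apply: ltW; apply: big; rewrite ?leq_addr.
have dom : \forall x \ae P, forall L, setT x ->
    (`|h L x| <= `|((Ex i.+1 v \- Ex i v) x * g x)%:E|)%E.
  apply: aeW => x L _; rewrite /h /u lee_fin -mulrA normrM.
  rewrite -[leRHS]mul1r ler_wpM2r // indicE; case: (_ \in _); rewrite ?normr1 ?normr0 //.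
have [_ _ cv] := dominated_convergence measurableT mh (measurable_int _ intd)
  cvh (integrable_abse intd) dom.
apply: fine_cvg; rewrite fineK; first exact: cv.
exact: integrable_fin_num intd.
Qed.

(** The atomic decomposition, in the form of the pairing that it is used for:
    the layers of [v] between consecutive powers of [2] are paired with
    [g - g^nu], for the passage time [nu] of the lower level, and estimated by
    the Cauchy-Schwarz inequality. *)
Lemma pairing_le (b : R) : Ex 0 v = cst 0 %[ae P] ->
  (forall n L, \sum_(0 <= j < L.*2) 2 ^ (window L j + 1) *
     fine (P (stops (nu (window L j)))) `^ 2^-1 *
     nrm2 (stopped_tail P F g (nu (window L j)) n) <= b) ->
  `|ip v g| <= b.
Proof.
move=> E0 bound.
have Enb n : `|ip (Ex n v) g| <= b.
  have sumE : ip (Ex n v) g = \sum_(0 <= i < n) ip (Ex i.+1 v \- Ex i v) g.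
    elim: n => [|n IH].
      have mE := L2_measurable (Ex_L2 FF 0 v2); have mg := L2_measurable g2.
      by rewrite big_geq // (ip_ae mE (measurable_cst _) mg E0) ip0l.
    rewrite big_nat_recr //= -IH ipBl ?Ex_L2 //; ring.
  have cv : (fun L => ip (w n (window L 0) (window L L.*2)) g) @ \oo --> ip (Ex n v) g.
    rewrite sumE.
    have -> : (fun L => ip (w n (window L 0) (window L L.*2)) g) =
        (fun L => \sum_(0 <= i < n) ip (u (window L 0) (window L L.*2) i) g).
      apply/funext => L; rewrite /w ip_suml // => i _.
      exact: mart_diff_L2 (u_md (window L 0) (window L L.*2)) i.
    elim: (n) => [|m IH].
      under eq_fun do rewrite big_geq //.
      by rewrite big_geq //; exact: cvg_cst.
    under eq_fun do rewrite big_nat_recr //=.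
    by rewrite big_nat_recr //=; apply: cvgD => //; exact: window_cvg.
  have cvn : (fun L => `|ip (w n (window L 0) (window L L.*2)) g|) @ \oo --> `|ip (Ex n v) g|.
    by apply: cvg_norm; exact: cv.
  by apply: (cvgr_to_le cvn); apply: nearW => L; apply: window_bound; exact: bound.
have cv : (fun n => b + nrm2 (Ex n v \- v) * nrm2 g) @ \oo --> b + 0 * nrm2 g.
  by apply: cvgD; [exact: cvg_cst|apply: cvgMl; exact: Ex_cvg].
rewrite mul0r addr0 in cv; apply: (cvgr_to_ge cv); apply: nearW => n.
have Ev2 := Ex_L2 FF n v2.
have -> : ip v g = ip (Ex n v) g - ip (Ex n v \- v) g by rewrite ipBl //; ring.
apply: (le_trans (ler_normB _ _)); apply: lerD => //.
exact: cauchy_schwarz (L2B Ev2 v2) g2.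
Qed.

End pairing.

(** * Test functions *)

(** A finite combination of atoms is indexed by one window, but
    [atomic_estimate] computes it in all larger ones. *)
Lemma window_sum_support (R : nmodType) (x : int -> R) L N : (L <= N)%N ->
  (forall k : int, ~~ (- L%:Z <= k < L%:Z) -> x k = 0) ->
  \sum_(0 <= j < N.*2) x (window N j) = \sum_(0 <= j < L.*2) x (window L j).
Proof.
move=> LN x0; rewrite -(subnKC LN); elim: (N - L)%N => [|m IH]; first by rewrite addn0.
rewrite addnS doubleS big_nat_recr //= big_nat_recl //= x0; last by rewrite /window; lia.
rewrite x0; last by rewrite /window; lia.
rewrite add0r addr0 -IH; apply: eq_big_nat => j _; congr (x _).
by rewrite /window; lia.
Qed.

Section stopped_tails.
Context d (T : measurableType d) (R : realType) (P : probability T R).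
Variable F : nat -> set (set T).
Hypothesis FF : filtration F.
Variable g : T -> R.
Hypothesis g2 : g \in Lfun P 2%:E.

Local Notation L2 := (Lfun P 2%:E).
Local Notation ip := (l2_inner P).
Local Notation nrm2 := (l2_norm P).
Local Notation Ex n := (cexp P (F n)).
Local Notation FMs := (filtration_measurable FF).
Local Notation sF := (filtration_sigma FF).
Local Notation U nu n := (stopped_tail P F g nu n).

Section one_time.
Variable nu : T -> option nat.
Hypothesis st : stopping_time F nu.

(** By [ip_stopped_tail] it is the orthogonal projection of [g] on a line. *)
Lemma nrm2_stopped_tail_le_nrm2 n : nrm2 (U nu n) <= nrm2 g.
Proof.
have U2 := stopped_tail_L2 FF g2 st n.
have [U0|U0] := eqVneq (nrm2 (U nu n)) 0; first by rewrite U0 nrm2_ge0.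
have Upos : 0 < nrm2 (U nu n) by rewrite lt_def U0 nrm2_ge0.
rewrite -(ler_pM2l Upos) -expr2 sqr_nrm2 -(ip_stopped_tail FF g2 st).
by apply: le_trans (cauchy_schwarz U2 g2); exact: ler_norm.
Qed.

Lemma nrm2_stopped_tail_mono m n : (m <= n)%N -> nrm2 (U nu m) <= nrm2 (U nu n).
Proof.
move=> mn; have [Um Un] := (stopped_tail_L2 FF g2 st m, stopped_tail_L2 FF g2 st n).
rewrite ler_sqrt ?ip_ge0 // -lee_fin -(ipE Um) -(ipE Un).
apply: ge0_le_integral => //.
- by move=> x _; rewrite lee_fin sqr_ge0.
- by apply/measurable_EFinP/measurable_funX; exact: L2_measurable Um.
- by apply/measurable_EFinP/measurable_funX; exact: L2_measurable Un.
move=> x _; rewrite lee_fin !stopped_tailE; case: (nu x) => [k|//].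
case: (ltnP k m) => [km|_]; first by rewrite (leq_trans km mn).
by rewrite [X in X <= _]expr0n sqr_ge0.
Qed.

Lemma stopped_diff_norm_fin : stopped_diff_norm P F 2 g nu \is a fin_num.
Proof.
have le := stopped_diff_norm_le FF g2 st (nrm2_ge0 P g) nrm2_stopped_tail_le_nrm2.
rewrite ge0_fin_numE; first exact: le_lt_trans le (ltry _).
by apply: le_trans (nrm2_stopped_tail_le FF g2 st 0); rewrite lee_fin nrm2_ge0.
Qed.

(** Allows the finite sums [stopped_tail] to replace [g - g^nu] in norm
    estimates. *)
Lemma cvg_nrm2_stopped_tail :
  (fun n => nrm2 (U nu n)) @ \oo --> fine (stopped_diff_norm P F 2 g nu).
Proof.
have cv : cvgn (fun n => nrm2 (U nu n)).
  apply: nondecreasing_is_cvgn; first by move=> m n; exact: nrm2_stopped_tail_mono.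
  by exists (nrm2 g) => _ [n _ <-]; exact: nrm2_stopped_tail_le_nrm2.
suff -> : fine (stopped_diff_norm P F 2 g nu) = limn (fun n => nrm2 (U nu n)) by [].
have lim_ge n : nrm2 (U nu n) <= limn (fun n => nrm2 (U nu n)).
  apply: nondecreasing_cvgn_le => //.
  by move=> m m'; exact: nrm2_stopped_tail_mono.
apply/eqP; rewrite eq_le; apply/andP; split.
  rewrite -lee_fin fineK ?stopped_diff_norm_fin //.
  by apply: (stopped_diff_norm_le FF g2 st) => //; exact: le_trans (nrm2_ge0 P _) (lim_ge 0%N).
apply: limr_le => //; apply: nearW => n.
by rewrite -lee_fin fineK ?stopped_diff_norm_fin // nrm2_stopped_tail_le.
Qed.

End one_time.

Lemma Ex_cst0 n : Ex n (cst 0) = cst 0 %[ae P].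
Proof.
apply: (Ex_unique FF (L2_cst P 0) (L2_cst P 0)) => //.
exact: measurable_cst.
Qed.

Section family.
Variables (times : nat -> T -> option nat) (c : nat -> R) (n : nat).
Hypothesis st : forall j, stopping_time F (times j).
Let w m M x := \sum_(m <= j < M) c j * U (times j) n x.

Lemma stopped_sum_L2 m M : w m M \in L2.
Proof. by apply: L2_sum => j _; apply: L2Z; exact: stopped_tail_L2. Qed.

Lemma stopped_sum_diff_eq0 m M i :
  \forall x \ae P, (forall j, (m <= j < M)%N -> ~ stops_by (times j) i x) ->
    Ex i.+1 (w m M) x - Ex i (w m M) x = 0.
Proof.
have zero : \forall x \ae P, Ex i.+1 (cst 0) x - Ex i (cst 0) x = 0.
  by apply: filterS2 (Ex_cst0 i.+1) (Ex_cst0 i) => x /(_ I) -> /(_ I) ->; rewrite subrr.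
elim: M => [|M IH].
  have -> : w m 0 = cst 0 by apply/funext => x; rewrite /w big_geq.
  by apply: filterS zero => x.
have [mM|Mm] := leqP m M; last first.
  have -> : w m M.+1 = cst 0 by apply/funext => x; rewrite /w big_geq.
  by apply: filterS zero => x.
have U2 := stopped_tail_L2 FF g2 (st M) n; have w2 := stopped_sum_L2 m M.
have -> : w m M.+1 = fun x => c M * U (times M) n x + w m M x.
  by apply/funext => x; rewrite /w big_nat_recr //= addrC.
have l0 := Ex_linear FF i (c M) U2 w2; have l1 := Ex_linear FF i.+1 (c M) U2 w2.
apply: filterS2 (filterI l0 l1) (filterI IH (diff_stopped_tail_before FF g2 (st M) n i)).
move=> x [/(_ I) e0 /(_ I) e1] [{}IH dU] nx; rewrite e0 e1.
have dU0 : Ex i.+1 (U (times M) n) x - Ex i (U (times M) n) x = 0.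
  by apply: dU; apply: nx; rewrite mM ltnSn.
have IH0 : Ex i.+1 (w m M) x - Ex i (w m M) x = 0.
  by apply: IH => j /andP[mj jM]; apply: nx; rewrite mj ltnW.
rewrite opprD addrACA IH0 addr0 -mulrBr dU0 mulr0 //.
Qed.

(** No increment occurs before the first of the stopping times. *)
Lemma stopped_sum_cond_sq_eq0 m M :
  \forall x \ae P, ~ (exists2 j, (m <= j < M)%N & stops (times j) x) ->
    cond_sq P F (mart P F (w m M)) x = 0%E.
Proof.
pose B i := [set x | forall j, (m <= j < M)%N -> ~ stops_by (times j) i x].
have FB i : F i (B i).
  have -> : B i = ~` \bigcup_(j in [set j | (m <= j < M)%N]) stops_by (times j) i.
    apply/seteqP; split => x /=; first by move=> h [j jm /(h j jm)].
    by move=> h j jm xj; apply: h; exists j.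
  rewrite -(g_sigma_algebra_measurableE (sF i)); apply: measurableC.
  apply: bigcup_measurable => j _; rewrite g_sigma_algebra_measurableE; first exact: st.
  exact: sF.
have md := mart_measurable_seq FF (stopped_sum_L2 m M).
apply: filterS (cond_sq_eq0 FF md FB (fun i => stopped_sum_diff_eq0 m M i)) => x h nx.
apply: h => i j jm [k ki xk]; apply: nx; exists j => //.
by rewrite /stops /mkset xk.
Qed.

Lemma stopped_sum_Ex0 m M : Ex 0 (w m M) = cst 0 %[ae P].
Proof.
apply: (Ex_unique FF (stopped_sum_L2 m M) (L2_cst P 0)); first exact: measurable_cst.
move=> A FA; have A2 := indic_in_L2 P (FMs FA).
rewrite [RHS]ipC ip0l ipC ip_suml //; last first.
  by move=> j _; apply: L2Z; exact: stopped_tail_L2.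
rewrite big1 // => j _; rewrite ipZl ?stopped_tail_L2 // ipC.
by rewrite (stopped_tail_ip_F0 FF g2 (st j)) // mulr0.
Qed.

End family.
End stopped_tails.

(** * The two bounds *)

(** A single stopping time is a family of which only one member ever stops. *)
Lemma dyadic_sum_single (R : realType) (p q a : R) (k0 : int) : 0 < p -> 0 < q ->
  dyadic_sum p q (fun k => if k == k0 then a else 0) = ((2 ^ k0 * a `^ p^-1) `^ q)%:E.
Proof.
move=> p0 q0; rewrite /dyadic_sum.
transitivity (\esum_(k in [set k0]) ((2 ^ k * a `^ p^-1) `^ q)%:E)%E; last first.
  by rewrite esum_set1 // lee_fin powR_ge0.
rewrite [RHS]esum_mkcond; apply: eq_esum => k _.
have [->|kk] := eqVneq k k0; first by rewrite mem_set.
rewrite memNset; last by move=> kE; rewrite kE eqxx in kk.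
by rewrite powR0 ?invr_eq0 ?gt_eqF // mulr0 powR0 ?gt_eqF.
Qed.

Lemma window_bounds L j : (0 <= j < L.*2)%N -> - L%:Z <= window L j < L%:Z.
Proof. by rewrite /window; lia. Qed.

Section bounds.
Context d (T : measurableType d) (R : realType) (P : probability T R).
Variable F : nat -> set (set T).
Hypothesis FF : filtration F.
Variables (p q : R).
Hypotheses (p0 : 0 < p) (p2 : p < 2) (q0 : 0 < q).

Local Notation L2 := (Lfun P 2%:E).
Local Notation ip := (l2_inner P).
Local Notation nrm2 := (l2_norm P).
Local Notation Ex n := (cexp P (F n)).
Local Notation N f := (hardy_norm P F p q f).
Local Notation hd f := (dyadic_sum p q (sq_level P F f)).
Local Notation sdn g nu := (stopped_diff_norm P F 2 g nu).

Let mart0_diff i : \forall x \ae P, [set: T] x ->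
  mart P F (cst 0) i.+1 x - mart P F (cst 0) i x = 0.
Proof.
apply: filterS2 (Ex_cst0 P FF i.+1) (Ex_cst0 P FF i) => x /(_ I) e1 /(_ I) e2 _.
by rewrite /mart e1 e2 subrr.
Qed.

Local Opaque cond_sq hardy_norm mart.

Lemma hardy_norm_le_dyadic : exists2 C : R, 0 < C &
  forall f (a : R) D, measurable_seq f -> 0 <= a -> (0 <= D)%E ->
    (hd f <= a%:E * D)%E -> (N f <= (C * a `^ q^-1)%:E * D `^ q^-1)%E.
Proof.
have [c [C [c0 C0 NE]]] := hardy_norm_dyadic P FF p0 q0.
exists (C `^ q^-1); first by rewrite powR_gt0.
move=> f a D mf a0 D0 le; have [_ hi] := NE f mf.
rewrite -powRM ?(ltW C0) //.
apply: (poweR_le_inv q0) => //; first by rewrite mulr_ge0 // ltW.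
- exact: hardy_norm_ge0.
- exact: poweR_ge0.
rewrite (poweR_rootK q0) //; apply: (le_trans hi); rewrite EFinM -muleA.
by apply: lee_wpmul2l => //; rewrite lee_fin ltW.
Qed.

Lemma dyadic_le_hardy_norm : exists2 C : R, 0 < C &
  forall f, measurable_seq f -> ((hd f) `^ q^-1 <= C%:E * N f)%E.
Proof.
have [c [C [c0 C0 NE]]] := hardy_norm_dyadic P FF p0 q0.
have ci0 : 0 < c^-1 by rewrite invr_gt0.
exists (c^-1 `^ q^-1); first exact: powR_gt0.
move=> f mf; have [lo _] := NE f mf.
have hd0 := dyadic_sum_ge0 p q (sq_level P F f).
have N0 := hardy_norm_ge0 P F p q f.
apply: (poweR_le_inv q0) => //; first by rewrite invr_ge0 ltW.
  exact: poweR_ge0.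
rewrite (poweR_rootK q0) // -[leLHS]mul1e -(mulVf (lt0r_neq0 c0)) EFinM -muleA.
by apply: lee_wpmul2l => //; rewrite lee_fin invr_ge0 ltW.
Qed.

(** [L_2] embeds in the Hardy space: a function is an atom carried by the whole
    space, up to its norm. *)
Lemma hardy_norm_le_nrm2 : exists2 C : R, 0 < C &
  forall v, v \in L2 -> (N (mart P F v) <= (C * nrm2 v)%:E)%E.
Proof.
have [C1 C10 atomic] := atomic_estimate P FF p0 p2 q0.
have [C2 C20 NE] := hardy_norm_le_dyadic.
pose C := C2 * C1 `^ q^-1; have C0 : 0 < C by rewrite mulr_gt0 // powR_gt0.
exists (C * 2); first by rewrite mulr_gt0.
move=> v v2; have mf := mart_measurable_seq FF v2.
(* The norm of [v] may vanish, so [v] is compared with all larger [e]. *)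
have main (e : R) : 0 < e -> nrm2 v <= e -> (N (mart P F v) <= (C * 2 * e)%:E)%E.
  move=> e0 ve; have [k0 ek ke] := dyadic_exponent e0.
  pose h k x := if k == k0 then v x else 0.
  pose A k : set T := if k == k0 then setT else set0.
  have hE k : h k = if k == k0 then v else cst 0 by rewrite /h; case: (k == k0).
  have fineT : fine (P setT) = 1 by rewrite probability_setT.
  have fine0 : fine (P set0) = 0 by rewrite measure0.
  have h2 k : h k \in L2 by rewrite hE; case: (k == k0) => //; exact: L2_cst.
  have mA k : measurable (A k) by rewrite /A; case: (k == k0).
  have hA k : nrm2 (h k) <= 2 ^ k * fine (P (A k)) `^ 2^-1.
    rewrite hE /A; case: eqVneq => [->|_].
      by rewrite fineT powR1 mulr1 (le_trans ve).
    by rewrite nrm2_0 fine0 powR0 ?mulr0 // invr_eq0.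
  have fE M : (`|k0|.+1 <= M)%N -> v = fun x => \sum_(0 <= j < M.*2) h (window M j) x.
    move=> kM; have [j jM kE] := window_surj kM.
    apply/funext => x; rewrite (bigD1_seq j) ?mem_index_iota ?iota_uniq //=.
    rewrite big1 ?addr0 => [|i ij]; first by rewrite /h -kE eqxx.
    rewrite /h; case: eqVneq => // iE; move: ij; rewrite kE in iE.
    by rewrite (window_inj iE) eqxx.
  have supp M m : \forall x \ae P, ~ (exists2 j, (m <= j < M.*2)%N & A (window M j) x) ->
      cond_sq P F (mart P F (fun x => \sum_(m <= j < M.*2) h (window M j) x)) x = 0%E.
    have [[j jM kE]|none] := pselect (exists2 j, (m <= j < M.*2)%N & window M j = k0).
      by apply: aeW => x []; exists j => //; rewrite /A kE eqxx.
    have -> : (fun x => \sum_(m <= j < M.*2) h (window M j) x) = cst 0.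
      apply/funext => x; rewrite big_nat big1 // => j jM; rewrite /h; case: eqVneq => // kE.
      by exfalso; apply: none; exists j.
    have z2 := L2_cst P 0.
    have z i : \forall x \ae P, [set: T] x ->
        mart P F (cst 0) i.+1 x - mart P F (cst 0) i x = 0.
      exact: mart0_diff.
    have T_F i : F i setT by exact: sub_sigma_algebraT (filtration_sigma FF i).
    apply: filterS (cond_sq_eq0 FF (mart_measurable_seq FF z2) T_F z) => x h0 _.
    exact: h0.
  have hdle := atomic _ v h A h2 mA hA fE supp.
  have DE : dyadic_sum p q (fun k => fine (P (A k))) = ((2 ^ k0) `^ q)%:E.
    have := dyadic_sum_single 1 k0 p0 q0; rewrite powR1 mulr1 => <-; apply: eq_esum => k _; congr (((_ * _ `^ _) `^ _)%:E).
    by rewrite /A; case: (k == k0); rewrite ?fineT ?fine0.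
  rewrite DE in hdle.
  have D0 : (0 <= ((2 ^ k0) `^ q)%:E :> \bar R)%E by rewrite lee_fin powR_ge0.
  apply: (le_trans (NE _ _ _ mf (ltW C10) D0 hdle)).
  have k00 : 0 <= (2 : R) ^ k0 by rewrite ltW // exprz_gt0.
  rewrite poweR_EFin -powRrM mulfV ?gt_eqF // powRr1 //.
  by rewrite -EFinM lee_fin -mulrA; apply: ler_wpM2l => //; exact: ltW.
apply/lee_addgt0Pr => e e0.
have CC : 0 < C * 2 by rewrite mulr_gt0.
have pos : 0 < nrm2 v + e / (C * 2) by rewrite ltr_wpDl ?nrm2_ge0 // divr_gt0.
apply: (le_trans (main _ pos _)); first by rewrite lerDl ltW // divr_gt0.
rewrite -EFinD lee_fin mulrDr [X in _ + X](_ : _ = e) //.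
by rewrite mulrCA divff ?mulr1 // gt_eqF.
Qed.

(** The test function of a family of stopping times is a combination of the
    functions [g - g^nu], each normalised to be a multiple of an atom. *)
Lemma testing : exists2 C : R, 0 < C &
  forall g (K : R) (times : int -> T -> option nat), g \in L2 -> 0 <= K ->
    (forall k, stopping_time F (times k)) ->
    (forall v, v \in L2 -> Ex 0 v = cst 0 %[ae P] ->
       ((`|ip v g|)%:E <= K%:E * N (mart P F v))%E) ->
    (\esum_(k in [set: int])
       (2 ^ k * fine (P (stops (times k))) `^ 2^-1 * fine (sdn g (times k)))%:E
     <= (C * K)%:E * (dyadic_sum p q (fun k => fine (P (stops (times k))))) `^ q^-1)%E.
Proof.
have [C1 C10 atomic] := atomic_estimate P FF p0 p2 q0.
have [C2 C20 NE] := hardy_norm_le_dyadic.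
pose C := C2 * C1 `^ q^-1; have C0 : 0 < C by rewrite mulr_gt0 // powR_gt0.
exists C => // g K times g2 K0 st bound.
set D := dyadic_sum p q _.
have D0 : (0 <= D)%E by exact: dyadic_sum_ge0.
have sd0 k : 0 <= fine (sdn g (times k)).
  rewrite fine_ge0 //; apply: le_trans (nrm2_stopped_tail_le FF g2 (st k) 0).
  by rewrite lee_fin nrm2_ge0.
pose a k : R := 2 ^ k * fine (P (stops (times k))) `^ 2^-1.
have a0 k : 0 <= a k by rewrite mulr_ge0 ?powR_ge0 // ltW // exprz_gt0.
apply: (esum_le_window_sum (N0 := 0)) => [k|L _]; first exact: mulr_ge0 (a0 k) (sd0 k).
have fixed n : ((\sum_(0 <= j < L.*2) a (window L j) *
    nrm2 (stopped_tail P F g (times (window L j)) n))%:E <= (C * K)%:E * D `^ q^-1)%E.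
  (* Where the norm vanishes the quotient is 0, and so is the term. *)
  pose c (k : int) : R := if - L%:Z <= k < L%:Z then
    a k / nrm2 (stopped_tail P F g (times k) n) else 0.
  pose h k x := c k * stopped_tail P F g (times k) n x.
  pose f x := \sum_(0 <= j < L.*2) h (window L j) x.
  have U2 k := stopped_tail_L2 FF g2 (st k) n.
  have h2 k : h k \in L2 by exact: L2Z.
  have f2 : f \in L2 by apply: L2_sum => j _.
  have mf := mart_measurable_seq FF f2.
  have mA k := stops_measurable FF (st k).
  have hA k : nrm2 (h k) <= 2 ^ k * fine (P (stops (times k))) `^ 2^-1.
    rewrite nrm2Z // -/(a k) /c; case: ifP => _; last by rewrite normr0 mul0r.
    rewrite normrM (ger0_norm (a0 k)) normfV ger0_norm ?nrm2_ge0 // -mulrA.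
    have [->|z] := eqVneq (nrm2 (stopped_tail P F g (times k) n)) 0.
      by rewrite !mulr0.
    by rewrite mulVf // mulr1.
  have fE M : (L <= M)%N -> f = fun x => \sum_(0 <= j < M.*2) h (window M j) x.
    move=> LM; apply/funext => x; rewrite (window_sum_support (x := h^~ x) LM) //.
    by move=> k kL; rewrite /h /c (negbTE kL) mul0r.
  have supp M m := stopped_sum_cond_sq_eq0 FF g2 (c \o window M) n (fun j => st (window M j)) m M.*2.
  have hdle := atomic _ f h _ h2 mA hA fE supp.
  have Nle := NE _ _ _ mf (ltW C10) D0 hdle.
  have f0 := stopped_sum_Ex0 FF g2 (c \o window L) n (fun j => st (window L j)) 0 L.*2.
  have ipE : ip f g = \sum_(0 <= j < L.*2) a (window L j) *
      nrm2 (stopped_tail P F g (times (window L j)) n).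
    rewrite /f ip_suml //; apply: eq_big_nat => j jL.
    rewrite /h ipZl // (ip_stopped_tail FF g2 (st (window L j))) -sqr_nrm2 /c.
    rewrite (window_bounds jL).
    have [->|z] := eqVneq (nrm2 (stopped_tail P F g (times (window L j)) n)) 0.
      by rewrite expr0n !mulr0.
    by rewrite expr2 mulrA divfK.
  rewrite -ipE; apply: (@le_trans _ _ (`|ip f g|)%:E); first by rewrite lee_fin ler_norm.
  apply: (le_trans (bound f f2 f0)).
  apply: (@le_trans _ _ (K%:E * (C%:E * D `^ q^-1))%E).
    by apply: lee_wpmul2l; first by rewrite lee_fin.
  by rewrite muleA -EFinM (mulrC K).
have B0 : (0 <= (C * K)%:E * D `^ q^-1)%E.
  by rewrite mule_ge0 ?poweR_ge0 // lee_fin mulr_ge0 // ltW.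
move: B0 fixed; case: ((C * K)%:E * D `^ q^-1)%E => [b|_ _|//]; last exact: leey.
move=> _ fixed; rewrite lee_fin.
have cv : (fun n => \sum_(0 <= j < L.*2) a (window L j) *
    nrm2 (stopped_tail P F g (times (window L j)) n)) @ \oo -->
    \sum_(0 <= j < L.*2) a (window L j) * fine (sdn g (times (window L j))).
  elim: (L.*2) => [|m IH].
    under eq_fun do rewrite big_geq //.
    by rewrite big_geq //; exact: cvg_cst.
  under eq_fun do rewrite big_nat_recr //=.
  rewrite big_nat_recr //=; apply: cvgD => //; apply: cvgMr.
  exact: cvg_nrm2_stopped_tail.
apply: (cvgr_to_le cv); apply: nearW => n.
by have := fixed n; rewrite lee_fin.
Qed.

End bounds.

Lemma quotient_le (R : realType) (K : R) (X D : \bar R) :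
  0 <= K -> (0 <= D)%E -> (D < +oo)%E -> (X <= K%:E * D)%E ->
  (X * ((fine D)^-1)%:E <= K%:E)%E.
Proof.
move=> K0; case: D => [b||] //; rewrite lee_fin => b0 _ le /=.
have [->|bn0] := eqVneq b 0; first by rewrite invr0 mule0 lee_fin.
apply: (@le_trans _ _ (K%:E * b%:E * (b^-1)%:E)%E).
  by apply: lee_wpmul2r => //; rewrite lee_fin invr_ge0.
by rewrite -!EFinM mulfK.
Qed.

Section bmo_bounds.
Context d (T : measurableType d) (R : realType) (P : probability T R).
Variable F : nat -> set (set T).
Hypothesis FF : filtration F.
Variables (p q alpha : R).
Hypotheses (p0 : 0 < p) (p2 : p < 2) (q0 : 0 < q) (alphaE : alpha = p^-1 - 1).

Local Notation L2 := (Lfun P 2%:E).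
Local Notation ip := (l2_inner P).
Local Notation Ex n := (cexp P (F n)).
Local Notation N f := (hardy_norm P F p q f).
Local Notation hd f := (dyadic_sum p q (sq_level P F f)).
Local Notation sdn g nu := (stopped_diff_norm P F 2 g nu).

Local Opaque cond_sq hardy_norm mart.

Let alpha1 : 1 + alpha = p^-1. Proof. by rewrite alphaE addrC subrK. Qed.

Let sdn_ge0 g nu : g \in L2 -> stopping_time F nu -> 0 <= fine (sdn g nu).
Proof.
move=> g2 st; rewrite fine_ge0 //; apply: le_trans (nrm2_stopped_tail_le FF g2 st 0).
by rewrite lee_fin nrm2_ge0.
Qed.

Let bmo_q_numE g (nu : int -> T -> option nat) : g \in L2 ->
  (forall k, stopping_time F (nu k)) ->
  bmo_q_num P F 2 g nu = (\esum_(k in [set: int])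
    (2 ^ k * fine (P (stops (nu k))) `^ 2^-1 * fine (sdn g (nu k)))%:E)%E.
Proof.
move=> g2 st; apply: eq_esum => k _.
have -> : 1 - 2^-1 = 2^-1 :> R by lra.
by rewrite prob_finiteE [RHS]EFinM fineK // (stopped_diff_norm_fin FF).
Qed.

Let bmo_q_denE (nu : int -> T -> option nat) :
  bmo_q_den P q alpha nu = ((dyadic_sum p q (fun k => fine (P (stops (nu k))))) `^ q^-1)%E.
Proof. by rewrite /bmo_q_den alpha1. Qed.

(* The stopping time that fills up a family. *)
Let never : T -> option nat := fun=> None.

Let never_stopping : stopping_time F never.
Proof.
move=> n; have -> : [set x : T | exists2 m, (m <= n)%N & never x = Some m] = ~` setT.
  by apply/seteqP; split => x // [].
apply: (sub_sigma_algebraC (filtration_sigma FF n)).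
exact: sub_sigma_algebraT (filtration_sigma FF n).
Qed.

Let prob_never : fine (P (stops never)) = 0.
Proof.
have -> : stops never = set0 by apply/seteqP; split => x //; rewrite /stops /mkset.
by rewrite measure0.
Qed.

(** Tested on one stopping time, the bound gives [BMO_2(alpha)]; tested on
    families, it gives [BMO_(2,q)(alpha)]. *)
Lemma bmo_norms_le : exists2 C : R, 0 < C &
  forall g (K : R), g \in L2 -> 0 <= K ->
    (forall v, v \in L2 -> Ex 0 v = cst 0 %[ae P] ->
       ((`|ip v g|)%:E <= K%:E * N (mart P F v))%E) ->
    (bmo_norm P F 2 alpha g <= (C * K)%:E)%E /\
    (bmo_q_norm P F 2 q alpha g <= (C * K)%:E)%E.
Proof.
have [C C0 test] := testing P FF p0 p2 q0; exists C => // g K g2 K0 bound.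
have CK0 : 0 <= C * K by rewrite mulr_ge0 // ltW.
split; apply: ge_ereal_sup.
  move=> _ [nu st <-].
  pose a := fine (P (stops nu)); have a0 : 0 <= a := fine_prob_ge0 _ _.
  rewrite prob_finiteE -/a -(fineK (stopped_diff_norm_fin FF g2 st)) -EFinM lee_fin.
  have [az|an0] := eqVneq a 0.
    rewrite az powR0 ?mul0r // alphaE.
    have : 0 < p^-1 by rewrite invr_gt0.
    have : 2^-1 < p^-1 by rewrite ltf_pV2 ?posrE.
    by move=> lt _; rewrite lt_eqF //; lra.
  have apos : 0 < a by rewrite lt_def an0.
  pose times (k : int) : T -> option nat := if k == 0 then nu else never.
  have stt k : stopping_time F (times k) by rewrite /times; case: (k == 0) => //; exact: never_stopping.
  have timesP k : fine (P (stops (times k))) = if k == 0 then a else 0.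
    by rewrite /times; case: (k == 0); [|exact: prob_never].
  have := test g K times g2 K0 stt bound.
  have -> : dyadic_sum p q (fun k => fine (P (stops (times k)))) = ((a `^ p^-1) `^ q)%:E.
    have := dyadic_sum_single a 0 p0 q0; rewrite expr0z mul1r => <-.
    by congr (dyadic_sum p q _); apply/funext => k; exact: timesP.
  rewrite poweR_EFin -powRrM mulfV ?gt_eqF // powRr1 ?powR_ge0 //.
  have one : ((a `^ 2^-1 * fine (sdn g nu))%:E <= \esum_(k in [set: int])
      (2 ^ k * fine (P (stops (times k))) `^ 2^-1 * fine (sdn g (times k)))%:E)%E.
    apply: esum_ge; exists [set 0%Z]; first by split; [exact: finite_set1|].
    rewrite fsbig_set1 /times eqxx expr0z mul1r //.
  move=> /(le_trans one); rewrite -EFinM lee_fin => le.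
  have e1 : a `^ (- 2^-1 - alpha) = a `^ (- p^-1) * a `^ 2^-1.
    rewrite -powRD; last by rewrite an0 implybT.
    by congr (_ `^ _); rewrite alphaE; lra.
  rewrite e1 -mulrA powRN mulrC ler_pdivrMr ?powR_gt0 //.
move=> _ [nu [st den] <-].
rewrite (bmo_q_numE g2 st).
have le := test g K nu g2 K0 st bound.
rewrite -bmo_q_denE in le.
apply: (quotient_le CK0 _ den le); exact: poweR_ge0.
Qed.

Lemma bmo_norm_ge0 g : (0 <= bmo_norm P F 2 alpha g)%E.
Proof.
apply: (@le_trans _ _ ((prob_finite P never `^ (- 2^-1 - alpha))%:E * sdn g never)%E).
  by apply: mule_ge0; [rewrite lee_fin powR_ge0|exact: Lnorm_ge0].
by apply: ereal_sup_ubound; exists never => //; exact: never_stopping.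
Qed.

Lemma bmo_q_norm_ge0 g : (0 <= bmo_q_norm P F 2 q alpha g)%E.
Proof.
pose nu (k : int) := never.
apply: (@le_trans _ _ (bmo_q_num P F 2 g nu * ((fine (bmo_q_den P q alpha nu))^-1)%:E)%E).
  apply: mule_ge0; last by rewrite lee_fin invr_ge0 fine_ge0 // poweR_ge0.
  apply: esum_ge0 => k _; apply: mule_ge0; last exact: Lnorm_ge0.
  by rewrite lee_fin mulr_ge0 ?powR_ge0 // ltW // exprz_gt0.
apply: ereal_sup_ubound; exists nu => //; split; first by move=> k; exact: never_stopping.
rewrite bmo_q_denE.
have -> : (fun k => fine (P (stops (nu k)))) = (fun=> 0).
  by apply/funext => k; exact: prob_never.
by rewrite dyadic_sum0 // poweR_EFin ltry.
Qed.

Section direct.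
Variables v g : T -> R.
Hypotheses (v2 : v \in L2) (g2 : g \in L2) (E0 : Ex 0 v = cst 0 %[ae P]).
Let nu k := passage_time P F (mart P F v) (((2 : R) ^ k) ^+ 2)%:E.

Let mf : measurable_seq (mart P F v). Proof. exact: mart_measurable_seq. Qed.

Let st k : stopping_time F (nu k). Proof. exact: passage_stopping_time. Qed.

Let prob_stops k : fine (P (stops (nu k))) = sq_level P F (mart P F v) k.
Proof.
have t0 : (0 <= (((2 : R) ^ k) ^+ 2)%:E)%E by rewrite lee_fin sqr_ge0.
by rewrite (stops_passage P FF mf t0).
Qed.

Let pairing_bound (b : R) :
  (forall L, \sum_(0 <= j < L.*2) 2 ^ window L j *
     fine (P (stops (nu (window L j)))) `^ 2^-1 * fine (sdn g (nu (window L j))) <= b) ->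
  `|ip v g| <= 2 * b.
Proof.
move=> le; apply: (pairing_le FF v2 g2 E0) => n L.
apply: le_trans (ler_wpM2l (ler0n R 2) (le L)); rewrite mulr_sumr; apply: ler_sum => j _.
rewrite expfzDr ?pnatr_eq0 // [2 ^ _ * 2 ^ 1]mulrC expr1z -!mulrA.
apply: ler_wpM2l => //; apply: ler_wpM2l; first by rewrite ltW // exprz_gt0.
apply: ler_wpM2l; first exact: powR_ge0.
rewrite -lee_fin (fineK (stopped_diff_norm_fin FF g2 (st (window L j)))).
exact (nrm2_stopped_tail_le FF g2 (st (window L j)) n).
Qed.

Let hd_fin : (hd (mart P F v) < +oo)%E.
Proof.
apply/(hardy_norm_fin P FF p0 q0 mf); have [C C0 le] := hardy_norm_le_nrm2 P FF p0 p2 q0.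
exact: le_lt_trans (le v v2) (ltry _).
Qed.

(** For [q <= 1] each passage time is estimated on its own, and [l^q] is
    contained in [l^1]. *)
Lemma pairing_le_bmo (M : R) : q <= 1 -> 0 <= M ->
  (bmo_norm P F 2 alpha g <= M%:E)%E ->
  ((`|ip v g|)%:E <= (2 * M)%:E * hd (mart P F v) `^ q^-1)%E.
Proof.
move=> q1 M0 gM.
have hd0 := dyadic_sum_ge0 p q (sq_level P F (mart P F v)).
have hdE : hd (mart P F v) = (fine (hd (mart P F v)))%:E by rewrite fineK // ge0_fin_numE.
rewrite hdE poweR_EFin -EFinM lee_fin -mulrA; apply: pairing_bound => L.
set x := fun j => 2 ^ window L j * sq_level P F (mart P F v) (window L j) `^ p^-1.
have x0 j : 0 <= x j by rewrite mulr_ge0 ?powR_ge0 // ltW // exprz_gt0.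
apply: (@le_trans _ _ (M * \sum_(0 <= j < L.*2) x j)).
  rewrite mulr_sumr; apply: ler_sum => j _; rewrite /x -prob_stops mulrCA -mulrA.
  apply: ler_wpM2l; first by rewrite ltW // exprz_gt0.
  set a := fine (P _); have a0 : 0 <= a := fine_prob_ge0 _ _.
  have [->|an0] := eqVneq a 0.
    by rewrite powR0 ?invr_eq0 // mul0r mulr_ge0 ?powR_ge0.
  have apos : 0 < a by rewrite lt_def an0.
  have : ((a `^ (- 2^-1 - alpha))%:E * sdn g (nu (window L j)) <= M%:E)%E.
    apply: le_trans gM; apply: ereal_sup_ubound; exists (nu (window L j)) => //.
  rewrite -(fineK (stopped_diff_norm_fin FF g2 (st (window L j)))) -EFinM lee_fin => le.
  have e1 : a `^ 2^-1 = a `^ p^-1 * a `^ (- 2^-1 - alpha).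
    rewrite -powRD; last by rewrite an0 implybT.
    by congr (_ `^ _); rewrite alphaE; lra.
  rewrite e1 -mulrA mulrC; apply: ler_wpM2r => //; exact: powR_ge0.
apply: ler_wpM2l => //; apply: (le_trans (sum_le_powR_sum _ q0 q1 x0)).
apply: ge0_ler_powR; rewrite ?invr_ge0 ?(ltW q0) ?nnegrE //.
- by apply: sumr_ge0 => j _; exact: powR_ge0.
- exact: fine_ge0.
rewrite -lee_fin -hdE.
by apply: (window_sum_le_esum (x := fun k => (2 ^ k * sq_level P F (mart P F v) k `^ p^-1) `^ q)) => k; exact: powR_ge0.
Qed.

(** The passage times of the powers of [2] are one of the families over which
    the supremum is taken, and its denominator is the dyadic sum of [v]. *)
Lemma pairing_le_bmo_q (M : R) : 0 <= M ->
  (bmo_q_norm P F 2 q alpha g <= M%:E)%E ->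
  ((`|ip v g|)%:E <= (2 * M)%:E * hd (mart P F v) `^ q^-1)%E.
Proof.
move=> M0 gM.
have hd0 := dyadic_sum_ge0 p q (sq_level P F (mart P F v)).
have hdE : hd (mart P F v) = (fine (hd (mart P F v)))%:E by rewrite fineK // ge0_fin_numE.
set b := fine (hd (mart P F v)) in hdE.
have b0 : 0 <= b by exact: fine_ge0.
have psE : (fun k => fine (P (stops (nu k)))) = sq_level P F (mart P F v).
  by apply/funext => k; exact: prob_stops.
have denE : bmo_q_den P q alpha nu = (b `^ q^-1)%:E.
  by rewrite bmo_q_denE psE hdE poweR_EFin.
have den_fin : (bmo_q_den P q alpha nu < +oo)%E by rewrite denE ltry.
have le : (bmo_q_num P F 2 g nu * ((b `^ q^-1)^-1)%:E <= M%:E)%E.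
  rewrite -[X in (X^-1)%:E]/(fine (b `^ q^-1)%:E) -denE; apply: le_trans gM.
  by apply: ereal_sup_ubound; exists nu.
rewrite hdE poweR_EFin -EFinM lee_fin -mulrA.
have term0 k : 0 <= 2 ^ k * fine (P (stops (nu k))) `^ 2^-1 * fine (sdn g (nu k)).
  by rewrite !mulr_ge0 ?powR_ge0 ?sdn_ge0 // ltW // exprz_gt0.
apply: pairing_bound => L; rewrite -lee_fin.
have [bz|bn0] := eqVneq b 0.
  rewrite bz powR0 ?invr_eq0 ?gt_eqF // mulr0 lee_fin big1 // => j _.
  set k := window L j; suff -> : fine (P (stops (nu k))) = 0.
    by rewrite powR0 ?invr_eq0 // mulr0 mul0r.
  rewrite prob_stops.
  have : (((2 ^ k * sq_level P F (mart P F v) k `^ p^-1) `^ q)%:E <= hd (mart P F v))%E.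
    apply: esum_ge; exists [set k]; first by split; [exact: finite_set1|].
    by rewrite fsbig_set1.
  rewrite hdE bz lee_fin => le0; apply/eqP; rewrite eq_le sq_level_ge0 andbT leNgt.
  apply/negP => pos; move: le0; rewrite leNgt powR_gt0 // mulr_gt0 ?powR_gt0 //.
  by rewrite exprz_gt0.
have bpos : 0 < b by rewrite lt_def bn0.
apply: (le_trans (window_sum_le_esum (x := fun k => 2 ^ k * fine (P (stops (nu k))) `^ 2^-1
  * fine (sdn g (nu k))) L term0)).
rewrite -(bmo_q_numE g2 st).
have rpos : 0 < b `^ q^-1 by rewrite powR_gt0.
by rewrite EFinM -lee_pdivrMr.
Qed.

End direct.
End bmo_bounds.

(** * Density of the square-integrable martingales *)

(** Dominated convergence: a finite window carries the dominating sum up to [e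
    / 2], and there the terms converge to zero. *)
Lemma esum_dominated_small (R : realType) (x : nat -> int -> R) (y : int -> R) (e : R) :
  0 < e -> (forall n k, 0 <= x n k) -> (forall n k, x n k <= y k) ->
  (\esum_(k in [set: int]) (y k)%:E < +oo)%E ->
  (forall k, x^~ k @ \oo --> 0) ->
  exists n, (\esum_(k in [set: int]) (x n k)%:E <= e%:E)%E.
Proof.
move=> e0 x0 xy fin cv.
have y0 k : 0 <= y k by exact: le_trans (x0 0%N k) (xy 0%N k).
have e20 : 0 < e / 2 by rewrite divr_gt0.
have yE : (\esum_(k in [set: int]) (y k)%:E)%E = (fine (\esum_(k in [set: int]) (y k)%:E)%E)%:E.
  by rewrite fineK // ge0_fin_numE // esum_ge0 // => k _; rewrite lee_fin.
set S := fine _ in yE.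
have [L SL] : exists L, S - e / 2 < \sum_(0 <= j < L.*2) y (window L j).
  apply: contrapT => /forallNP H.
  have : (\esum_(k in [set: int]) (y k)%:E <= (S - e / 2)%:E)%E.
    apply: (esum_le_window_sum (N0 := 0)) => // N _; rewrite lee_fin leNgt.
    by apply/negP; exact: H.
  by rewrite yE lee_fin lerBrDr gerDl leNgt e20.
have cvL : (fun n => \sum_(0 <= j < L.*2) x n (window L j)) @ \oo --> 0.
  elim: (L.*2) => [|m IH].
    by under eq_fun do rewrite big_geq //; exact: cvg_cst.
  under eq_fun do rewrite big_nat_recr //=.
  have h := cvgD IH (cv (window L m)); rewrite addr0 in h; exact: h.
have [n _ /(_ n (leqnn n)) small] := cvgr_le _ cvL _ e20.
exists n; apply: (esum_le_window_sum (N0 := L)) => // M LM; rewrite lee_fin.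
pose inside (z : int -> R) (k : int) := if - L%:Z <= k < L%:Z then z k else 0.
have sumL (z : int -> R) :
    \sum_(0 <= j < M.*2) inside z (window M j) = \sum_(0 <= j < L.*2) z (window L j).
  rewrite (window_sum_support (x := inside z) LM).
    by apply: eq_big_nat => j jL; rewrite /inside window_bounds.
  by move=> k kL; rewrite /inside (negbTE kL).
have yM : \sum_(0 <= j < M.*2) y (window M j) <= S.
  by rewrite -lee_fin -yE; exact: window_sum_le_esum.
have : \sum_(0 <= j < M.*2) x n (window M j) <= \sum_(0 <= j < M.*2)
    (inside (x n) (window M j) + (y (window M j) - inside y (window M j))).
  apply: ler_sum => j _; rewrite /inside; case: ifP => _.
    by rewrite subrr addr0.
  by rewrite add0r subr0.
rewrite big_split sumrB /= !sumL => /le_trans; apply.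
lra.
Qed.

Lemma powR_cvg0 (R : realType) (a : nat -> R) (r : R) : 0 < r -> (forall n, 0 <= a n) ->
  a @ \oo --> 0 -> (fun n => a n `^ r) @ \oo --> 0.
Proof.
move=> r0 a0 cv; apply/cvgrPdist_le => e e0.
have d0 : 0 < e `^ r^-1 by rewrite powR_gt0.
near=> n; rewrite sub0r normrN ger0_norm ?powR_ge0 //.
have -> : e = (e `^ r^-1) `^ r by rewrite -powRrM mulVf ?gt_eqF // powRr1 // ltW.
apply: ge0_ler_powR; rewrite ?nnegrE ?powR_ge0 ?(ltW r0) //.
by near: n; exact: cvgr_le _ cv _ d0.
Unshelve. all: by end_near. Qed.

Section density.
Context d (T : measurableType d) (R : realType) (P : probability T R).
Variable F : nat -> set (set T).
Hypothesis FF : filtration F.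
Variables (p q : R).
Hypotheses (p0 : 0 < p) (q0 : 0 < q).
Variable f : nat -> T -> R.
Hypotheses (f_mart : martingale0 P F f) (f_fin : (hardy_norm P F p q f < +oo)%E).

Local Notation L2 := (Lfun P 2%:E).
Local Notation Ex n := (cexp P (F n)).
Local Notation N f := (hardy_norm P F p q f).
Local Notation Sq f := (cond_sq P F f).
Local Notation hd f := (dyadic_sum p q (sq_level P F f)).
Local Notation sF := (filtration_sigma FF).
Local Notation csq i f := (cexp_ge0 P (F i) (fun y => (`|f i.+1 y - f i y| ^+ 2)%:E)).

Let mf : measurable_seq f.
Proof.
move=> n; have [w _ _ _] := f_mart.
by have := measurable_wrtW (sF n) (@filtration_measurable _ _ _ FF n) (w n); exact.
Qed.

(* Off these events, whose complements shrink to a null event as [n] grows,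
    the increments are dropped. *)
Let B n i := [set x | (psq P F f i x <= (n%:R : R)%:E)%E].
Let FB n i : F i (B n i). Proof. exact: psq_le_F. Qed.

Let u n i x := \1_(B n i) x * (f i.+1 x - f i x).

Let u_md n : mart_diff P F (u n).
Proof.
apply: (martingale_mart_diff FF f_mart (FB n)) => i.
exact: (integral_sq_fin FF mf (ler0n R n) (FB n i)).
Qed.

Let w n x := \sum_(0 <= i < n) u n i x.

Let w_L2 n : w n \in L2. Proof. exact: mart_diff_sum_L2 (u_md n) n. Qed.

Let w_E0 n : Ex 0 (w n) = cst 0 %[ae P].
Proof.
by apply: filterS (mart_diff_Ex FF (u_md n) n 0) => x e _; rewrite e // min0n big_geq.
Qed.

Let D n m x := f m x - mart P F (w n) m x.

Let mD n : measurable_seq (D n).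
Proof. by move=> m; apply: measurable_funB => //; exact: mart_measurable_seq. Qed.

Let diff_w n i : \forall x \ae P,
  mart P F (w n) i.+1 x - mart P F (w n) i x = if (i < n)%N then u n i x else 0.
Proof.
apply: filterS2 (mart_diff_Ex FF (u_md n) n i) (mart_diff_Ex FF (u_md n) n i.+1).
move=> x /(_ I) e0 /(_ I) e1; rewrite /mart e0 e1; case: (boolP (i < n)%N) => h.
  rewrite (minn_idPl h) (minn_idPl (ltnW h)) big_nat_recr //=.
  by rewrite addrAC subrr add0r.
rewrite -leqNgt in h.
by rewrite (minn_idPr h) (minn_idPr (leqW h)) subrr.
Qed.

(* What is left of the square function after subtracting the truncation. *)
Let csq_D n i : \forall x \ae P,
  (csq i (D n) x <= if (i < n)%N && (psq P F f i x <= (n%:R : R)%:E)%E then 0 else csq i f x)%E.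
Proof.
have F_T : F i setT by exact: sub_sigma_algebraT (sF i).
have FC := sub_sigma_algebraC (sF i) (FB n i).
have off (A : set T) : F i A -> (forall x, A x -> ~~ ((i < n)%N && (psq P F f i x <= (n%:R : R)%:E)%E)) ->
    \forall x \ae P, A x -> (csq i (D n) x <= csq i f x)%E.
  move=> FA Aoff; apply: (csq_mono FF (mD n) mf FA); apply: filterS (diff_w n i) => x dw Ax.
  rewrite /D; set b := mart P F (w n) i.+1 x in dw *; set a := mart P F (w n) i x in dw *.
  have := Aoff x Ax; case: ltnP dw => /= _ dw nx; last first.
    have -> : f i.+1 x - b - (f i x - a) = f i.+1 x - f i x - (b - a) by ring.
    by rewrite dw subr0.
  have {}dw : b - a = 0 by rewrite dw /u indicE memNset ?mul0r //= => xB; rewrite xB in nx.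
  have -> : f i.+1 x - b - (f i x - a) = f i.+1 x - f i x - (b - a) by ring.
  by rewrite dw subr0.
have [ni|ni] := leqP n i.
  have := off setT F_T; rewrite ltnNge ni /=.
  by move=> /(_ (fun _ _ => isT)); apply: filterS => x; exact.
have on : \forall x \ae P, B n i x -> csq i (D n) x = 0%E.
  apply: (csq_eq0 FF (mD n) (FB n i)); apply: filterS (diff_w n i) => x dw Bx.
  rewrite /D; set b := mart P F (w n) i.+1 x in dw *; set a := mart P F (w n) i x in dw *.
  have -> : f i.+1 x - b - (f i x - a) = f i.+1 x - f i x - (b - a) by ring.
  by rewrite dw ni /u indicE mem_set // mul1r subrr.
have Coff : forall x, (~` B n i) x -> ~~ ((i < n)%N && (psq P F f i x <= (n%:R : R)%:E)%E).
  by move=> x; rewrite ni /= => /negP.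
apply: filterS2 on (off _ FC Coff) => x on off' /=.
by case: ifPn => [/on ->//|/negP]; exact: off'.
Qed.

Let Sq_D_le : \forall x \ae P, forall n, (Sq (D n) x <= Sq f x)%E.
Proof.
apply: ae_forall_nat => n.
have : \forall x \ae P, forall i, (csq i (D n) x <= csq i f x)%E.
  apply: ae_forall_nat => i; apply: filterS (csq_D n i) => x /le_trans; apply.
  by case: ifP => _ //; exact: csq_ge0.
apply: filterS => x le; apply: lee_nneseries => [i _ _|i _]; last exact: le.
exact: (csq_ge0 P FF i x (mD n)).
Qed.

Let Sq_D_small (t : R) : 0 < t ->
  \forall x \ae P, exists m, forall n, (m <= n)%N -> (Sq (D n) x <= t%:E)%E.
Proof.
move=> t0.
have all : \forall x \ae P, forall n i, (csq i (D n) x <=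
    if (i < n)%N && (psq P F f i x <= (n%:R : R)%:E)%E then 0 else csq i f x)%E.
  by apply: ae_forall_nat => n; apply: ae_forall_nat => i; exact: csq_D.
apply: filterS2 all (cond_sq_fin_ae FF p0 q0 mf f_fin) => x le fin.
have csq0 i : (0 <= csq i f x)%E by exact: csq_ge0.
have tail0 := @nneseries_tail_cvg R (fun i => csq i f x) xpredT fin (fun i _ => csq0 i).
have [m1 _ m1P] : \forall m \near \oo, (\sum_(m <= i <oo) csq i f x < t%:E)%E.
  have t0' : (0 < t%:E)%E by rewrite lte_fin.
  exact: tail0 _ (open_ereal_lt' t0').
have SE : (Sq f x = (fine (Sq f x))%:E)%E by rewrite fineK // ge0_fin_numE // cond_sq_ge0.
exists (maxn m1 (Num.truncn (fine (Sq f x))).+1) => n; rewrite geq_max => /andP[m1n Sn].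
have psn i : (psq P F f i x <= (n%:R : R)%:E)%E.
  apply: (le_trans (psq_le_cond_sq P FF mf i x)); rewrite SE lee_fin ltW //.
  by apply: (lt_le_trans (truncnS_gt _)); rewrite ler_nat.
apply: le_trans (ltW (m1P n m1n)).
have tailE : (\sum_(n <= i <oo) csq i f x =
    \sum_(0 <= i <oo) if (n <= i)%N then csq i f x else 0)%E.
  by rewrite eseries_cond eseries_mkcond.
rewrite tailE; apply: lee_nneseries => [i _ _|i _]; first exact: (csq_ge0 P FF i x (mD n)).
apply: (le_trans (le n i)); rewrite psn andbT.
by case: ltnP.
Qed.

Let level_cvg k : (fun n => sq_level P F (D n) k) @ \oo --> 0.
Proof.
pose t : R := (2 ^ k) ^+ 2; have t0 : 0 < t by rewrite exprn_gt0 // exprz_gt0.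
pose A n := [set x | (t%:E < Sq (D n) x)%E].
have mA n : measurable (A n) by exact: sq_set_measurable.
pose h n x : \bar R := (\1_(A n) x)%:E.
have mh n : measurable_fun setT (h n).
  by apply/measurable_EFinP; exact: measurable_indic.
have cvh : \forall x \ae P, setT x -> h^~ x @ \oo --> (cst 0 x : \bar R).
  apply: filterS (Sq_D_small t0) => x [m small] _.
  apply: cvg_near_cst; exists m => // n /= mn.
  by rewrite /h indicE memNset // /A /= ltNge small.
have dom : \forall x \ae P, forall n, setT x -> (`|h n x| <= cst 1 x)%E.
  by apply: aeW => x n _; rewrite /h lee_fin indicE; case: (_ \in _); rewrite ?normr1 ?normr0.
have int1 : P.-integrable setT (cst 1%E : T -> \bar R).
  exact: finite_measure_integrable_cst.
have [_ _] := dominated_convergence measurableT mh (measurable_cst _) cvh int1 dom.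
rewrite integral0 => cv.
have E : (fun n => (\int[P]_x h n x)%E) = (fun n => P (A n)).
  by apply/funext => n; rewrite /h integral_indic // setIT.
rewrite E in cv; exact: (fine_cvg cv).
Qed.

(** Truncating the increments where the predictable square function is large,
    and stopping at a finite time, approximates [f] by dominated convergence. *)
Lemma hardy_dense (e : R) : 0 < e -> exists v,
  [/\ v \in L2, Ex 0 v = cst 0 %[ae P] &
    (N (fun n x => f n x - mart P F v n x)%R <= e%:E)%E].
Proof.
move=> e0; have [C C0 NE] := hardy_norm_le_dyadic P FF p0 q0.
pose x n k := (2 ^ k * sq_level P F (D n) k `^ p^-1) `^ q.
pose y k := (2 ^ k * sq_level P F f k `^ p^-1) `^ q.
have x0 n k : 0 <= x n k by exact: powR_ge0.
have xy n k : x n k <= y k.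
  apply: (term_le p0 q0); first exact: sq_level_ge0.
  apply: fine_prob_le_ae; [exact: sq_set_measurable..|].
  by apply: filterS Sq_D_le => z /(_ n) le /= /lt_le_trans; apply.
have cv k : x^~ k @ \oo --> 0.
  have pk : 0 < (2 : R) ^ k by rewrite exprz_gt0.
  apply: powR_cvg0 => //; first by move=> n; rewrite mulr_ge0 ?powR_ge0 // ltW.
  have h : (fun n => sq_level P F (D n) k `^ p^-1) @ \oo --> 0.
    by apply: powR_cvg0; [rewrite invr_gt0|move=> n; exact: sq_level_ge0|exact: level_cvg].
  have := cvgMr (a := 2 ^ k) h; rewrite mulr0; exact.
have fin : (\esum_(k in [set: int]) (y k)%:E < +oo)%E by exact/(hardy_norm_fin P FF p0 q0 mf).
have d0 : 0 < (e / C) `^ q by rewrite powR_gt0 // divr_gt0.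
have [n le] := esum_dominated_small d0 x0 xy fin cv.
exists (w n); split; [exact: w_L2|exact: w_E0|].
have D0 : (0 <= ((e / C) `^ q)%:E :> \bar R)%E by rewrite lee_fin powR_ge0.
have {}le : (hd (D n) <= 1%:E * ((e / C) `^ q)%:E)%E by rewrite mul1e.
apply: (le_trans (NE _ _ _ (mD n) ler01 D0 le)).
rewrite powR1 mulr1 poweR_EFin -powRrM mulfV ?gt_eqF // powRr1 ?divr_ge0 ?(ltW C0) ?(ltW e0) //.
by rewrite -EFinM lee_fin mulrCA divff ?mulr1 // gt_eqF.
Qed.

End density.

(** * The Hardy space as a quasi-normed space *)

Lemma lee_lin_const (R : realType) (c a : R) (X Y Z : \bar R) :
  0 <= c -> 0 <= a -> (0 <= Y)%E -> (0 <= Z)%E -> (X <= (c * a)%:E * Y)%E ->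
  (X + Z <= (c + 1)%:E * (a%:E * Y + Z))%E.
Proof.
move=> c0 a0 Y0 Z0 XY.
rewrite ge0_muleDr ?mule_ge0 ?lee_fin //; apply: leeD.
  apply: (le_trans XY); rewrite muleA -EFinM; apply: lee_wpmul2r => //.
  by rewrite lee_fin ler_wpM2r // lerDl.
by rewrite -[leLHS]mul1e; apply: lee_wpmul2r => //; rewrite lee_fin lerDr.
Qed.

Lemma lin_fin (R : realType) (c a : R) (Y Z : \bar R) :
  0 <= c -> 0 <= a -> (0 <= Y)%E -> (Y < +oo)%E -> (Z < +oo)%E ->
  (c%:E * (a%:E * Y + Z) < +oo)%E.
Proof.
move=> c0 a0 Y0 Yoo Zoo.
rewrite lte_mul_pinfty ?lee_fin // lte_add_pinfty // lte_mul_pinfty ?lee_fin //.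
Qed.

Section hardy_space.
Context d (T : measurableType d) (R : realType) (P : probability T R).
Variable F : nat -> set (set T).
Hypothesis FF : filtration F.
Variables (p q : R).
Hypotheses (p0 : 0 < p) (p2 : p < 2) (q0 : 0 < q).

Local Notation L2 := (Lfun P 2%:E).
Local Notation Ex n := (cexp P (F n)).
Local Notation N := (hardy_norm P F p q).
Local Notation Sq f := (cond_sq P F f).
Local Notation H := (hardy P F p q).
Local Notation M0 := (martingale0 P F).
Local Notation V := (nat -> T -> R).
Local Notation J := (mart P F).
Local Notation sF := (filtration_sigma FF).
Local Notation FM n := (@filtration_measurable _ _ _ FF n).
Local Notation FMs := (filtration_measurable FF).
Local Notation zero_seq := (fun _ : nat => (cst 0%R : T -> R)).
Implicit Types (f g h : V) (v w : T -> R).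

Lemma scale_addE (a : R) f h : a *: f + h = (fun n x => a * f n x + h n x).
Proof. by []. Qed.

Lemma sub_scaleE f h : f - h = (-1) *: h + f.
Proof. by rewrite scaleN1r addrC. Qed.

Lemma martingale_measurable f : M0 f -> measurable_seq f.
Proof.
move=> [w _ _ _] n.
by have := measurable_wrtW (sF n) (@filtration_measurable _ _ _ FF n) (w n); exact.
Qed.

Lemma martingale0_lin (a : R) f h : M0 f -> M0 h -> M0 (a *: f + h).
Proof.
rewrite scale_addE => -[fw fi fm f0] [hw hi hm h0].
have lin_int n : P.-integrable setT (EFin \o (fun x => a * f n x + h n x)).
  exact: (integrableD measurableT (integrableZl measurableT a (fi n)) (hi n)).
have lin_w n : measurable_wrt (F n) (fun x => a * f n x + h n x).
  apply: measurable_funD; last exact: hw.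
  by apply: measurable_funM; [exact: measurable_cst|exact: fw].
have linE n A : measurable A -> (\int[P]_(x in A) (a * f n x + h n x)%:E =
    a%:E * \int[P]_(x in A) (f n x)%:E + \int[P]_(x in A) (h n x)%:E)%E.
  move=> mA; have fA : P.-integrable A (fun x => (f n x)%:E) by exact: (integrableS measurableT mA (@subsetT _ A) (fi n)).
  have hA : P.-integrable A (fun x => (h n x)%:E) by exact: (integrableS measurableT mA (@subsetT _ A) (hi n)).
  have afA : P.-integrable A (fun x => a%:E * (f n x)%:E)%E.
    exact: (integrableZl mA a fA).
  have := integralD mA afA hA; rewrite (integralZl mA fA) => <-.
  by apply: eq_integral => x _.
have mean g m n A : (forall n, P.-integrable setT (EFin \o g n)) ->
    (forall m n, (m <= n)%N -> cexp P (F m) (g n) = g m %[ae P]) ->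
    (forall n, measurable_fun setT (g n)) ->
    (m <= n)%N -> F m A -> (\int[P]_(x in A) (g m x)%:E = \int[P]_(x in A) (g n x)%:E)%E.
  move=> gi gm mg mn FA; rewrite -(integral_cexp (sF m) (FM m) (gi n) FA).
  have mA := FMs FA; apply: ae_eq_integral => //.
  - by apply/measurable_EFinP; exact: measurable_funTS.
  - apply: measurable_funTS.
    by case/integrableP: (integrable_cexp (sF m) (FM m) (gi n)).
  - by apply: filterS (gm m n mn) => x /(_ I) -> _.
split=> //.
- move=> m n mn; apply: (cexp_unique (sF m) (FM m) (lin_int n)); split => // A FA.
  have mA := FMs FA; rewrite !linE //.
  rewrite (mean f m n A fi fm (martingale_measurable _) mn FA); last by split.
  by rewrite (mean h m n A hi hm (martingale_measurable _) mn FA); last by split.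
- by apply: filterS2 f0 h0 => x /(_ I) -> /(_ I) -> _; rewrite mulr0 addr0.
Qed.

Lemma martingale0_cst0 : M0 zero_seq.
Proof.
have int0 : P.-integrable setT (EFin \o (cst 0 : T -> R)) by exact: integrable0.
split=> //.
- by move=> n; exact: measurable_cst.
- by move=> m n _; exact: (Ex_cst0 P FF m).
- by apply: aeW.
Qed.

Lemma mart_martingale0 v : v \in L2 -> Ex 0 v = cst 0 %[ae P] -> M0 (J v).
Proof.
move=> v2 v0; have E2 n := Ex_L2 FF n v2; split=> //.
- by move=> n; exact (Ex_wrt FF (n := n) v2).
- by move=> n; exact: (L2_integrable (E2 n)).
move=> m n mn; have Ewm := Ex_wrt FF (n := m) v2.
apply: (Ex_unique FF (E2 n) (E2 m) Ewm) => A FA.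
have A2 := indic_in_L2 P (FMs FA).
have m1 : measurable_wrt (F m) (\1_A : T -> R) := measurable_wrt_indic FF FA.
have m1n : measurable_wrt (F n) (\1_A : T -> R).
  exact (measurable_wrt_indic FF (filtration_mono FF mn FA)).
by rewrite (ip_Ex FF A2 v2 m1n) (ip_Ex FF A2 v2 m1).
Qed.

Lemma cond_sq_cst0 : \forall x \ae P, Sq zero_seq x = 0%E.
Proof.
have mz : measurable_seq zero_seq.
  by move=> n; exact: measurable_cst.
have T_F i : F i setT by exact: sub_sigma_algebraT (sF i).
have z : forall i : nat, \forall x \ae P, setT x -> (cst 0 : T -> R) x - (cst 0 : T -> R) x = 0.
  by move=> i; apply: aeW => x _; rewrite subrr.
by apply: filterS (cond_sq_eq0 FF mz T_F z) => x; apply.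
Qed.

Local Opaque cond_sq hardy_norm mart.

Let mz : measurable_seq zero_seq.
Proof. by move=> n; exact: measurable_cst. Qed.

Lemma hardy_norm_ae0 f : measurable_seq f -> (forall n, f n = cst 0 %[ae P]) -> N f = 0%E.
Proof.
move=> mf f0; have [C C0 scale] := hardy_norm_scale P FF p0 q0.
have le0 h : measurable_seq h -> (forall n, h n = cst 0 %[ae P]) -> \forall x \ae P, Sq h x = 0%E.
  move=> mh h0; have T_F i : F i setT by exact: sub_sigma_algebraT (sF i).
  have z i : \forall x \ae P, setT x -> h i.+1 x - h i x = 0.
    by apply: filterS2 (h0 i.+1) (h0 i) => x /(_ I) -> /(_ I) -> _; rewrite subrr.
  by apply: filterS (cond_sq_eq0 FF mh T_F z) => x; apply.
have : (N f <= (C * `|0 : R|)%:E * N f)%E.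
  apply: (scale f f 0 mf mf); apply: filterS (le0 f mf f0) => x ->.
  by rewrite mule0.
rewrite normr0 mulr0 mul0e => le; apply/eqP; rewrite eq_le le.
exact: hardy_norm_ge0.
Qed.

(** One estimate covers homogeneity, the quasi-triangle inequality and the
    invariance under almost sure equality, by which martingales are not
    quotiented. *)
Lemma hardy_norm_lin : exists2 C : R, 0 < C & forall f g h (a : R),
  measurable_seq f -> measurable_seq g -> measurable_seq h ->
  (forall n, f n = (fun x => a * g n x + h n x) %[ae P]) ->
  (N f <= C%:E * ((`|a|)%:E * N g + N h))%E.
Proof.
have [C1 C10 quasi] := hardy_norm_quasi P FF p0 q0.
have [C2 C20 scale] := hardy_norm_scale P FF p0 q0.
pose C := C2 + 1; have C0 : 0 < C by rewrite addr_gt0.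
exists (C1 * C); first by rewrite mulr_gt0.
move=> f g h a mf mg mh fE.
pose ag : V := fun n x => a * g n x.
have mag : measurable_seq ag.
  by move=> n; apply: measurable_funM => //; exact: measurable_cst.
have fle : (N f <= C1%:E * (N ag + N h))%E.
  exact: (quasi f ag h mf mag mh (sq_quasi_of_ae FF mf mag mh fE)).
have agle : (N ag <= (C2 * `|a|)%:E * N g)%E.
  apply: (scale ag g a mag mg).
  have le : \forall x \ae P, (Sq ag x <= (a ^+ 2)%:E * (Sq g x + Sq zero_seq x))%E.
    apply: (cond_sq_le FF mag mg mz (sqr_ge0 a)) => i; apply: aeW => x.
    rewrite /ag /= subrr normr0 expr0n addr0 -mulrBr normrM exprMn.
    by rewrite real_normK ?num_real.
  by apply: filterS2 le cond_sq_cst0 => x le z0; rewrite z0 adde0 in le.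
have Ng0 := hardy_norm_ge0 P F p q g; have Nh0 := hardy_norm_ge0 P F p q h.
apply: (le_trans fle); rewrite EFinM -muleA; apply: lee_wpmul2l; first by rewrite lee_fin ltW.
exact: (lee_lin_const (ltW C20) (normr_ge0 a) Ng0 Nh0 agle).
Qed.

Lemma hardy_measurable f : H f -> measurable_seq f.
Proof. by move=> [/martingale_measurable]. Qed.

Lemma hardy_lin (a : R) f h : H f -> H h -> H (a *: f + h).
Proof.
move=> [fm fN] [hm hN]; have m := martingale0_lin a fm hm; split; first exact: m.
have [C C0 lin] := hardy_norm_lin.
have mfh := martingale_measurable m.
apply: le_lt_trans (lin (a *: f + h) f h a mfh (martingale_measurable fm)
  (martingale_measurable hm) _) _; first by move=> n; exact: aeW.
exact: (lin_fin (ltW C0) (normr_ge0 a) (hardy_norm_ge0 P F p q f) fN hN).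
Qed.

Lemma hardy_mart v : v \in L2 -> Ex 0 v = cst 0 %[ae P] -> H (J v).
Proof.
move=> v2 v0; split; first exact: mart_martingale0.
have [C C0 le] := hardy_norm_le_nrm2 P FF p0 p2 q0.
exact: le_lt_trans (le v v2) (ltry _).
Qed.

Lemma hardy0 : H 0.
Proof.
split; first exact: martingale0_cst0.
rewrite (hardy_norm_ae0 mz) ?ltry // => n; exact: aeW.
Qed.

Lemma hardy_dense_mart f (e : R) : H f -> 0 < e -> exists v,
  [/\ v \in L2, Ex 0 v = cst 0 %[ae P] & (N (J v - f)%R <= e%:E)%E].
Proof.
move=> [fm fN] e0; have [C C0 lin] := hardy_norm_lin.
have eC0 : 0 < e / C by rewrite divr_gt0.
have [v [v2 v0 le]] := hardy_dense FF p0 q0 fm fN eC0.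
have mf := martingale_measurable fm; have mJ := mart_measurable_seq FF v2.
exists v; split => //.
pose D : V := fun n x => f n x - J v n x.
have mD : measurable_seq D by move=> n; exact: measurable_funB.
have mJf : measurable_seq (J v - f) by move=> n; exact: measurable_funB.
have Nz : N zero_seq = 0%E by apply: (hardy_norm_ae0 mz) => n; exact: aeW.
apply: le_trans (lin (J v - f) D zero_seq (-1) mJf mD mz _) _.
  move=> n; apply: aeW => x _ /=.
  rewrite -[LHS]/(J v n x - f n x) /D; ring.
rewrite Nz adde0 normrN1 mul1e; apply: (le_trans (lee_wpmul2l _ le)); first by rewrite lee_fin ltW.
by rewrite -EFinM lee_fin mulrCA divff ?mulr1 // gt_eqF.
Qed.

End hardy_space.

(** * Functionals on a quasi-normed space *)

Section quasi_normed.
Context (R : realType) (V : lmodType R) (H : set V) (n : V -> R) (C : R).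
Hypotheses (C0 : 0 < C) (H0 : H 0) (Hlin : forall a f h, H f -> H h -> H (a *: f + h))
  (n_ge0 : forall f, 0 <= n f) (n0 : n 0 = 0)
  (nlin : forall (a : R) f h, H f -> H h -> n (a *: f + h) <= C * (`|a| * n f + n h)).

Definition linear_on (phi : V -> R) :=
  forall (a : R) f h, H f -> H h -> phi (a *: f + h) = a * phi f + phi h.

Let Hscale a f : H f -> H (a *: f).
Proof. by move=> Hf; rewrite -(addr0 (a *: f)); exact: Hlin. Qed.

Let Hsub f h : H f -> H h -> H (f - h).
Proof. by move=> Hf Hh; rewrite addrC -scaleN1r; exact: Hlin. Qed.

Let nscale a f : H f -> n (a *: f) <= C * (`|a| * n f).
Proof.
by move=> Hf; have := nlin a Hf H0; rewrite n0 !addr0.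
Qed.

Let nadd f h : H f -> H h -> n (f + h) <= C * (n f + n h).
Proof. by move=> Hf Hh; have := nlin 1 Hf Hh; rewrite scale1r normr1 mul1r. Qed.

Let nsub f h : H f -> H h -> n (f - h) <= C * (n h + n f).
Proof.
by move=> Hf Hh; have := nlin (-1) Hh Hf; rewrite scaleN1r addrC normrN1 mul1r.
Qed.

Lemma linear_on0 phi : linear_on phi -> phi 0 = 0.
Proof.
move=> lin; have := lin 1 0 0 H0 H0; rewrite scale1r addr0 mul1r => e.
by apply: (@addrI _ (phi 0)); rewrite -e addr0.
Qed.

Lemma linear_on_scale phi a f : linear_on phi -> H f -> phi (a *: f) = a * phi f.
Proof.
by move=> lin Hf; have := lin a f 0 Hf H0; rewrite (linear_on0 lin) !addr0.
Qed.

Lemma linear_on_sub phi f h : linear_on phi -> H f -> H h -> phi (f - h) = phi f - phi h.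
Proof.
by move=> lin Hf Hh; have := lin (-1) h f Hh Hf; rewrite scaleN1r addrC => ->; rewrite mulN1r addrC.
Qed.

(** The form in which approximation arguments conclude: every error is a
    multiple of an arbitrary [e]. *)
Lemma le0_small (x c : R) : (forall e, 0 < e -> x <= c * e) -> x <= 0.
Proof.
move=> le; rewrite leNgt; apply/negP => x0.
have [c0|c0] := leP c 0.
  by have := le 1 ltr01; rewrite mulr1 => /le_trans /(_ c0); rewrite leNgt x0.
have := le (x / (2 * c)); rewrite divr_gt0 ?mulr_gt0 // => /(_ isT).
have -> : c * (x / (2 * c)) = x / 2 by field; rewrite gt_eqF.
lra.
Qed.

(** A bound on the unit ball is a bound everywhere; the constant appears because
    [n] is only quasi-homogeneous. *)
Lemma bounded_of_ball phi (D : R) : linear_on phi -> 0 <= D ->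
  (forall f, H f -> n f <= 1 -> `|phi f| <= D) ->
  forall f, H f -> `|phi f| <= C * D * n f.
Proof.
move=> lin D0 ball f Hf; rewrite -subr_le0; apply: (@le0_small _ (C * D)) => e e0.
have pos : 0 < n f + e by rewrite ltr_wpDl.
have t0 : 0 < (C * (n f + e))^-1 by rewrite invr_gt0 mulr_gt0.
have := ball ((C * (n f + e))^-1 *: f) (Hscale _ Hf).
rewrite (linear_on_scale _ lin Hf) normrM gtr0_norm // ler_pdivrMl ?mulr_gt0 // => le.
have {}le : n ((C * (n f + e))^-1 *: f) <= 1 -> `|phi f| <= C * D * (n f + e).
  by move=> /le; rewrite mulrAC.
rewrite lerBlDr addrC -mulrDr; apply: le.
apply: (le_trans (nscale _ Hf)); rewrite gtr0_norm // mulrCA ler_pdivrMl ?mulr_gt0 // mulr1 ler_wpM2l ?(ltW C0) //.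
by rewrite lerDl ltW.
Qed.

Lemma bounded_of_continuous phi : linear_on phi ->
  (exists2 delta : R, 0 < delta & forall h, H h -> n h < delta -> `|phi h| < 1) ->
  exists2 B : R, 0 <= B & forall f, H f -> `|phi f| <= B * n f.
Proof.
move=> lin [delta d0 small]; pose D := 2 * C / delta.
have D0 : 0 < D by rewrite divr_gt0 // mulr_gt0.
exists (C * D); first by rewrite mulr_ge0 // ltW.
apply: bounded_of_ball => //; first exact: ltW.
move=> f Hf n1; have := small (D^-1 *: f) (Hscale _ Hf).
rewrite (linear_on_scale _ lin Hf) normrM gtr0_norm ?invr_gt0 // ltr_pdivrMl // mulr1 => le.
apply/ltW/le; apply: (le_lt_trans (nscale _ Hf)).
rewrite gtr0_norm ?invr_gt0 //; apply: (@le_lt_trans _ _ (C * D^-1)).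
  by apply: ler_wpM2l; [exact: ltW|rewrite ler_piMr // ltW // invr_gt0].
have -> : C * D^-1 = delta / 2 by rewrite /D; field; rewrite !gt_eqF.
by rewrite ltr_pdivrMr // ltr_pMr // ltr1n.
Qed.

Lemma eq_on_dense I (J : I -> V) (phi psi : V -> R) :
  (forall i, H (J i)) ->
  (forall f (e : R), H f -> 0 < e -> exists i, n (J i - f) < e) ->
  (forall f, H f -> forall e : R, 0 < e -> exists2 delta : R, 0 < delta &
     forall h, H h -> n (h - f) < delta -> `|phi h - phi f| < e) ->
  (forall f, H f -> forall e : R, 0 < e -> exists2 delta : R, 0 < delta &
     forall h, H h -> n (h - f) < delta -> `|psi h - psi f| < e) ->
  (forall i, phi (J i) = psi (J i)) -> forall f, H f -> phi f = psi f.
Proof.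
move=> HJ dense cphi cpsi eqJ f Hf; apply/eqP; rewrite -subr_eq0 -normr_le0.
apply: (@le0_small _ 2) => e e0.
have [d1 d10 s1] := cphi f Hf e e0; have [d2 d20 s2] := cpsi f Hf e e0.
have m0 : 0 < Num.min d1 d2 by rewrite lt_min d10 d20.
have [i] := dense f _ Hf m0; rewrite lt_min => /andP[i1 i2].
have := s1 _ (HJ i) i1; have := s2 _ (HJ i) i2; rewrite eqJ => h2 h1.
have -> : phi f - psi f = (psi (J i) - psi f) - (psi (J i) - phi f) by ring.
by apply: (le_trans (ler_normB _ _)); rewrite mulr2n mulrDl mul1r lerD // ltW.
Qed.

(** Extension of a bounded functional given on a dense family [J].  The value
    at [f] is the supremum of the lower bounds that the values on the family
    impose, so that no limit of a chosen sequence has to be taken. *)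
Section extension.
Context (I : Type) (i0 : I) (J : I -> V) (l : I -> R) (K : R).
Hypotheses (K0 : 0 <= K) (HJ : forall i, H (J i))
  (Jlin : forall (a : R) i j, exists k,
     l k = a * l i + l j /\ n (J k - (a *: J i + J j)) = 0)
  (bound : forall i, `|l i| <= K * n (J i))
  (dense : forall f (e : R), H f -> 0 < e -> exists i, n (J i - f) <= e).

Let K2 := K * (C * C).
Let K20 : 0 <= K2. Proof. by rewrite mulr_ge0 // mulr_ge0 // ltW. Qed.

Let ext f := sup [set l i - K2 * n (J i - f) | i in [set: I]].

Let l_close f i j : H f -> `|l i - l j| <= K2 * (n (J j - f) + n (J i - f)).
Proof.
move=> Hf; have [k [lk Jk]] := Jlin (-1) j i.
have -> : l i - l j = l k by rewrite lk; ring.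
apply: (le_trans (bound k)); rewrite /K2 -!mulrA; apply: ler_wpM2l => //.
have Hc : H (-1 *: J j + J i) by exact: Hlin.
have -> : J k = (J k - (-1 *: J j + J i)) + (-1 *: J j + J i) by rewrite subrK.
apply: (le_trans (nadd (Hsub (HJ k) Hc) Hc)); rewrite Jk add0r.
apply: ler_wpM2l; first exact: ltW.
have -> : -1 *: J j + J i = (J i - f) - (J j - f).
  by rewrite scaleN1r opprB addrA subrK addrC.
exact: nsub (Hsub (HJ i) Hf) (Hsub (HJ j) Hf).
Qed.

Let ext_close f i : H f -> `|ext f - l i| <= K2 * n (J i - f).
Proof.
move=> Hf.
have ub j : ubound [set l i - K2 * n (J i - f) | i in [set: I]] (l j + K2 * n (J j - f)).
  move=> _ [k _ <-]; have := l_close k j Hf; rewrite ler_norml => /andP[_].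
  by rewrite mulrDr; lra.
have hs : has_sup [set l i - K2 * n (J i - f) | i in [set: I]].
  split; first by exists (l i0 - K2 * n (J i0 - f)), i0.
  by exists (l i + K2 * n (J i - f)).
have lo : l i - K2 * n (J i - f) <= ext f by apply: ub_le_sup; [case: hs|exists i].
have hi : ext f <= l i + K2 * n (J i - f) by apply: ge_sup => //; case: hs.
by rewrite ler_norml; apply/andP; split; lra.
Qed.

Lemma functional_extension : exists phi,
  [/\ linear_on phi, forall f, H f -> `|phi f| <= K * C * n f & forall i, phi (J i) = l i].
Proof.
exists ext; split.
- move=> a f h Hf Hh; have Hfh := Hlin a Hf Hh.
  apply/eqP; rewrite -subr_eq0 -normr_le0.
  apply: (@le0_small _ (K2 * (C * C + 1) * (`|a| + 1))) => e e0.
  have [i ni] := dense Hf e0; have [j nj] := dense Hh e0.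
  have [k [lk Jk]] := Jlin a i j.
  have Hc := Hlin a (HJ i) (HJ j).
  have [Hi Hj] := (Hsub (HJ i) Hf, Hsub (HJ j) Hh).
  have nk : n (J k - (a *: f + h)) <= C * C * ((`|a| + 1) * e).
    have -> : J k - (a *: f + h) =
        (J k - (a *: J i + J j)) + (a *: (J i - f) + (J j - h)).
      rewrite scalerBr [a *: J i - _ + _]addrACA -opprD addrA subrK //.
    apply: (le_trans (nadd (Hsub (HJ k) Hc) (Hlin a Hi Hj))).
    rewrite Jk add0r -mulrA; apply: ler_wpM2l; first exact: ltW.
    apply: (le_trans (nlin a Hi Hj)); apply: ler_wpM2l; first exact: ltW.
    by rewrite mulrDl mul1r lerD // ler_wpM2l.
  have e1 := le_trans (ext_close k Hfh) (ler_wpM2l K20 nk).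
  have e2 := le_trans (ext_close i Hf) (ler_wpM2l K20 ni).
  have e3 := le_trans (ext_close j Hh) (ler_wpM2l K20 nj).
  have -> : ext (a *: f + h) - (a * ext f + ext h) =
      (ext (a *: f + h) - l k) - (a * (ext f - l i) + (ext h - l j)).
    by rewrite lk; ring.
  apply: (le_trans (ler_normB _ _)).
  apply: (@le_trans _ _ (K2 * (C * C * ((`|a| + 1) * e)) + (`|a| * (K2 * e) + K2 * e))).
    apply: lerD => //; apply: (le_trans (ler_normD _ _)); apply: lerD => //.
    by rewrite normrM ler_wpM2l.
  by rewrite le_eqVlt; apply/orP; left; apply/eqP; ring.
- move=> f Hf; rewrite -subr_le0.
  apply: (@le0_small _ (K2 + K * C)) => e e0; have [i ni] := dense Hf e0.
  have e1 := le_trans (ext_close i Hf) (ler_wpM2l K20 ni).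
  have nJ : n (J i) <= C * (e + n f).
    rewrite -[J i](subrK f); apply: (le_trans (nadd (Hsub (HJ i) Hf) Hf)).
    by apply: ler_wpM2l; [exact: ltW|rewrite lerD2r].
  have -> : ext f = (ext f - l i) + l i by rewrite subrK.
  rewrite lerBlDr; apply: (le_trans (ler_normD _ _)).
  apply: (le_trans (lerD e1 (le_trans (bound i) (ler_wpM2l K0 nJ)))).
  by rewrite le_eqVlt; apply/orP; left; apply/eqP; ring.
move=> i; apply/eqP; rewrite -subr_eq0 -normr_le0.
by apply: (le_trans (ext_close i (HJ i))); rewrite subrr n0 mulr0.
Qed.

End extension.
End quasi_normed.

(** * Duality *)

Lemma le_of_lin (R : realType) (c a x y z : R) (X Y Z : \bar R) :
  X = x%:E -> Y = y%:E -> Z = z%:E -> (X <= c%:E * (a%:E * Y + Z))%E ->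
  x <= c * (a * y + z).
Proof. by move=> -> -> ->; rewrite -!(EFinM, EFinD) lee_fin. Qed.

Section duality.
Context d (T : measurableType d) (R : realType) (P : probability T R).
Variable F : nat -> set (set T).
Hypothesis FF : filtration F.
Variables (p q : R).
Hypotheses (p0 : 0 < p) (p2 : p < 2) (q0 : 0 < q).

Local Notation L2 := (Lfun P 2%:E).
Local Notation ip := (l2_inner P).
Local Notation nrm2 := (l2_norm P).
Local Notation Ex n := (cexp P (F n)).
Local Notation N := (hardy_norm P F p q).
Local Notation H := (hardy P F p q).
Local Notation V := (nat -> T -> R).
Local Notation J := (mart P F).
Implicit Types (f h : V) (v w g : T -> R).

Lemma expectation_ip v g : v \in L2 -> g \in L2 -> ('E_P[v \* g] = (ip v g)%:E)%E.
Proof.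
move=> v2 g2; rewrite unlock /l2_inner /Rintegral fineK //.
exact: integrable_fin_num (L2M_integrable v2 g2).
Qed.

Lemma Ex_ae n v w : v \in L2 -> w \in L2 -> v = w %[ae P] -> Ex n v = Ex n w %[ae P].
Proof.
move=> v2 w2 vw; apply: (Ex_unique FF v2 (Ex_L2 FF n w2) (Ex_wrt FF w2)) => A FA.
have mA := filtration_measurable FF FA; have A2 := indic_in_L2 P mA.
rewrite (ip_Ex FF A2 w2 (measurable_wrt_indic FF FA)) ipC (ipC P _ w).
exact: (ip_ae (L2_measurable v2) (L2_measurable w2) (L2_measurable A2) vw).
Qed.

Lemma Lr0_lin (a : R) v w : Lr0 P F 2 v -> Lr0 P F 2 w ->
  Lr0 P F 2 (fun x => a * v x + w x).
Proof.
move=> [v2 v0] [w2 w0]; split; first exact: (L2D (L2Z a v2) w2).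
apply: filterS2 (Ex_linear FF 0 a v2 w2) (filterI v0 w0) => x /(_ I) e [/(_ I) e1 /(_ I) e2] _.
by rewrite e e1 e2 mulr0 addr0.
Qed.

Lemma Lr0_centered v : v \in L2 -> Lr0 P F 2 (v \- Ex 0 v).
Proof.
move=> v2; have E2 := Ex_L2 FF 0 v2; split; first exact: L2B.
apply: (Ex_unique FF (L2B v2 E2) (L2_cst P 0)); first exact: measurable_cst.
move=> A FA; have A2 := indic_in_L2 P (filtration_measurable FF FA).
have m1 : measurable_wrt (F 0%N) (\1_A : T -> R) := measurable_wrt_indic FF FA.
by rewrite (ipBr v2 E2 A2) (ip_Ex FF A2 v2 m1) subrr ipC ip0l.
Qed.

Lemma nrm2_centered_le v : v \in L2 -> nrm2 (v \- Ex 0 v) <= 2 * nrm2 v.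
Proof.
move=> v2; have E2 := Ex_L2 FF 0 v2.
have -> : v \- Ex 0 v = (fun x => v x + (-1) * Ex 0 v x).
  by apply/funext => x; rewrite mulN1r.
apply: (le_trans (nrm2D v2 (L2Z (-1) E2))); rewrite nrm2Z // normrN1 mul1r.
have le : nrm2 (Ex 0 v) <= nrm2 v by rewrite ler_sqrt ?ip_ge0 //; exact: nrm2_Ex_le.
lra.
Qed.

Local Opaque cond_sq hardy_norm mart.

Let nr f := fine (N f).

Let NE f : H f -> N f = (nr f)%:E.
Proof. by move=> [_ Nf]; rewrite /nr fineK // ge0_fin_numE // hardy_norm_ge0. Qed.

Let nr_ge0 f : 0 <= nr f.
Proof. by rewrite fine_ge0 // hardy_norm_ge0. Qed.

Let Hsub f h : H f -> H h -> H (f - h).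
Proof. by move=> Hf Hh; rewrite sub_scaleE; exact: hardy_lin. Qed.

Let nr_ae0 f : H f -> (forall n, f n = cst 0 %[ae P]) -> nr f = 0.
Proof.
move=> Hf f0; rewrite /nr (hardy_norm_ae0 FF p0 q0 (hardy_measurable FF Hf) f0) //.
Qed.

Let nr0 : nr 0 = 0.
Proof. by apply: nr_ae0; [exact: hardy0|move=> n; exact: aeW]. Qed.

Let nr_lin : exists2 C : R, 0 < C & forall (a : R) f h, H f -> H h ->
  nr (a *: f + h) <= C * (`|a| * nr f + nr h).
Proof.
have [C C0 lin] := hardy_norm_lin P FF p0 q0.
exists C; [exact: C0|move=> a f h Hf Hh].
have Hfh := hardy_lin FF p0 q0 a Hf Hh.
have ae : forall n, (a *: f + h) n = (fun x => a * f n x + h n x) %[ae P].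
  by move=> n; exact: aeW.
exact: (le_of_lin (NE Hfh) (NE Hf) (NE Hh) (lin (a *: f + h) f h a
  (hardy_measurable FF Hfh) (hardy_measurable FF Hf) (hardy_measurable FF Hh) ae)).
Qed.

Let index := {v | Lr0 P F 2 v}.
Let Ji (i : index) := J (sval i).

Let H_J v : Lr0 P F 2 v -> H (J v).
Proof. by move=> [v2 v0]; exact: hardy_mart. Qed.

Let H_Ji i : H (Ji i). Proof. by apply: H_J; case: i. Qed.

Let mart_lin_ae (a : R) u v w : H (J u) -> Lr0 P F 2 v -> Lr0 P F 2 w ->
  (forall n, J u n = (fun x => a * J v n x + J w n x) %[ae P]) ->
  nr (J u - (a *: J v + J w)) = 0.
Proof.
move=> Hu Lv Lw uE; apply: nr_ae0 => [|n].
  exact: (Hsub Hu (hardy_lin FF p0 q0 a (H_J Lv) (H_J Lw))).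
apply: filterS (uE n) => x /(_ I) e _.
rewrite -[LHS]/(J u n x - (a * J v n x + J w n x)) e subrr //.
Qed.

Let J_linear (a : R) v w : Lr0 P F 2 v -> Lr0 P F 2 w ->
  nr (J (fun x => a * v x + w x) - (a *: J v + J w)) = 0.
Proof.
move=> Lv Lw; apply: (mart_lin_ae (H_J (Lr0_lin a Lv Lw)) Lv Lw) => n.
by case: Lv Lw => v2 _ [w2 _]; exact: (Ex_linear FF n a v2 w2).
Qed.

Let J_dense f (e : R) : H f -> 0 < e -> exists i, nr (Ji i - f) <= e.
Proof.
move=> Hf e0; have [v [v2 v0 le]] := hardy_dense_mart FF p0 q0 Hf e0.
exists (exist _ v (conj v2 v0)); set i : index := exist _ _ _.
rewrite -lee_fin -(NE (Hsub (H_Ji i) Hf)); exact: le.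
Qed.

Let continuousE phi : continuous_linear_on H N phi ->
  linear_on H phi /\
  forall f, H f -> forall e : R, 0 < e -> exists2 delta : R, 0 < delta &
     forall h, H h -> nr (h - f) < delta -> `|phi h - phi f| < e.
Proof.
move=> [lin cont]; split; [exact: lin|move=> f Hf e e0]; have [delta d0 cd] := cont f Hf e e0.
exists delta; [exact: d0|move=> h Hh hf].
by apply: (cd h Hh); rewrite (NE (Hsub Hh Hf)) lte_fin.
Qed.

Let continuous_of_bound phi (B : R) : linear_on H phi ->
  (forall f, H f -> `|phi f| <= B * nr f) -> continuous_linear_on H N phi.
Proof.
move=> lin bd; split; [exact: lin|move=> f Hf e e0].
have B1 : 0 < `|B| + 1 by rewrite ltr_wpDl.
exists (e / (`|B| + 1)); first by rewrite divr_gt0.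
move=> h Hh; rewrite (NE (Hsub Hh Hf)) lte_fin ltr_pdivlMr // => lt.
rewrite -(linear_on_sub lin Hh Hf).
apply: (le_lt_trans (bd _ (Hsub Hh Hf))); apply: le_lt_trans lt.
rewrite mulrC; apply: ler_wpM2l; first exact: nr_ge0.
by rewrite (le_trans (ler_norm B)) // lerDl.
Qed.

(** An equivalence of norms on the dense subspace [L_2] gives the duality: the
    functional extends by density, and a functional on the whole space is
    represented by the Riesz theorem on [L_2]. *)
Lemma dual_of_bounds (X : set (T -> R)) (NX : (T -> R) -> \bar R) :
  (forall g, X g <-> Lr0 P F 2 g /\ (NX g < +oo)%E) ->
  (forall g, (0 <= NX g)%E) ->
  (exists2 C : R, 0 < C & forall g (M : R), g \in L2 -> 0 <= M -> (NX g <= M%:E)%E ->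
     forall v, v \in L2 -> Ex 0 v = cst 0 %[ae P] ->
     ((`|ip v g|)%:E <= (C * M)%:E * N (J v))%E) ->
  (exists2 C : R, 0 < C & forall g (K : R), g \in L2 -> 0 <= K ->
     (forall v, v \in L2 -> Ex 0 v = cst 0 %[ae P] ->
        ((`|ip v g|)%:E <= K%:E * N (J v))%E) ->
     (NX g <= (C * K)%:E)%E) ->
  dual_is P F H N X NX.
Proof.
move=> XE NX0 [Cd Cd0 direct] [Cc Cc0 converse].
have [C C0 lin] := nr_lin.
have HH0 : H 0 by exact: hardy0.
have Hlin (a : R) f h : H f -> H h -> H (a *: f + h).
  by move=> Hf Hh; exact: (hardy_lin FF p0 q0 a Hf Hh).
have i0 : index := exist _ _ (Lr0_centered (L2_cst P 0)).
have dense' f (e : R) : H f -> 0 < e -> exists i, nr (Ji i - f) < e.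
  move=> Hf e0; have e20 : 0 < e / 2 by rewrite divr_gt0.
  have [i le] := J_dense Hf e20; exists i; apply: (le_lt_trans le).
  by rewrite ltr_pdivrMr // ltr_pMr // ltr1n.
have uniq phi psi g : continuous_linear_on H N phi -> continuous_linear_on H N psi ->
    extends_pairing P F g phi -> extends_pairing P F g psi ->
    forall f, H f -> psi f = phi f.
  move=> /continuousE[_ cphi] /continuousE[_ cpsi] ephi epsi.
  apply: (eq_on_dense H_Ji dense' cpsi cphi) => -[v Lv]; apply/EFin_inj.
  by rewrite /Ji /= (epsi v Lv) (ephi v Lv).
have ext g : X g -> exists phi, [/\ linear_on H phi,
    forall f, H f -> `|phi f| <= Cd * fine (NX g) * C * nr f & extends_pairing P F g phi].
  move=> /XE[[g2 g0] gfin]; pose M := fine (NX g).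
  have ME : NX g = M%:E by rewrite fineK // ge0_fin_numE.
  have M0 : 0 <= M by exact: fine_ge0.
  have CM0 : 0 <= Cd * M by rewrite mulr_ge0 // ltW.
  have gM : (NX g <= M%:E)%E by rewrite ME.
  pose l (i : index) := ip (sval i) g.
  have bound i : `|l i| <= Cd * M * nr (Ji i).
    rewrite -lee_fin EFinM -(NE (H_Ji i)); case: i => v [v2 v0].
    exact: (direct g M g2 M0 gM v v2 v0).
  have Jlin (a : R) i j : exists k, l k = a * l i + l j /\
      nr (Ji k - (a *: Ji i + Ji j)) = 0.
    case: i j => [v Lv] [w Lw]; exists (exist _ _ (Lr0_lin a Lv Lw)); split.
      have [[v2 _] [w2 _]] := (Lv, Lw).
      have e := ipDl (L2Z a v2) w2 g2; rewrite (ipZl a v2 g2) in e; exact: e.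
    exact: J_linear.
  have [phi [plin pbd pJ]] := functional_extension C0 Hlin nr0 lin i0 CM0 H_Ji Jlin bound J_dense.
  exists phi; split; [exact: plin|exact: pbd|move=> v Lv]; have := pJ (exist _ v Lv); rewrite /Ji /l /= => ->.
  by have [v2 _] := Lv; rewrite (expectation_ip v2 g2).
have ball phi : continuous_linear_on H N phi -> exists2 D : R, 0 <= D &
    dual_norm H N phi = D%:E /\ forall f, H f -> `|phi f| <= C * D * nr f.
  move=> /continuousE[plin pcont].
  have p00 : phi 0 = 0 := linear_on0 HH0 plin.
  have cont0 : exists2 delta : R, 0 < delta & forall h, H h -> nr h < delta -> `|phi h| < 1.
    have [delta d0 cd] := pcont 0 HH0 1 ltr01; exists delta; [exact: d0|move=> h Hh hd].
    by have := cd h Hh; rewrite (subr0 h) p00 (subr0 (phi h)) => /(_ hd).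
  have [B B0 bd] := bounded_of_continuous C0 HH0 Hlin nr_ge0 nr0 lin plin cont0.
  have le_B : (dual_norm H N phi <= B%:E)%E.
    apply: ge_ereal_sup => _ [f [Hf f1] <-]; rewrite lee_fin.
    rewrite (NE Hf) lee_fin in f1.
    by apply: (le_trans (bd f Hf)); exact: ler_piMr.
  have ge0 : (0 <= dual_norm H N phi)%E.
    apply: ereal_sup_ubound; exists 0; last by rewrite p00 normr0.
    split; first exact: HH0.
    by rewrite (NE HH0) nr0 lee_fin ler01.
  have DE : dual_norm H N phi = (fine (dual_norm H N phi))%:E.
    by rewrite fineK // ge0_fin_numE // (le_lt_trans le_B) // ltry.
  exists (fine (dual_norm H N phi)); first exact: fine_ge0.
  split; first exact: DE.
  apply: (bounded_of_ball C0 HH0 Hlin nr_ge0 nr0 lin plin).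
    exact: fine_ge0.
  move=> f Hf f1; rewrite -lee_fin -DE; apply: ereal_sup_ubound; exists f; last by [].
  split; first exact: Hf.
  by rewrite (NE Hf) lee_fin.
have pair_le phi g K : 0 <= K -> (forall f, H f -> `|phi f| <= K * nr f) ->
    extends_pairing P F g phi -> g \in L2 -> forall v, v \in L2 -> Ex 0 v = cst 0 %[ae P] ->
    ((`|ip v g|)%:E <= K%:E * N (J v))%E.
  move=> K0 bd ep g2 v v2 v0; have Lv : Lr0 P F 2 v by [].
  have e : phi (J v) = ip v g.
    by apply: EFin_inj; rewrite (ep v Lv) (expectation_ip v2 g2).
  rewrite -e.
  by rewrite (NE (H_J Lv)) -EFinM lee_fin; exact: bd _ (H_J Lv).
split.
- by move=> v Lv; exact: H_J.
- move=> g Xg; have [phi [plin pbd pe]] := ext g Xg; exists phi.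
  have pc := continuous_of_bound plin pbd; split; [exact: pc|exact: pe|].
  by move=> psi psic pse f Hf; exact: (uniq phi psi g pc psic pe pse f Hf).
- move=> phi pc; have [D D0 [DE bd]] := ball phi pc.
  have [plin _] := continuousE pc.
  have CD0 : 0 <= C * D by rewrite mulr_ge0 // ltW.
  have [C3 C30 emb] := hardy_norm_le_nrm2 P FF p0 p2 q0.
  have phi_ae a u v w : H (J u) -> Lr0 P F 2 v -> Lr0 P F 2 w ->
      (forall n, J u n = (fun x => a * J v n x + J w n x) %[ae P]) ->
      phi (J u) = a * phi (J v) + phi (J w).
    move=> Hu Lv Lw uE; have n00 := mart_lin_ae Hu Lv Lw uE.
    have Hvw := Hlin a _ _ (H_J Lv) (H_J Lw).
    have := bd _ (Hsub Hu Hvw); rewrite n00 mulr0 normr_le0.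
    rewrite (linear_on_sub plin Hu Hvw) subr_eq0 => /eqP ->.
    exact: plin (H_J Lv) (H_J Lw).
  have phi_eq u v : H (J u) -> H (J v) -> (forall n, J u n = J v n %[ae P]) ->
      phi (J u) = phi (J v).
    move=> Hu Hv uv.
    have n00 : nr (J u - J v) = 0.
      apply: (nr_ae0 (Hsub Hu Hv)) => n; apply: filterS (uv n) => x /(_ I) e _.
      by rewrite -[LHS]/(J u n x - J v n x) e subrr.
    have := bd _ (Hsub Hu Hv); rewrite n00 mulr0 normr_le0.
    by rewrite (linear_on_sub plin Hu Hv) subr_eq0 => /eqP.
  pose psi v := phi (J (v \- Ex 0 v)).
  have psi_lin (a : R) v w : v \in L2 -> w \in L2 ->
      psi (fun x => a * v x + w x) = a * psi v + psi w.
    move=> v2 w2; have u2 : (fun x => a * v x + w x) \in L2 by exact: (L2D (L2Z a v2) w2).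
    have Lu := Lr0_centered u2.
    have [Lv Lw] := (Lr0_centered v2, Lr0_centered w2).
    apply: (phi_ae a _ _ _ (H_J Lu) Lv Lw) => n.
    have c2 v' : v' \in L2 -> v' \- Ex 0 v' \in L2 by move=> /Lr0_centered[].
    have lin0 := Ex_linear FF 0 a v2 w2.
    have eqc : (fun x => a * v x + w x) \- Ex 0 (fun x => a * v x + w x) =
       (fun x => a * (v \- Ex 0 v) x + (w \- Ex 0 w) x) %[ae P].
      apply: filterS lin0 => x /(_ I) e _ /=; rewrite e; ring.
    have lin2 : (fun x => a * (v \- Ex 0 v) x + (w \- Ex 0 w) x) \in L2.
      exact: (L2D (L2Z a (c2 v v2)) (c2 w w2)).
    have := Ex_linear FF n a (c2 v v2) (c2 w w2).
    have := Ex_ae n (c2 _ u2) lin2 eqc.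
    by apply: filterS2 => x /(_ I) e1 /(_ I) e2 _; exact (etrans e1 e2).
  have psi_bd v : v \in L2 -> `|psi v| <= C * D * (C3 * 2) * nrm2 v.
    move=> v2; have Lv := Lr0_centered v2; have [c2 _] := Lv.
    apply: (le_trans (bd _ (H_J Lv))); rewrite -[leRHS]mulrA; apply: (ler_wpM2l CD0).
    have := emb _ c2; rewrite (NE (H_J Lv)) lee_fin => /le_trans; apply.
    rewrite -mulrA; apply: ler_wpM2l; first exact: ltW.
    exact: nrm2_centered_le.
  have [g1 g12 g1E] := riesz_L2 psi_lin psi_bd.
  have Lg := Lr0_centered g12; have [g2 g0] := Lg.
  have ep : extends_pairing P F (g1 \- Ex 0 g1) phi.
    move=> v Lv; have [v2 v0] := Lv; rewrite (expectation_ip v2 g2); congr EFin.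
    have E2 := Ex_L2 FF 0 g12.
    have -> : ip v (g1 \- Ex 0 g1) = ip v g1.
      have Ev := Ex_L2 FF 0 v2.
      rewrite ipBr // -[in RHS](subr0 (ip v g1)); congr (_ - _).
      rewrite ipC -(ip_Ex FF E2 v2 (Ex_wrt FF g12)) ipC.
      have mc := L2_measurable (L2_cst P 0).
      by rewrite (ip_ae (L2_measurable Ev) mc (L2_measurable E2) v0) ip0l.
    have Lc := Lr0_centered v2; have [c2 _] := Lc.
    have eqv : v = v \- Ex 0 v %[ae P].
      by apply: filterS v0 => x /(_ I) e _ /=; rewrite e subr0.
    rewrite -(g1E v v2); apply: (phi_eq _ _ (H_J Lv) (H_J Lc)) => n.
    exact: (Ex_ae n v2 c2 eqv).
  exists (g1 \- Ex 0 g1) => //; apply/XE; split => //.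
  apply: (le_lt_trans (converse _ _ g2 CD0 (pair_le phi _ _ CD0 bd ep g2))).
  exact: ltry.
exists (Cc * C)^-1, (Cd * C); split.
- by rewrite invr_gt0 mulr_gt0.
- by rewrite mulr_gt0.
move=> g phi Xg pc ep; have [[g2 g0] gfin] := (XE g).1 Xg.
have [D D0 [DE bd]] := ball phi pc.
have CD0 : 0 <= C * D by rewrite mulr_ge0 // ltW.
have ME : NX g = (fine (NX g))%:E by rewrite fineK // ge0_fin_numE.
have M0 : 0 <= fine (NX g) by exact: fine_ge0.
split.
  have := converse g _ g2 CD0 (pair_le phi _ _ CD0 bd ep g2).
  rewrite DE ME -EFinM !lee_fin ler_pdivrMl ?mulr_gt0 //.
  by rewrite mulrA.
have [psi [slin sbd se]] := ext g Xg.
have sc := continuous_of_bound slin sbd.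
apply: ge_ereal_sup => _ [f [Hf f1] <-].
rewrite -(uniq phi psi g pc sc ep se f Hf) ME -EFinM lee_fin.
apply: (le_trans (sbd f Hf)).
rewrite (NE Hf) lee_fin in f1; rewrite (mulrAC Cd); apply: ler_piMr => //.
by apply: mulr_ge0 => //; apply: mulr_ge0; exact: ltW.
Qed.

End duality.

Lemma pairing_const (R : realType) (a M c : R) (X Y Z : \bar R) : 0 <= a -> 0 <= M ->
  (X <= (a * M)%:E * Y)%E -> (Y <= c%:E * Z)%E -> (X <= (a * c * M)%:E * Z)%E.
Proof.
move=> a0 M0 XY YZ; apply: (le_trans XY).
rewrite mulrAC (EFinM (a * M) c) -muleA; apply: lee_wpmul2l => //.
by rewrite lee_fin mulr_ge0.
Qed.

Theorem theorem1p3 (R : realType) (d : measure_display) (T : measurableType d)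
    (P : probability T R) (F : nat -> set (set T)) (p q alpha : R)
    (Pcomplete : measure_is_complete P) (Ffiltration : filtration F)
    (p_gt0 : 0 < p) (p_le1 : p <= 1) (alphaE : alpha = p^-1 - 1) :
  (0 < q -> q <= 1 ->
     dual_is P F (hardy P F p q) (hardy_norm P F p q)
       (bmo P F 2 alpha) (bmo_norm P F 2 alpha)) /\
  (1 < q ->
     dual_is P F (hardy P F p q) (hardy_norm P F p q)
       (bmo_q P F 2 q alpha) (bmo_q_norm P F 2 q alpha)).
Proof.
have p2 : p < 2 by apply: (le_lt_trans p_le1); rewrite ltr1n.
split=> [q0 q1|q1].
- have [C2 C20 dyad] := dyadic_le_hardy_norm P Ffiltration p_gt0 q0.
  have [C1 C10 conv] := bmo_norms_le P Ffiltration p_gt0 p2 q0 alphaE.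
  apply: (dual_of_bounds Ffiltration p_gt0 p2 q0).
  + by move=> g; split.
  + by move=> g; exact: (bmo_norm_ge0 P Ffiltration).
  + exists (2 * C2); first by rewrite mulr_gt0.
    move=> g M g2 M0 gM v v2 v0.
    have le := pairing_le_bmo Ffiltration p_gt0 p2 q0 alphaE v2 g2 v0 q1 M0 gM.
    have dv := dyad _ (mart_measurable_seq Ffiltration v2).
    exact: (pairing_const (ler0n R 2) M0 le dv).
  + by exists C1 => // g K g2 K0 bound; have [] := conv g K g2 K0 bound.
have q0 : 0 < q by apply: lt_trans q1.
have [C2 C20 dyad] := dyadic_le_hardy_norm P Ffiltration p_gt0 q0.
have [C1 C10 conv] := bmo_norms_le P Ffiltration p_gt0 p2 q0 alphaE.
apply: (dual_of_bounds Ffiltration p_gt0 p2 q0).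
- by move=> g; split.
- by move=> g; exact: (bmo_q_norm_ge0 P Ffiltration p_gt0 q0 alphaE).
- exists (2 * C2); first by rewrite mulr_gt0.
  move=> g M g2 M0 gM v v2 v0.
  have le := pairing_le_bmo_q Ffiltration p_gt0 p2 q0 alphaE v2 g2 v0 M0 gM.
  have dv := dyad _ (mart_measurable_seq Ffiltration v2).
  exact: (pairing_const (ler0n R 2) M0 le dv).
by exists C1 => // g K g2 K0 bound; have [] := conv g K g2 K0 bound.
Qed.
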